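(* Let $\theta\in\Theta:=\Theta_+\cup\Theta_-$. Then $\mathcal I_0$ is discrete in $(\mathcal I,d_\theta)$ if and only if $\mathcal I$ is a building.
   Context: **Vectorial data.** $I$ is a finite set and $C=(c_{i,j})_{i,j\in I}$ is a Kac--Moody matrix: $c_{i,j}\in\mathbb Z$, $c_{i,i}=2$, $c_{i,j}\le 0$ for $i\neq j$, and $c_{i,j}=0\iff c_{j,i}=0$. $X,Y$ are dual free $\mathbb Z$-modules of finite rank with $\mathbb Z$-linearly independent families $(\alpha_i)_{i\in I}$ in $X$ and $(\alpha_i^\vee)_{i\in I}$ in $Y$ such that $\alpha_j(\alpha_i^\vee)=c_{i,j}$. $\mathbb A=Y\otimes\mathbb R$, with its usual topology; elements of $X$ are linear forms on $\mathbb A$. $r_i(v)=v-\alpha_i(v)\alpha_i^\vee$, and $W^v=\langle r_i\mid i\in I\rangle\subset \mathrm{GL}(\mathbb A)$ (Weyl group), acting on $\mathbb A^*$ by $(w.\alpha)(x)=\alpha(w^{-1}x)$. $\Phi=\{w.\alpha_i\}$ is the set of real roots; for $\alpha=w.\alpha_i\in\Phi$, $\alpha^\vee=w.\alpha_i^\vee$. $Q^\vee=\bigoplus_i\mathbb Z\alpha_i^\vee$ and $W^a=Q^\vee\rtimes W^v$. $\Delta\subset\bigoplus_i\mathbb Z\alpha_i\subset\mathbb A^*$ is the set of all (real and imaginary) roots of the Kac--Moody algebra of $C$. For $\alpha\in\mathbb A^*$, $k\in\mathbb R$: $D(\alpha,k)=\{\alpha(x)+k\ge0\}$, $D^\circ(\alpha,k)=\{\alpha(x)+k>0\}$,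 $M(\alpha,k)=\{\alpha(x)+k=0\}$, and $D(\alpha,+\infty)=D^\circ(\alpha,+\infty)=\mathbb A$. Walls (resp. half-apartments) are the $M(\alpha,k)$ (resp. $D(\alpha,k)$), $\alpha\in\Phi$, $k\in\mathbb Z$. $C^v_f=\{v\mid\alpha_i(v)>0\ \forall i\}$; for $J\subset I$, $F^v(J)=\{v\mid \alpha_i(v)=0\ (i\in J),\ \alpha_i(v)>0\ (i\notin J)\}$. Positive (resp. negative) vectorial faces are the $w.F^v(J)$ (resp. $-w.F^v(J)$), $w\in W^v$; vectorial chambers are the $\pm w.C^v_f$. Tits cone: $\mathcal T=\bigcup_{w}w.\overline{C^v_f}$. A vectorial face is spherical if it meets $\pm\mathring{\mathcal T}$. $x\le y$ means $y-x\in\mathcal T$. A ray or segment through $x\ne y$ from $x$ is preordered if $x\le y$ or $y\le x$, generic if $y-x\in\pm\mathring{\mathcal T}$. **Filters.** A filter lies in a set $Z$ if $Z$ is an element of it; a set (e.g. an apartment) contains a filter if it contains an element of it; a map fixes a filter if it fixes pointwise some element of it. The support of a filter is the smallest affine subspace containing it. $\mathcal F\Cup\mathcal F'=\{E\cup E'\mid E\in\mathcal F,E'\in\mathcal F'\}$. The enclosure $\mathrm{cl}(\mathcal F)$ of a filter on $\mathbb A$ is the filter of sets $E$ containing some $\bigcap_{\alpha\in\Delta}D(\alpha,k_\alpha)\in\mathcal F$ with $k_\alpha\in\mathbb Z\cup\{+\infty\}$ (a set is treated as its principal filter). A sector-face is $f=x+F^v$ ($F^v$ a vectorial face); its germ at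 infinity is the filter of sets containing $x+u+F^v$ for some $u\in\overline{F^v}$. If $F^v$ is a vectorial chamber, $f$ is a sector and its germ is a sector-germ, with the sign of $F^v$; $\pm\infty$ is the germ of $\pm C^v_f$. The face $F(x,F^v)$ is the filter of sets $E$ for which there are $k_\alpha,k'_\alpha\in\mathbb Z\cup\{+\infty\}$ $(\alpha\in\Delta)$ and a neighbourhood $\Omega$ of $x$ with $E\supset\bigcap_{\alpha}(D(\alpha,k_\alpha)\cap D^\circ(\alpha,k'_\alpha))\supset\Omega\cap(x+F^v)$. A chamber (resp. panel) is a face with support $\mathbb A$ (resp. a wall). A chimney is $\mathfrak r(F,F^v)=\mathrm{cl}(F+F^v)$, $F$ a face, $F^v$ a vectorial face; it is splayed if $F^v$ is spherical, solid if the pointwise stabilizer in $W^v$ of the direction of its support is finite. Its germ is the filter of sets belonging to some $\mathfrak r(F+u,F^v)$, $u\in\overline{F^v}$. **Apartments.** $\mathrm{Aut}(\mathbb A)$ is the group of affine bijections of $\mathbb A$ stabilizing $\{(M(\alpha,k),\alpha^\vee)\mid\alpha\in\Phi,k\in\mathbb Z\}$. An apartment of type $\mathbb A$ is a set $A$ with a nonempty set $\mathrm{Isom}^w(\mathbb A,A)$ of bijections $\mathbb A\to A$ forming one orbit $f_0\circ W^a$. A bijection $\phi:A\to A'$ is a Weyl isomorphism (resp. an isomorphism, which here always means vectorially Weyl isomorphism) if $f'^{-1}\circ\phi\circ f\in W^a$ (resp. $\in(W^v\ltimes\mathbb A)\cap\mathrm{Aut}(\mathbb A)$) for $f\in\mathrm{Isom}^w(\mathbb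 A,A)$, $f'\in\mathrm{Isom}^w(\mathbb A,A')$. All above notions, the affine structure and the affine topology are transported to every apartment. **Masure.** A masure of type $\mathbb A$ is a set $\mathcal I$ covered by a family of subsets called apartments such that: (MA1) each apartment has a structure of apartment of type $\mathbb A$. (MA2) If $F$ is a point, a germ of a preordered interval, a generic ray or a solid chimney in an apartment $A$, and $A'$ is another apartment containing $F$, then $A\cap A'$ contains $\mathrm{cl}_A(F)$ and there is a Weyl isomorphism $A\to A'$ fixing $\mathrm{cl}_A(F)$. (MA3) If $\mathfrak R$ is the germ of a splayed chimney and $F$ is a face or a germ of a solid chimney, some apartment contains $\mathfrak R$ and $F$. (MA4) If apartments $A,A'$ contain $\mathfrak R$ and $F$ as in (MA3), there is a Weyl isomorphism $A\to A'$ fixing $\mathrm{cl}_A(\mathfrak R\Cup F)$. (MAO) If $x,y\in A\cap A'$ and $x\le_A y$ then $[x,y]_A=[x,y]_{A'}$. Standing assumptions: $\mathcal I$ is such a masure; each panel lies in the closure of finitely many, and more than $2$, chambers; a group $G$ acts strongly transitively on $\mathcal I$ (it permutes apartments, each $g:A\to g.A$ is an isomorphism of apartments, and all isomorphisms in the axioms are induced by elements of $G$); $\mathbb A$ is identified with a fixed apartment of $\mathcal I$, and the stabilizer of $\mathbb A$ in $G$ induces on $\mathbb A$ the group $W^v\ltimes Y$. $\mathcal I$ is a building if and only if $W^v$ is finite. Sector-germs of $\mathcal I$ are sector-germs of its apartments (a sector-germ contained in an apartment $B$ is a sector-germ of $B$, of the same sign). $\mathcal I_0=G.0$ is the orbit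 of $0\in\mathbb A$ (vertices of type $0$). **Distances.** Let $\mathfrak s$ be a sector-germ of sign $\mathrm{sgn}(\mathfrak s)\in\{+,-\}$, $x\in\mathcal I$, $u\in\overline{C^v_f}$. Choose an apartment $A_1$ containing $x$ and $\mathfrak s$ and an isomorphism $\psi:\mathbb A\to A_1$ with $\psi(\mathrm{sgn}(\mathfrak s)\infty)=\mathfrak s$; then $x+_{\mathfrak s}u:=\psi(\psi^{-1}(x)+\mathrm{sgn}(\mathfrak s)u)$ is independent of choices. $U_{\mathfrak s}(x,x')=\{(u,u')\in\overline{C^v_f}^2\mid x+_{\mathfrak s}u=x'+_{\mathfrak s}u'\}$, which is nonempty. $\Theta_+$ (resp. $\Theta_-$) is the set of pairs $\theta=(|\cdot|,\mathfrak s)$ with $|\cdot|$ a norm on $\mathbb A$ and $\mathfrak s$ a positive (resp. negative) sector-germ of $\mathcal I$. For such $\theta$, $d_\theta(x,x')=\inf\{|u|+|u'|\mid(u,u')\in U_{\mathfrak s}(x,x')\}$ is a distance on $\mathcal I$. *)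

(* Defs.v *)
From HB Require Import structures.
From mathcomp Require Import all_boot all_order all_algebra.
From mathcomp Require Import complex.
From mathcomp Require Import all_classical all_reals all_analysis.
Set Implicit Arguments.
Unset Strict Implicit.
Unset Printing Implicit Defensive.
Import Order.TTheory GRing.Theory Num.Theory.
Import numFieldNormedType.Exports.
Local Open Scope classical_set_scope.
Local Open Scope ring_scope.

(* Bases of the dual lattices are fixed: X = Y = Z^n with the standard pairing.
   The same formula evaluates a in X on Y, on Y (x) R and on Y (x) C. *)
Definition pairing (K : pzRingType) (n : nat) (a : 'rV[int]_n) (v : 'rV[K]_n) : K :=
  \sum_(k < n) (a ord0 k)%:~R * v ord0 k.

Definition lin_indep_Z (I : finType) (n : nat) (a : I -> 'rV[int]_n) : Prop :=
  forall m : I -> int, \sum_i m i *: a i = 0 -> forall i, m i = 0.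

Record kac_moody_matrix (I : finType) (C : I -> I -> int) : Prop := {
  kmm_diag : forall i, C i i = 2;
  kmm_offdiag : forall i j, i != j -> C i j <= 0;
  kmm_zero : forall i j, C i j = 0 <-> C j i = 0 }.

Record rootDatum (I : finType) (n : nat) := RootDatum {
  cartan : I -> I -> int;
  sroot : I -> 'rV[int]_n;
  scoroot : I -> 'rV[int]_n;
  cartanP : kac_moody_matrix cartan;
  sroot_indep : lin_indep_Z sroot;
  scoroot_indep : lin_indep_Z scoroot;
  sroot_scoroot : forall i j, pairing (sroot j) (scoroot i) = cartan i j }.

(* The Kac-Moody algebra with Cartan subalgebra h = Y (x) C: generated by h, e_i, f_i,
   with the Chevalley relations and no nonzero ideal meeting h trivially.
   This determines it up to isomorphism; its roots do not depend on the realization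
   (h, (alpha_i), (alpha_i^vee)), a free one as both families are independent. *)
Record kacMoodyAlgebra (R : realType) (I : finType) (n : nat) (S : rootDatum I n)
    (L : lmodType R[i]) := KacMoodyAlgebra {
  br : L -> L -> L;
  km_h : 'rV[R[i]]_n -> L;
  km_e : I -> L;
  km_f : I -> L;
  br_linearr : forall x, linear (br x);
  br_linearl : forall y, linear (br^~ y);
  br_alt : forall x, br x x = 0;
  br_jacobi : forall x y z, br x (br y z) + br y (br z x) + br z (br x y) = 0;
  km_h_linear : linear km_h;
  km_h_inj : injective km_h;
  km_hh : forall u v, br (km_h u) (km_h v) = 0;
  km_ef : forall i j, br (km_e i) (km_f j) =
    if i == j then km_h (map_mx intr (scoroot S i)) else 0;
  km_he : forall u i, br (km_h u) (km_e i) = pairing (sroot S i) u *: km_e i;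
  km_hf : forall u i, br (km_h u) (km_f i) = - pairing (sroot S i) u *: km_f i;
  km_gen : forall V : set L,
    (forall a x y, V x -> V y -> V (a *: x + y)) ->
    (forall x y, V x -> V y -> V (br x y)) ->
    (forall u, V (km_h u)) -> (forall i, V (km_e i)) -> (forall i, V (km_f i)) ->
    V = setT;
  km_ideal : forall J : set L,
    J 0 -> (forall a x y, J x -> J y -> J (a *: x + y)) ->
    (forall x y, J y -> J (br x y)) ->
    (forall u, J (km_h u) -> km_h u = 0) ->
    forall x, J x -> x = 0 }.

Definition km_roots (R : realType) (I : finType) (n : nat) (S : rootDatum I n)
    (L : lmodType R[i]) (g : kacMoodyAlgebra S L) : set 'rV[int]_n :=
  [set a | [/\ a != 0, exists m : I -> int, a = \sum_i m i *: sroot S i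
    & exists2 x : L, x != 0 &
        forall u, br g (km_h g u) x = pairing a u *: x]].

Definition is_norm (R : realType) (n : nat) (N : 'rV[R]_n -> R) : Prop :=
  [/\ forall u v, N (u + v) <= N u + N v,
      forall (a : R) v, N (a *: v) = `|a| * N v
    & forall v, N v = 0 -> v = 0].

Section Apartment.
Variables (R : realType) (I : finType) (n : nat) (S : rootDatum I n).
Local Notation AA := 'rV[R]_n.
Implicit Types (F : set_system AA) (V : set AA).

Definition form (a : 'rV[int]_n) : AA -> R := pairing a.
Definition vec (y : 'rV[int]_n) : AA := map_mx intr y.
Definition refl (i : I) (v : AA) : AA := v - form (sroot S i) v *: vec (scoroot S i).

(* Words in the involutions r_i: the group W^v they generate. *)
Definition weyl : set (AA -> AA) :=
  [set w | exists s : seq I, w = foldr (fun i h => refl i \o h) idfun s].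

(* alpha = w.alpha_i, i.e. alpha o w = alpha_i, and alpha^vee = w.alpha_i^vee. *)
Definition root_coroot (a : AA -> R) (av : AA) : Prop :=
  exists w i, [/\ weyl w, a \o w = form (sroot S i) & av = w (vec (scoroot S i))].

Definition Phi : set (AA -> R) := [set a | exists av, root_coroot a av].

Definition coroot_lattice : set AA :=
  [set q | exists m : I -> int, q = vec (\sum_i m i *: scoroot S i)].

Definition affine_weyl : set (AA -> AA) :=
  [set h | exists w q, [/\ weyl w, coroot_lattice q & h = fun x => w x + q]].

Definition weyl_translations : set (AA -> AA) :=
  [set h | exists w t, weyl w /\ h = fun x => w x + t].

Definition weyl_Y : set (AA -> AA) :=
  [set h | exists w y, weyl w /\ h = fun x => w x + vec y].

(* k : option int encodes an element of Z u {+oo}, with None for +oo. *)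
Definition half (a : AA -> R) (k : option int) : set AA :=
  if k is Some z then [set x | 0 <= a x + z%:~R] else setT.
Definition ohalf (a : AA -> R) (k : option int) : set AA :=
  if k is Some z then [set x | 0 < a x + z%:~R] else setT.
Definition wall (a : AA -> R) (k : int) : set AA := [set x | a x + k%:~R = 0].

Definition wall_coroots : set (set AA * AA) :=
  [set p | exists a av k, root_coroot a av /\ p = (wall a k, av)].

Definition Aut : set (AA -> AA) :=
  [set h | exists (l : {linear AA -> AA}) (t : AA),
     [/\ h = (fun x => l x + t), bijective h
       & [set (h @` p.1, l p.2) | p in wall_coroots] = wall_coroots]].

Definition vw_aut : set (AA -> AA) := weyl_translations `&` Aut.

(* Signs are booleans: false is +, true is -. *)
Definition sgnR (b : bool) : R := (-1) ^+ b.

Definition Cvf : set AA := [set v | forall i, 0 < form (sroot S i) v].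
Definition Fv (J : {set I}) : set AA :=
  [set v | forall i, if i \in J then form (sroot S i) v = 0
                     else 0 < form (sroot S i) v].
Definition vface (V : set AA) : Prop :=
  exists b w J, weyl w /\ V = [set sgnR b *: w v | v in Fv J].
Definition vchamber (b : bool) (V : set AA) : Prop :=
  exists w, weyl w /\ V = [set sgnR b *: w v | v in Cvf].

Definition tits : set AA := \bigcup_(w in weyl) (w @` closure Cvf).
Definition pm_open_tits : set AA :=
  interior tits `|` [set - v | v in interior tits].
Definition spherical V : Prop := V `&` pm_open_tits !=set0.

Definition translate (x : AA) V : set AA := [set x + v | v in V].
Definition segment (x y : AA) : set AA :=
  [set z | exists2 t : R, 0 <= t <= 1 & z = x + t *: (y - x)].
Definition ray (x y : AA) : set AA :=
  [set z | exists2 t : R, 0 <= t & z = x + t *: (y - x)].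
Definition preordered (x y : AA) : Prop := tits (y - x) \/ tits (x - y).

Definition affine_subspace (E : set AA) : Prop :=
  E !=set0 /\ forall x y (t : R), E x -> E y -> E (x + t *: (y - x)).
Definition is_support F (E : set AA) : Prop :=
  [/\ affine_subspace E, F E
    & forall E', affine_subspace E' -> F E' -> E `<=` E'].

Definition fclosure F : set_system AA :=
  [set Z | exists2 E, F E & closure E `<=` Z].
Definition fadd F V : set_system AA :=
  [set Z | exists2 E, F E & [set x + v | x in E & v in V] `<=` Z].

Definition sector_face_germ (x : AA) V : set_system AA :=
  [set Z | exists2 u, closure V u & translate (x + u) V `<=` Z].
Definition germ_infty (b : bool) : set_system AA :=
  sector_face_germ 0 [set sgnR b *: v | v in Cvf].
Definition sector_germ_model (b : bool) F : Prop :=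
  exists x V, vchamber b V /\ F = sector_face_germ x V.

Section Enclosure.
Variables (L : lmodType R[i]) (g : kacMoodyAlgebra S L).

Definition Delta : set (AA -> R) := [set form a | a in km_roots g].

Definition enclosure F : set_system AA :=
  [set E | exists k : (AA -> R) -> option int,
     let D := \bigcap_(a in Delta) half a (k a) in F D /\ D `<=` E].

Definition face (x : AA) V : set_system AA :=
  [set E | exists (k k' : (AA -> R) -> option int) (Om : set AA),
     let D := \bigcap_(a in Delta) (half a (k a) `&` ohalf a (k' a)) in
     [/\ nbhs x Om, D `<=` E & Om `&` translate x V `<=` D]].
Definition is_face F : Prop := exists x V, vface V /\ F = face x V.
Definition is_chamber F : Prop := is_face F /\ is_support F setT.
Definition is_panel F : Prop :=
  is_face F /\ exists a k, Phi a /\ is_support F (wall a k).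

Definition chimney F V : set_system AA := enclosure (fadd F V).
Definition chimney_germ F V : set_system AA :=
  [set Z | exists2 u, closure V u & chimney (fmap (+%R u) F) V Z].
Definition solid_chimney F V : Prop :=
  exists E, is_support (chimney F V) E /\
    finite_set [set w | weyl w /\ forall x y, E x -> E y -> w (y - x) = y - x].

Definition is_solid_chimney F : Prop := exists F0 V,
  [/\ is_face F0, vface V, solid_chimney F0 V & F = chimney F0 V].
Definition is_solid_chimney_germ F : Prop := exists F0 V,
  [/\ is_face F0, vface V, solid_chimney F0 V & F = chimney_germ F0 V].
Definition is_splayed_chimney_germ F : Prop := exists F0 V,
  [/\ is_face F0, vface V, spherical V & F = chimney_germ F0 V].

(* The germ at x of a preordered interval, the interval being [x,y] or ]x,y]. *)
Definition is_preordered_interval_germ F : Prop := exists x y,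
  [/\ x <> y, preordered x y
    & F = within (segment x y) (nbhs x) \/
      F = within (segment x y `\ x) (nbhs x)].
Definition is_generic_ray F : Prop := exists x y,
  [/\ x <> y, pm_open_tits (y - x) & F = globally (ray x y)].
Definition is_point F : Prop := exists x, F = globally [set x].

Definition MA2_filter F : Prop :=
  [\/ is_point F, is_preordered_interval_germ F, is_generic_ray F
    | is_solid_chimney F].
Definition MA3_filter F : Prop := is_face F \/ is_solid_chimney_germ F.

End Enclosure.
End Apartment.

(* apt is the family of apartments and isom A the orbit Isom^w(AA, A). A filter in
   an apartment is pushed forward to M, so that an apartment A contains the filter U
   exactly when U A. Maps between apartments are maps M -> M considered on A only. *)
Section Masure.
Variables (R : realType) (I : finType) (n : nat) (S : rootDatum I n).
Variables (L : lmodType R[i]) (g : kacMoodyAlgebra S L).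
Variables (M : Type) (apt : set (set M)) (isom : set M -> set ('rV[R]_n -> M)).
Local Notation AA := 'rV[R]_n.
Implicit Types (A : set M) (U : set_system M) (phi : M -> M).

Definition apartment_structure A : Prop :=
  exists f0 : AA -> M, [/\ injective f0, range f0 = A
    & isom A = [set f0 \o w | w in affine_weyl S]].

Definition iso_mod (H : set (AA -> AA)) A A' phi : Prop :=
  forall f f', isom A f -> isom A' f' -> exists2 h, H h & phi \o f = f' \o h.
Definition weyl_iso := iso_mod (affine_weyl S).
Definition vw_iso := iso_mod (vw_aut S).

(* Isomorphisms from the model apartment, for which Isom^w(AA, AA) = W^a. *)
Definition model_iso A (psi : AA -> M) : Prop :=
  forall f, isom A f -> exists2 h, vw_aut S h & psi = f \o h.

Definition in_apartment (P : set_system AA -> Prop) U : Prop :=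
  exists A f F, [/\ apt A, isom A f, P F & U = fmap f F].

Definition fixes phi U : Prop := exists2 E, U E & forall x, E x -> phi x = x.

Definition fcup U U' : set_system M := [set E `|` E' | E in U & E' in U'].

(* cl_A(U), in terms of f in Isom^w(AA, A). *)
Definition encl_by (f : AA -> M) U : set_system M :=
  fmap f (enclosure g [set E | U (f @` E)]).

Definition MA2_data A A' (f : AA -> M) U : Prop :=
  [/\ apt A, apt A', isom A f,
      exists F, MA2_filter g F /\ U = fmap f F & U A'].
Definition MA4_data A A' (f : AA -> M) U U' : Prop :=
  [/\ apt A, apt A', isom A f,
      in_apartment (is_splayed_chimney_germ g) U /\ in_apartment (MA3_filter g) U'
    & [/\ U A, U' A, U A' & U' A']].

Record masure : Prop := {
  masure_cover : \bigcup_(A in apt) A = setT;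
  MA1 : forall A, apt A -> apartment_structure A;
  MA2 : forall A A' f U, MA2_data A A' f U ->
    encl_by f U (A `&` A') /\
    exists phi, weyl_iso A A' phi /\ fixes phi (encl_by f U);
  MA3 : forall U U', in_apartment (is_splayed_chimney_germ g) U ->
    in_apartment (MA3_filter g) U' -> exists A, [/\ apt A, U A & U' A];
  MA4 : forall A A' f U U', MA4_data A A' f U U' ->
    exists phi, weyl_iso A A' phi /\ fixes phi (encl_by f (fcup U U'));
  MAO : forall A A' f f' a b a' b', apt A -> apt A' -> isom A f -> isom A' f' ->
    f a = f' a' -> f b = f' b' -> tits S (b - a) ->
    f @` segment a b = f' @` segment a' b' }.

(* The chambers of M whose closure contains the filter U. *)
Definition chambers_around U : set (set_system M) :=
  [set Ch | exists A f F, [/\ apt A, isom A f, is_chamber g F, Ch = fmap f F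
     & fmap f (fclosure F) `<=` U]].
Definition thick_loc_finite : Prop := forall U, in_apartment (is_panel g) U ->
  finite_set (chambers_around U) /\ (`I_3 #<= chambers_around U)%card.

(* An affine building of type AA: AA is Euclidean, any two faces lie in an apartment,
   and two apartments containing them are isomorphic by a map fixing both. *)
Definition is_building : Prop :=
  [/\ finite_set (@weyl R I n S),
      forall A, apt A -> apartment_structure A,
      forall U U', in_apartment (is_face g) U -> in_apartment (is_face g) U' ->
        exists A, [/\ apt A, U A & U' A]
    & forall A A' U U', apt A -> apt A' ->
        in_apartment (is_face g) U -> in_apartment (is_face g) U' ->
        U A -> U' A -> U A' -> U' A' ->
        exists phi, [/\ weyl_iso A A' phi, fixes phi U & fixes phi U']].

Record strongly_transitive (G : groupType) (act : G -> M -> M) : Prop := {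
  act_one : forall x, act 1%g x = x;
  act_mul : forall a b x, act (a * b)%g x = act a (act b x);
  act_apt : forall a A, apt A -> apt (act a @` A);
  act_iso : forall a A, apt A -> vw_iso A (act a @` A) (act a);
  act_MA2 : forall A A' f U phi, MA2_data A A' f U -> weyl_iso A A' phi ->
    fixes phi (encl_by f U) -> exists a, forall x, A x -> act a x = phi x;
  act_MA4 : forall A A' f U U' phi, MA4_data A A' f U U' -> weyl_iso A A' phi ->
    fixes phi (encl_by f (fcup U U')) -> exists a, forall x, A x -> act a x = phi x }.

(* The stabilizer of the apartment A, identified with AA by iota, induces W^v |x Y. *)
Definition stabilizer_induces_weyl_Y (G : groupType) (act : G -> M -> M)
    A (iota : AA -> M) : Prop :=
  [set h : AA -> AA | exists a, act a @` A = A /\ act a \o iota = iota \o h] = weyl_Y S.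

Definition sector_germ (b : bool) U : Prop := in_apartment (sector_germ_model S b) U.

(* z = x +_s u, for s a sector-germ of sign b. *)
Definition sector_add (b : bool) (s : set_system M) (x : M) (u : AA) (z : M) : Prop :=
  exists A psi a, [/\ apt A, s A & model_iso A psi] /\
    [/\ fmap psi (germ_infty S b) = s, x = psi a & z = psi (a + sgnR R b *: u)].

Definition sector_U (b : bool) (s : set_system M) (x x' : M) : set (AA * AA) :=
  [set p | [/\ closure (Cvf S) p.1, closure (Cvf S) p.2
     & exists z, sector_add b s x p.1 z /\ sector_add b s x' p.2 z]].

Definition dtheta (N : AA -> R) (b : bool) (s : set_system M) (x x' : M) : R :=
  inf [set N p.1 + N p.2 | p in sector_U b s x x'].

End Masure.

Definition orbit_of (G M : Type) (act : G -> M -> M) (x : M) : set M :=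
  range (act^~ x).

(* The subspace topology induced on E by the distance d is discrete. *)
Definition discrete_for (R : realType) (M : Type) (d : M -> M -> R) (E : set M) : Prop :=
  forall x, E x -> exists2 e : R, 0 < e & forall y, E y -> d x y < e -> y = x.

(* Main.v *)
Require Import Defs.
From HB Require Import structures.
From mathcomp Require Import all_boot all_order all_algebra.
From mathcomp Require Import complex.
From mathcomp Require Import all_classical all_reals all_analysis.
From mathcomp Require Import ring lra zify.
Require Import Defs.
Set Implicit Arguments.
Unset Strict Implicit.
Unset Printing Implicit Defensive.
Import Order.TTheory GRing.Theory Num.Theory.
Import numFieldNormedType.Exports.
Local Open Scope classical_set_scope.
Local Open Scope ring_scope.

(* Suppose W finite, and d(x, y) small, with z = x + u = y + u' for the sector-germ s.
   An isomorphism fixing s and z carries an apartment containing s, z and y onto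
   one containing s, z and x. As x lies in the enclosure of z when u is small, it
   fixes x too, so that x and y differ by a short vector of the lattice Y: x = y.
   Moreover every face is then the germ of a splayed chimney, and (MA3), (MA4)
   give the axioms of a building.

   Suppose W infinite, and let x be a vertex in an apartment A containing s. Real
   roots have unbounded heights, so for arbitrarily small u in the open chamber the
   point x + u lies on a wall, and thus is the base point of a panel. Isomorphisms
   fixing s, from A to the apartments containing s and a chamber at that panel, map
   x to vertices y with d(x, y) <= 2|u|. If each of these were x, then by (MAO) each of
   these apartments would contain the sector x + s, a neighbourhood of the panel in
   A, and A would contain all the chambers around the panel: there are at least 3
   of them but only 2 in A. *)

(** * Roots of the Kac-Moody algebra *)

(** Faces and enclosures involve all roots, imaginary ones included, while the algebra is known only
    through its generators and the absence of nonzero ideals missing h. Stability of the roots under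
    W and negation, and the absence of multiples of alpha_i other than its opposite, must be drawn
    from that. For W finite every root is real, so one constant bounds all roots near 0. Roots are
    integral at vertices, so a(z) + k >= 0 and |a(z - x)| < 1 force a(x) + k >= 0: this is why x
    lies in the enclosure of z. For W infinite, infinitely many walls pass through a vertex, and a
    chamber is not determined by finitely many of them. That an apartment has at most two chambers
    at a panel on a wall of alpha_i rests on a uniform estimate: in a positive root other than
    alpha_i, the coefficient of alpha_i is at most a constant times the sum of the others, so that
    its size is visible along the panel itself. The short vector is u = rho/ht(a), where rho is 1 on
    every simple root and a is a real root of large height: a(u) = 1 and a(x) is an integer, so x +
    u or x - u, according to the sign of s, lies on a wall of a. *)

Section Pairing.
Variables (K : pzRingType) (n : nat).
Implicit Types (a b : 'rV[int]_n) (u v : 'rV[K]_n).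

Lemma pairingDr a u v : pairing a (u + v) = pairing a u + pairing a v.
Proof. by rewrite -big_split; apply: eq_bigr => k _; rewrite mxE mulrDr. Qed.

Lemma pairingNr a u : pairing a (- u) = - pairing a u.
Proof. by rewrite -sumrN; apply: eq_bigr => k _; rewrite mxE mulrN. Qed.

Lemma pairing0r a : pairing a (0 : 'rV[K]_n) = 0.
Proof. by rewrite /pairing big1 // => k _; rewrite mxE mulr0. Qed.

Lemma pairingDl a b u : pairing (a + b) u = pairing a u + pairing b u.
Proof. by rewrite -big_split; apply: eq_bigr => k _; rewrite mxE rmorphD mulrDl. Qed.

Lemma pairingNl a u : pairing (- a) u = - pairing a u.
Proof. by rewrite -sumrN; apply: eq_bigr => k _; rewrite mxE rmorphN mulNr. Qed.

Lemma pairing0l u : pairing 0 u = 0.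
Proof. by rewrite /pairing big1 // => k _; rewrite mxE mul0r. Qed.

Lemma pairingZl (m : int) a u : pairing (m *: a) u = m%:~R * pairing a u.
Proof.
rewrite mulr_sumr; apply: eq_bigr => k _.
by rewrite mxE intrM mulrA.
Qed.

Lemma pairing_suml (J : Type) (r : seq J) (P : pred J) (a : J -> 'rV[int]_n) u :
  pairing (\sum_(j <- r | P j) a j) u = \sum_(j <- r | P j) pairing (a j) u.
Proof.
elim/big_rec2: _ => [|j x y _ <-]; [exact: pairing0l|exact: pairingDl].
Qed.

Lemma pairing_intr a (y : 'rV[int]_n) :
  pairing a (map_mx intr y : 'rV[K]_n) = (pairing a y)%:~R.
Proof.
rewrite rmorph_sum; apply: eq_bigr => k _ /=.
by rewrite mxE intrM intz.
Qed.

End Pairing.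

Lemma pairingZr (K : comPzRingType) n (a : 'rV[int]_n) (c : K) u :
  pairing a (c *: u) = c * pairing a u.
Proof. by rewrite mulr_sumr; apply: eq_bigr => k _; rewrite mxE mulrCA. Qed.

Lemma pairing_neq (K : numFieldType) n (a b : 'rV[int]_n) :
  a != b -> exists u : 'rV[K]_n, pairing a u != pairing b u.
Proof.
move=> ab; have [k akbk] : exists k, a ord0 k != b ord0 k.
  apply/existsP; apply: contraR ab => /existsPn H.
  by apply/eqP/rowP => k; have /negPn/eqP := H k.
have E c : pairing c (\row_j (j == k)%:R : 'rV[K]_n) = (c ord0 k)%:~R.
  rewrite /pairing (bigD1 k) //= mxE eqxx mulr1 big1 ?addr0 // => j jk.
  by rewrite mxE (negPf jk) mulr0.
by exists (\row_j (j == k)%:R); rewrite !E eqr_int.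
Qed.

(** * Linear spans as an inductive predicate *)

Section Span.
Variables (K : fieldType) (L : lmodType K).
Implicit Types (P Q : L -> Prop) (T : L -> L).

Inductive lspan P : L -> Prop :=
| lspan_zero : lspan P 0
| lspan_cons a x y of P x & lspan P y : lspan P (a *: x + y).

Lemma lspan_gen P x : P x -> lspan P x.
Proof. by move=> Px; rewrite -[x]addr0 -[x]scale1r; constructor => //; constructor. Qed.

Lemma lspan_lin P a x y : lspan P x -> lspan P y -> lspan P (a *: x + y).
Proof.
move=> Px Py; elim: Px => [|c z t Pz _ IH]; first by rewrite scaler0 add0r.
by rewrite scalerDr scalerA -addrA; constructor.
Qed.

Lemma lspanD P x y : lspan P x -> lspan P y -> lspan P (x + y).
Proof. by move=> Px Py; rewrite -[x]scale1r; apply: lspan_lin. Qed.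

Lemma lspanZ P a x : lspan P x -> lspan P (a *: x).
Proof. by move=> Px; rewrite -[_ *: x]addr0; apply: lspan_lin => //; constructor. Qed.

Lemma linear_at0 T : linear T -> T 0 = 0.
Proof.
move=> lT; have := lT 1 0 0; rewrite !scale1r addr0 => /eqP.
by rewrite -subr_eq0 opprD addNKr oppr_eq0 => /eqP.
Qed.

Lemma lspan_map P Q T : linear T -> (forall x, P x -> lspan Q (T x)) ->
  forall x, lspan P x -> lspan Q (T x).
Proof.
move=> lT PQ x; elim => [|a y z Py _ IH]; first by rewrite linear_at0 //; constructor.
by rewrite lT; apply: lspan_lin => //; apply: PQ.
Qed.

Lemma lspan_sub P Q : (forall x, P x -> lspan Q x) -> forall x, lspan P x -> lspan Q x.
Proof. by move=> PQ; apply: (@lspan_map P Q id). Qed.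

Lemma lspan_nz P x : lspan P x -> lspan (fun y => P y /\ y != 0) x.
Proof.
apply: lspan_sub => y Py; have [->|y0] := eqVneq y 0; first by constructor.
exact: lspan_gen.
Qed.

End Span.

(** The relations alone, without generation or the condition on ideals: in this form they also hold
    in the product of two copies of the algebra, where the graph of the Chevalley involution
    lives. *)
Record chevalley (K : numFieldType) (I : finType) n (S : rootDatum I n)
    (L : lmodType K) (br : L -> L -> L) (h : 'rV[K]_n -> L) (e f : I -> L) : Prop := {
  ch_linearr : forall x, linear (br x);
  ch_linearl : forall y, linear (br^~ y);
  ch_alt : forall x, br x x = 0;
  ch_jacobi : forall x y z, br x (br y z) + br y (br z x) + br z (br x y) = 0;
  ch_h_linear : forall a u v, h (a *: u + v) = a *: h u + h v;
  ch_hh : forall u v, br (h u) (h v) = 0;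
  ch_ef : forall i j, br (e i) (f j) =
    if i == j then h (map_mx intr (scoroot S i)) else 0;
  ch_he : forall u i, br (h u) (e i) = pairing (sroot S i) u *: e i;
  ch_hf : forall u i, br (h u) (f i) = - pairing (sroot S i) u *: f i }.

(** * Weights and the triangular decomposition *)

Section Chevalley.
Variables (K : numFieldType) (I : finType) (n : nat) (S : rootDatum I n).
Variables (L : lmodType K) (br : L -> L -> L) (h : 'rV[K]_n -> L) (e f : I -> L).
Hypothesis C : chevalley S br h e f.
Local Notation al := (sroot S).
Let linr := ch_linearr C.
Let linl := ch_linearl C.

Lemma br0r x : br x 0 = 0. Proof. exact: linear_at0. Qed.
Lemma br0l y : br 0 y = 0. Proof. exact: (@linear_at0 _ _ (br^~ y)). Qed.
Lemma brDr x y z : br x (y + z) = br x y + br x z.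
Proof. by have := linr x 1 y z; rewrite !scale1r. Qed.
Lemma brDl x y z : br (x + y) z = br x z + br y z.
Proof. by have := linl z 1 x y; rewrite !scale1r. Qed.
Lemma brZr a x y : br x (a *: y) = a *: br x y.
Proof. by have := linr x a y 0; rewrite !addr0 br0r addr0. Qed.
Lemma brZl a x y : br (a *: x) y = a *: br x y.
Proof. by have := linl y a x 0; rewrite !addr0 br0l addr0. Qed.
Lemma brNr x y : br x (- y) = - br x y.
Proof. by rewrite -scaleN1r brZr scaleN1r. Qed.
Lemma brC x y : br x y = - br y x.
Proof.
apply/eqP; rewrite -addr_eq0; have := ch_alt C (x + y).
by rewrite brDl !brDr !(ch_alt C) add0r addr0 => ->.
Qed.
Lemma br_br x y z : br x (br y z) = br (br x y) z + br y (br x z).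
Proof.
have /eqP := ch_jacobi C x y z; rewrite -addrA addr_eq0 => /eqP ->.
by rewrite opprD addrC (brC z) opprK (brC z x) brNr opprK.
Qed.
Lemma hN u : h (- u) = - h u.
Proof.
have h0 : h 0 = 0.
  have := ch_h_linear C 1 0 0; rewrite !scale1r addr0 => /eqP.
  by rewrite -subr_eq0 opprD addNKr oppr_eq0 => /eqP.
by have := ch_h_linear C (-1) u 0; rewrite !scaleN1r h0 !addr0.
Qed.

Definition weight a x := forall u, br (h u) x = pairing a u *: x.

Lemma weight_br a b x y : weight a x -> weight b y -> weight (a + b) (br x y).
Proof.
move=> wx wy u; rewrite br_br wx wy brZl brZr -scalerDl pairingDl //.
Qed.

Lemma weight_e i : weight (al i) (e i). Proof. by move=> u; rewrite (ch_he C). Qed.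
Lemma weight_f i : weight (- al i) (f i).
Proof. by move=> u; rewrite (ch_hf C) pairingNl. Qed.
Lemma weight_h u : weight 0 (h u).
Proof. by move=> v; rewrite (ch_hh C) pairing0l scale0r. Qed.

(** Weight spaces are independent. If [a] were not in [Om], a product of operators ad h(u) - b(u),
    one for each summand of x, with u separating [a] from its weight b, would kill x and yet act on
    weight [a] by a nonzero scalar. *)
Lemma weight_lspan (Om : 'rV[int]_n -> Prop) a x :
  lspan (fun y => exists2 b, Om b & weight b y) x -> weight a x -> x != 0 -> Om a.
Proof.
move=> sx wx; apply: contra_neqP => NOm.
suff [T [chi [lT Tx Tw ca]]] : exists (T : L -> L) (chi : 'rV[int]_n -> K),
    [/\ linear T, T x = 0, forall b y, weight b y -> T y = chi b *: y & chi a != 0].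
  have := Tw a x wx; rewrite Tx => /esym/eqP.
  by rewrite scaler_eq0 (negPf ca) => /eqP.
elim: sx => [|c y z [b Omb wy] _ [T [chi [lT Tz Tw ca]]]].
  by exists (fun x => x), (fun=> 1); split => // *; rewrite ?scale1r ?oner_eq0.
have [u abu] : exists u : 'rV[K]_n, pairing a u != pairing b u.
  by apply: pairing_neq; apply: contra_notN NOm => /eqP ->.
exists (fun x => br (h u) (T x) - pairing b u *: T x).
exists (fun d => (pairing d u - pairing b u) * chi d); split => //.
- move=> k s t; rewrite !lT !linr !scalerDr opprD addrACA; congr (_ + _).
  by rewrite scalerN !scalerA mulrC.
- rewrite lT Tz addr0 (Tw b) // !brZr wy.
  rewrite !scalerA -scalerBl.
  by have -> : c * chi b * pairing b u - pairing b u * c * chi b = 0;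
    [ring|rewrite scale0r].
- move=> d t wt; rewrite (Tw d) // brZr wt !scalerA -scalerBl; congr (_ *: _).
  by rewrite mulrBl [pairing d u * _]mulrC.
- by rewrite mulf_neq0 // subr_eq0.
Qed.

Definition ebr i s := foldr (fun j => br (e j)) (e i) s.
Definition fbr i s := foldr (fun j => br (f j)) (f i) s.
Definition wt (s : seq I) : 'rV[int]_n := \sum_(j <- s) al j.

Lemma weight_ebr i s : weight (wt (i :: s)) (ebr i s).
Proof.
elim: s => [|j s IH] /=; first by rewrite /wt big_seq1; apply: weight_e.
have -> : wt [:: i, j & s] = al j + wt (i :: s) by rewrite /wt !big_cons addrCA.
by apply: weight_br => //; apply: weight_e.
Qed.

Lemma weight_fbr i s : weight (- wt (i :: s)) (fbr i s).
Proof.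
elim: s => [|j s IH] /=; first by rewrite /wt big_seq1; apply: weight_f.
have -> : wt [:: i, j & s] = al j + wt (i :: s) by rewrite /wt !big_cons addrCA.
by rewrite opprD; apply: weight_br => //; apply: weight_f.
Qed.

(** Spanning vectors of the three pieces n+, h and n- of the triangular decomposition. *)
Definition tri x := [\/ exists i s, x = ebr i s, exists u, x = h u |
  exists i s, x = fbr i s].

Lemma tri_e i x : tri x -> lspan tri (br (e i) x).
Proof.
case=> [[j [s ->]]|[u ->]|[j [s ->]]].
- by apply: lspan_gen; constructor 1; exists j, (i :: s).
- rewrite brC (ch_he C) -scaleN1r; do 2!apply: lspanZ; apply: lspan_gen.
  by constructor 1; exists i, [::].
(* Keeping the brackets of the e's out of the target lets the induction apply [br (f k)] without
   knowing [tri_f]. *)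
suff: lspan (fun x => (exists u, x = h u) \/ exists i s, x = fbr i s)
    (br (e i) (fbr j s)).
  by apply: lspan_sub => y [|] ?; apply: lspan_gen; [constructor 2|constructor 3].
elim: s => [|k s IH] /=.
  rewrite (ch_ef C); case: eqP => _; last by constructor.
  by apply: lspan_gen; left; eexists.
rewrite br_br; apply: lspanD.
  rewrite (ch_ef C); case: eqP => _; last by rewrite br0l; constructor.
  by rewrite weight_fbr; apply: lspanZ; apply: lspan_gen; right; exists j, s.
apply: lspan_map IH => // y [[u ->]|[l [t ->]]]; last first.
  by apply: lspan_gen; right; exists l, (k :: t).
rewrite brC (ch_hf C) -scaleN1r; do 2!apply: lspanZ; apply: lspan_gen.
by right; exists k, [::].
Qed.


Lemma tri_f i x : tri x -> lspan tri (br (f i) x).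
Proof.
case=> [[j [s ->]]|[u ->]|[j [s ->]]]; last first.
- by apply: lspan_gen; constructor 3; exists j, (i :: s).
- rewrite brC (ch_hf C) -scaleN1r; do 2!apply: lspanZ; apply: lspan_gen.
  by constructor 3; exists i, [::].
suff: lspan (fun x => (exists u, x = h u) \/ exists i s, x = ebr i s)
    (br (f i) (ebr j s)).
  by apply: lspan_sub => y [|] ?; apply: lspan_gen; [constructor 2|constructor 1].
elim: s => [|k s IH] /=.
  rewrite brC (ch_ef C) -scaleN1r; apply: lspanZ; case: eqP => _; last by constructor.
  by apply: lspan_gen; left; eexists.
rewrite br_br; apply: lspanD.
  rewrite [br (f i) _]brC (ch_ef C) -scaleN1r brZl; apply: lspanZ.
  case: eqP => _; last by rewrite br0l; constructor.
  by rewrite weight_ebr; apply: lspanZ; apply: lspan_gen; right; exists j, s.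
apply: lspan_map IH => // y [[u ->]|[l [t ->]]]; last first.
  by apply: lspan_gen; right; exists l, (k :: t).
rewrite brC (ch_he C) -scaleN1r; do 2!apply: lspanZ; apply: lspan_gen.
by right; exists k, [::].
Qed.

Lemma tri_h u x : tri x -> lspan tri (br (h u) x).
Proof.
case=> [[j [s ->]]|[v ->]|[j [s ->]]].
- rewrite weight_ebr; apply/lspanZ/lspan_gen; constructor 1; by exists j, s.
- by rewrite (ch_hh C); constructor.
- rewrite weight_fbr; apply/lspanZ/lspan_gen; constructor 3; by exists j, s.
Qed.

(** When J is a linear subspace these elements form a subalgebra, so that invariance of J under all
    of L can be checked on the generators. *)
Definition stab (J : L -> Prop) x := forall y, J y -> J (br x y).

Lemma stab_br (J : L -> Prop) : (forall a x y, J x -> J y -> J (a *: x + y)) ->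
  forall x y, stab J x -> stab J y -> stab J (br x y).
Proof.
move=> Jl x y sx sy z Jz; have -> : br (br x y) z = -1 *: br y (br x z) + br x (br y z).
  by rewrite scaleN1r (br_br x) addrC addrK.
by apply: Jl; [apply: sy; apply: sx|apply: sx; apply: sy].
Qed.

Lemma stab_lin (J : L -> Prop) : (forall a x y, J x -> J y -> J (a *: x + y)) ->
  forall a x y, stab J x -> stab J y -> stab J (a *: x + y).
Proof. by move=> Jl a x y sx sy z Jz; rewrite brDl brZl; apply: Jl; auto. Qed.

Lemma lspan_tri_br x y : lspan tri x -> lspan tri y -> lspan tri (br x y).
Proof.
have se i : stab (lspan tri) (e i) by move=> z; apply: lspan_map => //; apply: tri_e.
have sf i : stab (lspan tri) (f i) by move=> z; apply: lspan_map => //; apply: tri_f.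
move=> tx; elim: tx y => [|a {}x z tx _ IH] y ty; first by rewrite br0l; constructor.
rewrite brDl brZl; apply: lspan_lin (IH _ ty).
suff: stab (lspan tri) x by apply.
case: tx => [[i [s ->]]|[u ->]|[i [s ->]]].
- by elim: s => //= j s IHs; apply: stab_br => //; apply: lspan_lin.
- by move=> t; apply: lspan_map => //; apply: tri_h.
- by elim: s => //= j s IHs; apply: stab_br => //; apply: lspan_lin.
Qed.

Lemma wt_coef s : wt s = \sum_i (count_mem i s)%:Z *: al i.
Proof.
rewrite /wt; elim: s => [|j s IH].
  by rewrite big_nil big1 // => i _; rewrite scale0r.
rewrite big_cons IH [RHS](eq_bigr (fun i => (i == j)%:Z *: al i + (count_mem i s)%:Z *: al i)).
  rewrite big_split /= [X in _ = X + _](bigD1 j) //= eqxx scale1r.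
  rewrite [X in _ = _ + X + _]big1 ?addr0 // => i ij.
  by rewrite (negPf ij) scale0r.
by move=> i _ /=; rewrite PoszD scalerDl eq_sym.
Qed.

Lemma wt_cons_neq0 i s : wt (i :: s) != 0.
Proof.
apply/eqP; rewrite wt_coef => /(sroot_indep (r:=S)) /(_ i) /=.
by rewrite eqxx.
Qed.

(** The iterated brackets have nonzero weights, as the simple roots are independent; by
    [weight_lspan] their contribution to a vector of weight 0 vanishes. *)
Lemma weight0_tri x : lspan tri x -> weight 0 x -> exists u, x = h u.
Proof.
move=> tx w0.
have [u [y [xE ty]]] : exists u y, x = h u + y /\
    lspan (fun y => exists2 b, b != 0 & weight b y) y.
  elim: tx => [|a z t tz _ [u [y [-> ty]]]].
    exists 0, 0; split; last by constructor.
    by rewrite addr0; apply/esym; have := hN 0; rewrite oppr0 => /eqP;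
       rewrite -addr_eq0 -mulr2n -scaler_nat scaler_eq0 pnatr_eq0 => /eqP.
  case: tz => [[j [s ->]]|[v ->]|[j [s ->]]].
  - exists u, (a *: ebr j s + y); split; first by rewrite addrCA.
    apply: lspan_cons => //; exists (wt (j :: s)); first exact: wt_cons_neq0.
    exact: weight_ebr.
  - by exists (a *: v + u), y; rewrite (ch_h_linear C) addrA.
  - exists u, (a *: fbr j s + y); split; first by rewrite addrCA.
    apply: lspan_cons => //; exists (- wt (j :: s)).
      by rewrite oppr_eq0 wt_cons_neq0.
    exact: weight_fbr.
exists u; suff: y = 0 by move=> y0; rewrite xE y0 addr0.
apply: contrapT => /eqP y0.
have wy : weight 0 y.
  move=> v; move: (w0 v); rewrite xE brDr weight_h.
  by rewrite !pairing0l !scale0r add0r.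
by have /eqP := weight_lspan ty wy y0.
Qed.

(** The coefficient is used in both ways: it vanishes at k = q, which yields the Serre relations,
    and is nonzero for natural numbers k < q, which keeps root strings alive. *)
Lemma sl2_string i y q k : br (e i) y = 0 ->
  br (h (map_mx intr (scoroot S i))) y = q *: y ->
  br (e i) (iter k.+1 (br (f i)) y) =
    (k.+1%:R * (q - k%:R)) *: iter k (br (f i)) y.
Proof.
move=> ey hy; set H := h _ in hy.
have wk j : br H (iter j (br (f i)) y) = (q - j%:R *+ 2) *: iter j (br (f i)) y.
  elim: j => [|j IH]; first by rewrite mul0rn subr0.
  rewrite iterS br_br IH brZr (ch_hf C) brZl -scalerDl; congr (_ *: _).
  rewrite pairing_intr sroot_scoroot (kmm_diag (cartanP S)).
  by rewrite -natr1; ring.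
elim: k => [|k IH].
  by rewrite /= br_br (ch_ef C) eqxx ey br0r addr0 hy mul1r subr0.
rewrite iterS br_br (ch_ef C) eqxx wk IH brZr -iterS -scalerDl; congr (_ *: _).
rewrite -!natr1; ring.
Qed.

End Chevalley.

(** * Signs, multiples and reflections of roots *)

Section KacMoody.
Variables (R : realType) (I : finType) (n : nat) (S : rootDatum I n).
Variables (L : lmodType R[i]).
Implicit Types (g : kacMoodyAlgebra S L).
Local Notation al := (sroot S).
Local Notation alv := (scoroot S).

Lemma km_chevalley g : chevalley S (br g) (km_h g) (km_e g) (km_f g).
Proof.
split; [exact: br_linearr|exact: br_linearl|exact: br_alt|exact: br_jacobi|
  exact: km_h_linear|exact: km_hh|exact: km_ef|exact: km_he|exact: km_hf].
Qed.

Lemma km_rootsE g a : km_roots g a <->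
  [/\ a != 0, exists m : I -> int, a = \sum_i m i *: al i
    & exists2 x, x != 0 & weight (br g) (km_h g) a x].
Proof. by []. Qed.

Lemma km_span g x : lspan (tri (br g) (km_h g) (km_e g) (km_f g)) x.
Proof.
have C := km_chevalley g.
suff -> : lspan (tri (br g) (km_h g) (km_e g) (km_f g)) = setT by [].
apply: (km_gen (k := g)) => [a y z|y z|u|i|i].
- exact: lspan_lin.
- exact: (lspan_tri_br C).
- by apply: lspan_gen; constructor 2; exists u.
- by apply: lspan_gen; constructor 1; exists i, [::].
- by apply: lspan_gen; constructor 3; exists i, [::].
Qed.

Lemma km_e_neq0 g i : km_e g i != 0.
Proof.
have C := km_chevalley g.
apply/eqP => e0; have := km_ef g i i; rewrite eqxx e0 (br0l C) => /esym.
have h0 : km_h g 0 = 0 by have := hN C 0; rewrite oppr0 => /eqP; rewrite -addr_eq0 -mulr2n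
  -scaler_nat scaler_eq0 pnatr_eq0 => /eqP.
rewrite -h0 => /(@km_h_inj _ _ _ _ _ g) a0.
have := sroot_scoroot S i i; rewrite (kmm_diag (cartanP S)).
have -> : alv i = 0; last by rewrite pairing0r.
apply/rowP => k; have := congr1 (fun v : 'rV_n => v ord0 k) a0; rewrite !mxE.
by move/eqP; rewrite intr_eq0 => /eqP.
Qed.

Definition qsum (m : I -> nat) : 'rV[int]_n := \sum_i (m i)%:Z *: al i.

Lemma km_roots_wt g a : km_roots g a ->
  (exists i s, ebr (br g) (km_e g) i s != 0 /\ a = wt S (i :: s)) \/
  (exists i s, fbr (br g) (km_f g) i s != 0 /\ a = - wt S (i :: s)).
Proof.
have C := km_chevalley g.
case/km_rootsE => a0 _ [x x0 wx].
pose Om b := [\/ b = 0,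
  exists i s, ebr (br g) (km_e g) i s != 0 /\ b = wt S (i :: s) |
  exists i s, fbr (br g) (km_f g) i s != 0 /\ b = - wt S (i :: s)].
suff [/eqP|?|?] : Om a by [rewrite (negPf a0)|left|right].
apply: (weight_lspan C (Om := Om) _ wx x0).
apply: lspan_sub (lspan_nz (km_span g x)) => y [ty y0]; apply: lspan_gen.
case: ty => [[i [s E]]|[u E]|[i [s E]]]; move: y0; rewrite E => y0.
- exists (wt S (i :: s)); last exact: weight_ebr C _ _.
  by constructor 2; exists i, s.
- by exists 0; [constructor 1|exact: weight_h C _].
- exists (- wt S (i :: s)); last exact: weight_fbr C _ _.
  by constructor 3; exists i, s.
Qed.

Lemma km_roots_sign g a : km_roots g a ->
  exists m, a = qsum m \/ a = - qsum m.
Proof.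
by case/km_roots_wt => [[i [s [_ ->]]]|[i [s [_ ->]]]];
  exists (fun j => count_mem j (i :: s)); rewrite wt_coef; [left|right].
Qed.

Lemma qsum_inj m m' : qsum m = qsum m' -> m = m'.
Proof.
move/eqP; rewrite -subr_eq0 -sumrB => /eqP H.
apply/funext => i.
have := @sroot_indep _ _ S (fun i => (m i)%:Z - (m' i)%:Z).
rewrite (eq_bigr (fun i => (m i)%:Z *: al i - (m' i)%:Z *: al i)); last first.
  by move=> j _; rewrite scalerBl.
by move/(_ H i)/eqP; rewrite subr_eq0 eqz_nat => /eqP.
Qed.

Lemma wt_cat s t : wt S (s ++ t) = wt S s + wt S t.
Proof. by rewrite /wt big_cat. Qed.

Lemma wt_nseq c i : wt S (nseq c i) = c%:Z *: al i.
Proof.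
elim: c => [|c IH]; first by rewrite /wt big_nil scale0r.
by rewrite -[nseq _ _]/([:: i] ++ nseq c i) wt_cat IH /wt big_seq1 intS scalerDl scale1r.
Qed.

Lemma wt_multiple (c : nat) i j s : wt S (j :: s) = c%:Z *: al i ->
  [/\ j = i, s = nseq (size s) i & c = (size s).+1].
Proof.
rewrite wt_coef => H.
have E : (fun k => count_mem k (j :: s)) = (fun k => if k == i then c else 0)%N.
  apply: qsum_inj.
  rewrite /qsum H [RHS](bigD1 i) //= eqxx big1 ?addr0 // => k ki.
  by rewrite (negPf ki) scale0r.
have E' k : count_mem k (j :: s) = if k == i then c else 0 := congr1 (fun h => h k) E.
have A : all (pred1 i) (j :: s).
  apply/allP => k ks /=; apply: contraT => ki.
  by have := E' k; rewrite (negPf ki) => /count_memPn; rewrite ks.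
case/andP: (A) => /eqP /= -> /all_pred1P As; split => //.
by have := E' i; rewrite eqxx => <-; move: A; rewrite all_count => /eqP ->.
Qed.

Lemma ebr_nseq g i k : ebr (br g) (km_e g) i (nseq k.+1 i) = 0.
Proof.
have C := km_chevalley g.
by elim: k => [|k IH]; [exact: br_alt|rewrite /ebr /= in IH *; rewrite IH (br0r C)].
Qed.

Lemma fbr_nseq g i k : fbr (br g) (km_f g) i (nseq k.+1 i) = 0.
Proof.
have C := km_chevalley g.
by elim: k => [|k IH]; [exact: br_alt|rewrite /fbr /= in IH *; rewrite IH (br0r C)].
Qed.

(** A bracket whose weight is a multiple of alpha_i involves the letter i only, and [e_i, e_i] =
    [f_i, f_i] = 0 leaves only brackets of length one. *)
Lemma km_roots_multiple g c i : km_roots g (c *: al i) -> c = 1 \/ c = -1.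
Proof.
case/km_roots_wt => [[j [s [nz E]]]|[j [s [nz E]]]].
- left; case: c E => c E; last first.
    exfalso; have /eqP := @wt_cons_neq0 _ _ S j (nseq c.+1 i ++ s); apply.
    have -> : wt S (j :: nseq c.+1 i ++ s) = wt S (j :: s) + c.+1%:Z *: al i.
      by rewrite -cat1s -[j :: s]cat1s !wt_cat wt_nseq addrAC addrA.
    by rewrite -E NegzE scaleNr addNr.
  case: (wt_multiple (esym E)) => ji sn cs; subst j c.
  case: s sn nz {E} => // k s sn; by rewrite sn ebr_nseq eqxx.
- right; case: c E => c E.
    exfalso; have /eqP := @wt_cons_neq0 _ _ S j (nseq c i ++ s); apply.
    have -> : wt S (j :: nseq c i ++ s) = wt S (j :: s) + c%:Z *: al i.
      by rewrite -cat1s -[j :: s]cat1s !wt_cat wt_nseq addrAC addrA.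
    by rewrite E addrN.
  move/eqP: E; rewrite NegzE scaleNr eqr_opp => /eqP E.
  case: (wt_multiple (esym E)) => ji sn cs; subst j; rewrite cs.
  by case: s sn nz {E cs} => // k s sn; rewrite sn fbr_nseq eqxx.
Qed.

Lemma km_dual_ef g i j : br g (km_f g i) (km_e g j) =
  if i == j then km_h g (- map_mx intr (alv i)) else 0.
Proof.
have C := km_chevalley g.
rewrite (brC C) km_ef eq_sym; case: eqP => [->|_]; last by rewrite oppr0.
by rewrite (hN C).
Qed.

Lemma km_dual_h_linear g : linear (fun u => km_h g (- u)).
Proof. by move=> a u v; rewrite opprD -scalerN km_h_linear. Qed.

Lemma km_dual_h_inj g : injective (fun u => km_h g (- u)).
Proof. by move=> u v /km_h_inj /oppr_inj. Qed.

Lemma km_dual_he g u i : br g (km_h g (- u)) (km_f g i) = pairing (al i) u *: km_f g i.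
Proof. by rewrite km_hf pairingNr opprK. Qed.

Lemma km_dual_hf g u i : br g (km_h g (- u)) (km_e g i) = - pairing (al i) u *: km_e g i.
Proof. by rewrite km_he pairingNr. Qed.

Lemma km_dual_gen g (V : set L) :
  (forall a x y, V x -> V y -> V (a *: x + y)) ->
  (forall x y, V x -> V y -> V (br g x y)) ->
  (forall u, V (km_h g (- u))) -> (forall i, V (km_f g i)) ->
  (forall i, V (km_e g i)) -> V = setT.
Proof.
move=> Vl Vb Vh Vf Ve; apply: (km_gen (k := g)) => // u.
by rewrite -[u]opprK.
Qed.

Lemma km_dual_ideal g (J : set L) :
  J 0 -> (forall a x y, J x -> J y -> J (a *: x + y)) ->
  (forall x y, J y -> J (br g x y)) ->
  (forall u, J (km_h g (- u)) -> km_h g (- u) = 0) -> forall x, J x -> x = 0.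
Proof.
move=> J0 Jl Jb Jh; apply: (km_ideal (k := g)) => // u.
by rewrite -[u]opprK; apply: Jh.
Qed.

(** Exchanging e and f and negating h gives a second structure on the same L, with opposite weights:
    results on the f_i transfer to the e_i, and reflections of roots with a(alpha_i^vee) >= 0 to
    those with a(alpha_i^vee) < 0. *)
Definition km_dual g : kacMoodyAlgebra S L :=
  KacMoodyAlgebra (@br_linearr _ _ _ _ _ g) (@br_linearl _ _ _ _ _ g)
    (@br_alt _ _ _ _ _ g) (@br_jacobi _ _ _ _ _ g) (km_dual_h_linear g)
    (@km_dual_h_inj g) (fun u v => km_hh g (- u) (- v)) (km_dual_ef g)
    (km_dual_he g) (km_dual_hf g) (@km_dual_gen g) (@km_dual_ideal g).

Lemma km_roots_dual g a : km_roots (km_dual g) a <-> km_roots g (- a).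
Proof.
split=> /km_rootsE [a0 [m am] [x x0 wx]]; split.
- by rewrite oppr_eq0.
- by exists (fun i => - m i); rewrite am -sumrN; apply: eq_bigr => i _; rewrite scaleNr.
- by exists x => // u; have := wx (- u); rewrite /= opprK pairingNr pairingNl.
- by rewrite -oppr_eq0.
- exists (fun i => - m i); rewrite -[a]opprK am -sumrN.
  by apply: eq_bigr => i _; rewrite scaleNr.
- by exists x => // u; have := wx (- u); rewrite /= pairingNr pairingNl opprK.
Qed.


(* The ideal generated by th is spanned by the iterated brackets of th with the
   f_j, as h and the e_k preserve that span; it therefore misses h. *)
Lemma km_singular_vector g t th : t != [::] -> weight (br g) (km_h g) (- wt S t) th ->
  (forall k, br g (km_e g k) th = 0) -> th = 0.
Proof.
move=> t0 wth eth; have C := km_chevalley g.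
pose fw s := foldr (fun j => br g (km_f g j)) th s.
pose J := lspan (fun y => exists s, y = fw s).
have Jl : forall a x y, J x -> J y -> J (a *: x + y) by exact: lspan_lin.
have wfw s : weight (br g) (km_h g) (- wt S (s ++ t)) (fw s).
  elim: s => //= j s IH; rewrite -cat1s wt_cat opprD.
  by apply: (weight_br C) => //; rewrite /wt big_seq1; apply: (weight_f C).
have stJ (T : L -> L) : linear T -> (forall s, J (T (fw s))) -> forall y, J y -> J (T y).
  by move=> lT H y; apply: (lspan_map lT) => _ [s ->]; apply: H.
have sf i : stab (br g) J (km_f g i).
  apply: stJ => [|s]; first exact: br_linearr.
  by apply: lspan_gen; exists (i :: s).
have sh u : stab (br g) J (km_h g u).
  apply: stJ => [|s]; first exact: br_linearr.
  by rewrite wfw; apply/lspanZ/lspan_gen; exists s.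
have se k : stab (br g) J (km_e g k).
  apply: stJ => [|s]; first exact: br_linearr.
  elim: s => [|j s IH] /=; first by rewrite eth; constructor.
  rewrite (br_br C); apply: lspanD; last exact: sf.
  rewrite km_ef; case: eqP => _; last by rewrite (br0l C); constructor.
  by apply: sh; apply: lspan_gen; exists s.
have sT x : stab (br g) J x.
  suff -> : stab (br g) J = setT by [].
  apply: (km_gen (k := g)) => //; first exact: (stab_lin C).
  exact: (stab_br C).
apply: (km_ideal (k := g) (J := J)) => //.
- by constructor.
- move=> u Ju; apply: contrapT => /eqP u0.
  have := @weight_lspan _ _ _ _ _ _ _ _ _ C (fun b => b != 0) 0 (km_h g u).
  rewrite eqxx => H; apply: notF; apply: H (weight_h C u) u0.
  apply: (lspan_sub _ Ju) => y [s ->]; apply: lspan_gen.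
  exists (- wt S (s ++ t)) => //; rewrite oppr_eq0.
  by case E : (s ++ t) => [|j r]; [case: s t t0 {Ju wth wfw stJ fw J Jl sf sh se sT} E => [|? ?] []|apply: wt_cons_neq0].
- by apply: lspan_gen; exists [::].
Qed.

(** The Serre relations are not among the axioms: the left-hand side is killed by every e_k, so
    [km_singular_vector] makes it vanish. *)
Lemma km_serre g i j : i != j ->
  iter `|1 - cartan S i j|%N (br g (km_f g i)) (km_f g j) = 0.
Proof.
move=> ij; have C := km_chevalley g.
have c0 : cartan S i j <= 0 by apply: (kmm_offdiag (cartanP S)).
have [c cE] : exists c : nat, cartan S i j = - c%:Z.
  by exists `|cartan S i j|%N; rewrite -abszN gez0_abs ?oppr_ge0 // opprK.
have -> : `|1 - cartan S i j|%N = c.+1 by rewrite cE; lia.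
have wth : weight (br g) (km_h g) (- wt S (rcons (nseq c.+1 i) j))
    (iter c.+1 (br g (km_f g i)) (km_f g j)).
  elim: c.+1 => [|k IH] /=.
    by rewrite /wt big_seq1; apply: (weight_f C).
  rewrite -cat1s wt_cat opprD; apply: (weight_br C) => //.
  by rewrite /wt big_seq1; apply: (weight_f C).
apply: (km_singular_vector _ wth) => [|k]; first by rewrite -size_eq0 size_rcons.
have eij : br g (km_e g i) (km_f g j) = 0 by rewrite km_ef (negPf ij).
have [->|ki] := eqVneq k i.
  rewrite (sl2_string C (q := c%:R)) // ?subrr ?mulr0 ?scale0r //.
  rewrite km_hf pairing_intr sroot_scoroot cE; congr (_ *: _).
  by rewrite rmorphN opprK.
have ekf y : br g (km_e g k) (br g (km_f g i) y) = br g (km_f g i) (br g (km_e g k) y).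
  by rewrite (br_br C) km_ef (negPf ki) (br0l C) add0r.
have ekit y m : br g (km_e g k) (iter m (br g (km_f g i)) y) =
    iter m (br g (km_f g i)) (br g (km_e g k) y).
  by elim: m => //= m IH; rewrite ekf IH.
have it0 m : iter m (br g (km_f g i)) 0 = 0 by elim: m => //= m ->; rewrite (br0r C).
rewrite ekit km_ef; case: eqP => [kj|_]; last exact: it0.
(* Here k = j, and one bracket of f_i with h(alpha_j^vee) gives a multiple of f_i with factor
   c_(j,i). Either this factor is 0, because c_(i,j) is, or a further bracket with f_i kills the
   result. *)
rewrite iterSr (brC C) km_hf pairing_intr sroot_scoroot kj.
case: c cE {wth} => [|c] cE.
  have -> : cartan S j i = 0 by apply/(kmm_zero (cartanP S)); rewrite cE.
  by rewrite mulr0z oppr0 scale0r oppr0.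
rewrite iterSr (brNr C) (brZr C) (br_alt g) scaler0 oppr0; exact: it0.
Qed.

Lemma iter_br_leibniz g z N p q x y : (p + q <= N)%N ->
  iter p (br g z) x = 0 -> iter q (br g z) y = 0 -> iter N (br g z) (br g x y) = 0.
Proof.
have C := km_chevalley g.
have it0 m : iter m (br g z) 0 = 0 by elim: m => //= m ->; rewrite (br0r C).
have itD m u v : iter m (br g z) (u + v) = iter m (br g z) u + iter m (br g z) v.
  by elim: m u v => //= m IH u v; rewrite IH (brDr C).
elim: N p q x y => [|N IH] p q x y.
  by rewrite leqn0 addn_eq0 => /andP[/eqP -> _] /= -> _; rewrite (br0l C).
case: p => [|p]; first by move=> _ /= -> _; rewrite (br0l C) it0 (br0r C).
case: q => [|q]; first by move=> _ _ /= ->; rewrite (br0r C) it0 (br0r C).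
move=> pq px qy; rewrite iterSr (br_br C) itD.
rewrite (IH p q.+1) ?(IH p.+1 q) ?addr0 // -?iterSr //; lia.
Qed.

(** By Leibniz, the vectors killed by some power of ad f_i form a subalgebra; it contains the
    generators, the f_j thanks to the Serre relations. *)
Lemma ad_f_nilpotent g i x : exists k, iter k (br g (km_f g i)) x = 0.
Proof.
have C := km_chevalley g; set F := br g (km_f g i).
have it0 m : iter m F 0 = 0 by elim: m => //= m ->; rewrite /F (br0r C).
have itD m a u v : iter m F (a *: u + v) = a *: iter m F u + iter m F v.
  by elim: m u v => //= m IH u v; rewrite IH /F br_linearr.
have grow k m u : iter k F u = 0 -> iter (m + k) F u = 0.
  by rewrite iterD => ->.
suff : [set x | exists k, iter k F x = 0] = setT by move/seteqP => [_ /(_ x)]; apply.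
apply: (km_gen (k := g)) => [a u v [k ku] [m mv]|u v [k ku] [m mv]|u|j|j] /=.
- by exists (m + k)%N; rewrite itD (grow k m) // addnC (grow m k) // scaler0 addr0.
- by exists (k + m)%N; apply: iter_br_leibniz ku mv.
- exists 2%N; rewrite /= /F [br g (km_f g i) (km_h g u)](brC C) km_hf.
  by rewrite (brNr C) (brZr C) br_alt scaler0 oppr0.
- exists 3%N; rewrite /= /F [br g (km_f g i) (km_e g j)](brC C) km_ef.
  case: eqP => _; last by rewrite oppr0 !(br0r C).
  rewrite (brNr C) [br g (km_f g i) (km_h g _)](brC C) km_hf.
  by rewrite opprK (brZr C) br_alt scaler0.
- have [<-|ij] := eqVneq i j; first by exists 1%N; apply: br_alt.
  by eexists; apply: km_serre.
Qed.

Lemma ad_e_nilpotent g i x : exists k, iter k (br g (km_e g i)) x = 0.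
Proof. exact: (ad_f_nilpotent (km_dual g)). Qed.

(** With d = a(alpha_i^vee), climb by e_i to the top y = e_i^p x of the string, which exists by
    nilpotency, then descend d + p times by f_i. As y has eigenvalue d + 2p, [sl2_string] keeps the
    descent nonzero, and it ends in weight a - d alpha_i. *)
Lemma km_roots_refl_ge0 g i a : 0 <= pairing a (alv i) -> km_roots g a ->
  km_roots g (a - pairing a (alv i) *: al i).
Proof.
set c := pairing a (alv i) => c0 /km_rootsE [a0 [m am] [x x0 wx]].
have C := km_chevalley g.
have [d cE] : exists d : nat, c = d%:Z by exists `|c|%N; rewrite gez0_abs.
apply/km_rootsE; split.
- apply/eqP => /eqP; rewrite subr_eq0 => /eqP aE.
  have : c = c * 2 by rewrite {1}/c aE pairingZl sroot_scoroot (kmm_diag (cartanP S)) intz.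
  move=> c2; have c00 : c = 0 by lia.
  by move: a0; rewrite aE c00 scale0r eqxx.
- exists (fun j => m j - (if j == i then c else 0)).
  under eq_bigr do rewrite scalerBl.
  rewrite sumrB -am (bigD1 i) //= eqxx big1 ?addr0 // => j ji.
  by rewrite (negPf ji) scale0r.
have [k kx] := ad_e_nilpotent g i x.
have exP : exists k, iter k (br g (km_e g i)) x == 0 by exists k; apply/eqP.
case: (ex_minnP exP) => [[|p] /eqP px pmin]; first by rewrite /= in px; rewrite px eqxx in x0.
pose y := iter p (br g (km_e g i)) x.
have y0 : y != 0 by apply/negP => /pmin; rewrite ltnn.
have ey : br g (km_e g i) y = 0 by [].
have wE q : weight (br g) (km_h g) (a + q%:Z *: al i) (iter q (br g (km_e g i)) x).
  elim: q => [|q IH]; first by rewrite scale0r addr0.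
  by rewrite intS scalerDl scale1r addrCA; apply: (weight_br C) => //; apply: (weight_e C).
have hy : br g (km_h g (map_mx intr (alv i))) y = (d + p.*2)%:R *: y.
  rewrite wE pairing_intr pairingDl pairingZl sroot_scoroot (kmm_diag (cartanP S)).
  rewrite (_ : pairing a (alv i) = d%:Z) //; congr (_ *: _).
  have -> : d%:Z + p%:~R * 2 = (d + p.*2)%N by lia.
  by rewrite -pmulrn.
have nz q : (q <= d + p.*2)%N -> iter q (br g (km_f g i)) y != 0.
  elim: q => [|q IH] // qd; apply: contraNN (IH (ltnW qd)) => /eqP z.
  have := sl2_string C q ey hy; rewrite z (br0r C) => /esym/eqP.
  rewrite scaler_eq0 mulf_eq0 pnatr_eq0 /= subr_eq0 eqr_nat.
  by rewrite gtn_eqF.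
exists (iter (d + p) (br g (km_f g i)) y); first by apply: nz; lia.
have -> : a - c *: al i = a + p%:Z *: al i - (d + p)%N%:Z *: al i.
  by rewrite cE PoszD scalerDl opprD addrACA subrr addr0.
elim: (d + p)%N => [|q IH]; first by rewrite scale0r subr0; apply: wE.
rewrite intS scalerDl scale1r opprD addrCA /=.
by apply: (weight_br C) => //; apply: (weight_f C).
Qed.

Lemma km_roots_refl g i a : km_roots g a -> km_roots g (a - pairing a (alv i) *: al i).
Proof.
move=> ra; have [c0|c0] := leP 0 (pairing a (alv i)); first exact: km_roots_refl_ge0.
have : km_roots (km_dual g) (- a) by apply/km_roots_dual; rewrite opprK.
move/km_roots_refl_ge0 => /(_ i); rewrite pairingNl oppr_ge0 => /(_ (ltW c0)).
by move/km_roots_dual; rewrite opprD opprK scaleNr !opprK.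
Qed.


(** * The Chevalley involution and opposite roots *)

Section Graph.
Variable g : kacMoodyAlgebra S L.
Let br2 (p q : L * L) := (br g p.1 q.1, br g p.2 q.2).
Let h2 u := (km_h g u, km_h g (- u)).
Let e2 i := (km_e g i, km_f g i).
Let f2 i := (km_f g i, km_e g i).

Let chevalley2 : chevalley S br2 h2 e2 f2.
Proof.
have C := km_chevalley g; have C' := km_chevalley (km_dual g).
split=> [p a q r|p a q r|p|p q r|a u v|u v|i j|u i|u i].
- by congr (_, _); apply: br_linearr.
- by congr (_, _); rewrite /= (brDl C) (brZl C).
- by congr (_, _); apply: br_alt.
- by congr (_, _); apply: br_jacobi.
- by congr (_, _); rewrite /= ?opprD -?scalerN km_h_linear.
- by congr (_, _); apply: km_hh.
- by rewrite /br2 /= km_ef km_dual_ef; case: eqP.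
- by congr (_, _); rewrite /= ?km_dual_he ?km_he.
- by congr (_, _); rewrite /= ?km_dual_hf ?km_hf.
Qed.

(** No universal property allows a morphism to be defined on the generators, so its graph is built
    instead, as the subalgebra of L x L generated by the pairs [h2 u], [e2 i] and [f2 i]. *)
Local Notation Gamma := (lspan (tri br2 h2 e2 f2)).

Lemma graph_fst x : exists y, Gamma (x, y).
Proof.
suff : [set x | exists y, Gamma (x, y)] = setT by move/seteqP => [_ /(_ x)]; apply.
apply: (km_gen (k := g)) => [a u v [u' Gu] [v' Gv]|u v [u' Gu] [v' Gv]|u|i|i] /=.
- by exists (a *: u' + v'); apply: (lspan_lin a Gu Gv).
- by exists (br g u' v'); apply: (lspan_tri_br chevalley2 Gu Gv).
- by exists (km_h g (- u)); apply: lspan_gen; constructor 2; exists u.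
- by exists (km_f g i); apply: lspan_gen; constructor 1; exists i, [::].
- by exists (km_e g i); apply: lspan_gen; constructor 3; exists i, [::].
Qed.

Lemma graph_snd y : exists x, Gamma (x, y).
Proof.
suff : [set y | exists x, Gamma (x, y)] = setT by move/seteqP => [_ /(_ y)]; apply.
apply: (km_gen (k := g)) => [a u v [u' Gu] [v' Gv]|u v [u' Gu] [v' Gv]|u|i|i] /=.
- by exists (a *: u' + v'); apply: (lspan_lin a Gu Gv).
- by exists (br g u' v'); apply: (lspan_tri_br chevalley2 Gu Gv).
- by exists (km_h g (- u)); apply: lspan_gen; constructor 2; exists (- u); rewrite /h2 opprK.
- by exists (km_f g i); apply: lspan_gen; constructor 3; exists i, [::].
- by exists (km_e g i); apply: lspan_gen; constructor 1; exists i, [::].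
Qed.

Lemma graph_weight0 x y : Gamma (x, y) -> weight br2 h2 0 (x, y) ->
  exists u, x = km_h g u /\ y = km_h g (- u).
Proof. by move=> G w; have [u [-> ->]] := weight0_tri chevalley2 G w; exists u. Qed.

(** The fibre over 0 is an ideal because the second projection of [Gamma] is onto. If it contains
    h(u), the pair (0, h(u)) has weight 0, so it is (h(v), h(-v)) for some v; then h(v) = 0 and h(u)
    = 0. *)
Lemma graph_fun y : Gamma (0, y) -> y = 0.
Proof.
have C := km_chevalley g; move=> G0.
apply: (km_ideal (k := g) (J := fun y => Gamma (0, y))) G0 => [|a u v Gu Gv|u v Gv|u Gu].
- exact: lspan_zero.
- by have := lspan_lin a Gu Gv; rewrite -[_ + _]/(a *: 0 + 0, a *: u + v) scaler0 addr0.
- have [w Gw] := graph_snd u; have := lspan_tri_br chevalley2 Gw Gv.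
  by rewrite /br2 /= (br0r C).
- have [|v [h0 ->]] := graph_weight0 Gu.
    by move=> v; congr (_, _); rewrite /= ?(br0r C) ?km_hh pairing0l scale0r.
  by rewrite (hN C) -h0 oppr0.
Qed.

Lemma graph_inj x : Gamma (x, 0) -> x = 0.
Proof.
have C := km_chevalley g; move=> G0.
apply: (km_ideal (k := g) (J := fun x => Gamma (x, 0))) G0 => [|a u v Gu Gv|u v Gv|u Gu].
- exact: lspan_zero.
- by have := lspan_lin a Gu Gv; rewrite -[_ + _]/(a *: u + v, a *: 0 + 0) scaler0 addr0.
- have [w Gw] := graph_fst u; have := lspan_tri_br chevalley2 Gw Gv.
  by rewrite /br2 /= (br0r C).
- have [|v [-> h0]] := graph_weight0 Gu.
    by move=> v; congr (_, _); rewrite /= ?(br0r C) ?km_hh pairing0l scale0r.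
  by rewrite -[v]opprK (hN C) -h0 oppr0.
Qed.

(* [Gamma] is the graph of the Chevalley involution. *)
Lemma km_roots_opp a : km_roots g a -> km_roots g (- a).
Proof.
have C := km_chevalley g.
case/km_rootsE => a0 [m am] [x x0 wx].
have [y G] := graph_fst x.
apply/km_rootsE; split; first by rewrite oppr_eq0.
  by exists (fun i => - m i); rewrite am -sumrN; apply: eq_bigr => i _; rewrite scaleNr.
exists y; first by apply/eqP => y0; move: G x0; rewrite y0 => /graph_inj ->; rewrite eqxx.
move=> u; apply/eqP; rewrite -subr_eq0; apply/eqP; apply: graph_fun.
have Gh : Gamma (h2 (- u)) by apply: lspan_gen; constructor 2; exists (- u).
have := lspan_lin (- pairing a (- u)) G (lspan_tri_br chevalley2 Gh G).
rewrite /br2 /= opprK -[_ + _]/(- pairing a (- u) *: x + br g (km_h g (- u)) x,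
  - pairing a (- u) *: y + br g (km_h g u) y).
by rewrite wx scaleNr addNr addrC scaleNr pairingNr pairingNl.
Qed.

End Graph.

End KacMoody.

(** Clearing denominators turns independence over Z into independence over the rationals; the rank
    is unchanged over R, so the matrix has a right inverse. *)
Lemma lin_indep_solve (R : realType) (I : finType) n (a : I -> 'rV[int]_n) (c : I -> R) :
  lin_indep_Z a -> exists v : 'rV[R]_n, forall i, pairing (a i) v = c i.
Proof.
move=> aind; pose A : 'M[rat]_(#|I|, n) := \matrix_(i, j) (a (enum_val i) ord0 j)%:~R.
have Afree : row_free A.
  rewrite -kermx_eq0; apply/rowV0P => u /sub_kermxP uA.
  have [d d0 [m mE]] : exists2 d : int, d != 0 &
      exists m : 'I_#|I| -> int, forall i, u ord0 i * d%:~R = (m i)%:~R.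
    exists (\prod_i denq (u ord0 i)).
      by apply/prodf_neq0 => i _; apply: denq_neq0.
    exists (fun i => numq (u ord0 i) * \prod_(j | j != i) denq (u ord0 j)) => i.
    rewrite (bigD1 i) //= !intrM mulrA; congr (_ * _).
    by rewrite -{1}[u ord0 i]divq_num_den mulfVK // intr_eq0 denq_neq0.
  have m0 : \sum_i m (enum_rank i) *: a i = 0.
    apply/rowP => k; rewrite summxE mxE; apply/eqP; rewrite -(intr_eq0 rat).
    rewrite rmorph_sum /= (reindex_onto enum_val enum_rank) => [|i _]; last exact: enum_rankK.
    under eq_bigl do rewrite enum_valK eqxx.
    under eq_bigr do rewrite mxE enum_valK intrM -mE.
    have := congr1 (fun M : 'rV_n => M ord0 k * d%:~R) uA; rewrite !mxE mul0r => E.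
    apply/eqP; rewrite -[RHS]E mulr_suml; apply: eq_bigr => i _; rewrite !mxE; ring.
  apply/rowP => i; have := mE i; have := aind _ m0 (enum_val i).
  by rewrite enum_valK mxE => -> /eqP; rewrite mulf_eq0 intr_eq0 (negPf d0) orbF => /eqP.
have Bfree : row_free (map_mx (ratr : rat -> R) A) by rewrite row_free_map.
have /row_freeP [B AB] := Bfree.
exists (B *m \col_i c (enum_val i))^T => i.
have := congr1 (fun M : 'cV_#|I| => M (enum_rank i) ord0)
  (mulmxA (map_mx ratr A) B (\col_i c (enum_val i))).
rewrite AB mul1mx !mxE enum_rankK => <-.
by apply: eq_bigr => k _; rewrite !mxE enum_rankK ratr_int.
Qed.

(** * The Weyl group *)

Section Weyl.
Variables (R : realType) (I : finType) (n : nat) (S : rootDatum I n).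
Local Notation AA := 'rV[R]_n.
Local Notation al i := (@form R n (sroot S i)).
Local Notation alv i := (@vec R n (scoroot S i)).
Local Notation rr := (@refl R I n S).
Local Notation W := (@weyl R I n S).

Lemma form_al_alv i j : al j (alv i) = (cartan S i j)%:~R.
Proof. by rewrite /form /vec pairing_intr sroot_scoroot. Qed.

Lemma form_alv i : al i (alv i) = 2.
Proof. by rewrite form_al_alv (kmm_diag (cartanP S)). Qed.

Lemma formD a (u v : AA) : form a (u + v) = form a u + form a v.
Proof. exact: pairingDr. Qed.
Lemma formN a (u : AA) : form a (- u) = - form a u.
Proof. exact: pairingNr. Qed.
Lemma formB a (u v : AA) : form a (u - v) = form a u - form a v.
Proof. by rewrite formD formN. Qed.
Lemma formZ a (c : R) (u : AA) : form a (c *: u) = c * form a u.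
Proof. exact: pairingZr. Qed.
Lemma form0 a : form a (0 : AA) = 0.
Proof. exact: pairing0r. Qed.

Lemma form_sum (J : Type) (r : seq J) (v : J -> AA) a :
  form a (\sum_(j <- r) v j) = \sum_(j <- r) form a (v j).
Proof. by elim/big_rec2: _ => [|j x y _ <-]; [exact: form0|exact: formD]. Qed.

Lemma form_inj : injective (@form R n).
Proof.
move=> a b ab; apply/eqP; apply: contraT => /(pairing_neq R)[u].
by rewrite -[pairing a u]/(form a u) ab eqxx.
Qed.

Lemma exists_rho (c : I -> R) : exists v : AA, forall i, al i v = c i.
Proof. exact: lin_indep_solve (@sroot_indep _ _ S). Qed.

Lemma exists_coweight (c : I -> R) : exists lam : AA -> R,
  [/\ forall u v, lam (u + v) = lam u + lam v, forall k v, lam (k *: v) = k * lam v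
    & forall i, lam (alv i) = c i].
Proof.
have [y yc] := lin_indep_solve c (@scoroot_indep _ _ S).
exists (fun v => \sum_k v ord0 k * y ord0 k); split=> [u v|k v|i].
- by rewrite -big_split; apply: eq_bigr => k _; rewrite mxE mulrDl.
- by rewrite mulr_sumr; apply: eq_bigr => j _; rewrite mxE mulrA.
- by rewrite -yc; apply: eq_bigr => k _; rewrite mxE.
Qed.

Lemma reflD i u v : rr i (u + v) = rr i u + rr i v.
Proof. by rewrite /refl formD scalerDl opprD addrACA. Qed.
Lemma reflZ i c v : rr i (c *: v) = c *: rr i v.
Proof. by rewrite /refl formZ scalerBr scalerA. Qed.
Lemma refl_alv i : rr i (alv i) = - alv i.
Proof. by rewrite /refl form_alv scaler_nat mulr2n opprD addrA subrr add0r. Qed.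
Lemma form_refl i v : al i (rr i v) = - al i v.
Proof. rewrite /refl formB formZ form_alv; ring. Qed.
Lemma reflK i : involutive (rr i).
Proof. by move=> v; rewrite {1}/refl form_refl scaleNr opprK /refl subrK. Qed.

Lemma weyl_id : W idfun. Proof. by exists [::]. Qed.

Lemma weyl_cons i w : W w -> W (rr i \o w).
Proof. by case=> s ->; exists (i :: s). Qed.

Lemma weyl_refl i : W (rr i).
Proof. by exists [:: i]. Qed.

Lemma weyl_ind (P : (AA -> AA) -> Prop) : P idfun ->
  (forall i w, W w -> P w -> P (rr i \o w)) -> forall w, W w -> P w.
Proof.
move=> P0 PS w [s ->]; elim: s => //= i s IH; apply: PS => //.
by exists s.
Qed.

Lemma weyl_comp w w' : W w -> W w' -> W (w \o w').
Proof.
by move=> Ww Ww'; elim/weyl_ind: w / Ww => // i w Ww IH; apply: (weyl_cons i IH).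
Qed.

Lemma weyl_rcons i w : W w -> W (w \o rr i).
Proof. by move=> Ww; apply: weyl_comp => //; apply: weyl_refl. Qed.

Lemma weyl_inv w : W w -> exists w', [/\ W w', cancel w w' & cancel w' w].
Proof.
move=> Ww; elim/weyl_ind: w / Ww => [|i w _ [w' [Ww' K K']]]; first by exists idfun; split => //; apply: weyl_id.
exists (w' \o rr i); split; first exact: weyl_rcons.
  by move=> v /=; rewrite reflK K.
by move=> v /=; rewrite K' reflK.
Qed.

Lemma weylD w u v : W w -> w (u + v) = w u + w v.
Proof. by move=> Ww; elim/weyl_ind: w / Ww u v => //= i w _ IH u v; rewrite IH reflD. Qed.
Lemma weylZ w c v : W w -> w (c *: v) = c *: w v.
Proof. by move=> Ww; elim/weyl_ind: w / Ww v => //= i w _ IH v; rewrite IH reflZ. Qed.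
Lemma weylN w v : W w -> w (- v) = - w v.
Proof. by move=> Ww; rewrite -scaleN1r weylZ // scaleN1r. Qed.
Lemma weylB w u v : W w -> w (u - v) = w u - w v.
Proof. by move=> Ww; rewrite weylD // weylN. Qed.
Lemma weyl0 w : W w -> w 0 = 0.
Proof. by move=> Ww; rewrite -[0 in LHS](scale0r 0) weylZ // scale0r. Qed.

Definition pull i (a : 'rV[int]_n) := a - pairing a (scoroot S i) *: sroot S i.

Lemma form_pull i a : form (pull i a) = form a \o rr i.
Proof.
apply/funext => v; rewrite /= /refl formB formZ /form /pull pairingDl pairingNl pairingZl.
by rewrite /vec pairing_intr mulrC.
Qed.

Lemma weyl_lattice w y : W w -> exists y', w (@vec R n y) = vec R y'.
Proof.
move=> Ww; elim/weyl_ind: w / Ww => [|i w _ [y' E]]; first by exists y.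
exists (y' - pairing (sroot S i) y' *: scoroot S i).
rewrite /= E /refl /form /vec pairing_intr; apply/rowP => k; rewrite !mxE.
by rewrite intrD intrN intrM.
Qed.

Definition qf (m : I -> nat) (v : AA) : R := \sum_i (m i)%:R * al i v.

Lemma form_qsum m : @form R n (qsum S m) = qf m.
Proof.
apply/funext => v; rewrite /form /qsum pairing_suml.
by apply: eq_bigr => i _; rewrite pairingZl.
Qed.

Definition cospan v := exists c : I -> R, v = \sum_i c i *: alv i.

Lemma cospan0 : cospan 0.
Proof. by exists (fun=> 0); rewrite big1 // => i _; rewrite scale0r. Qed.
Lemma cospanD u v : cospan u -> cospan v -> cospan (u + v).
Proof.
case=> c -> [d ->]; exists (fun i => c i + d i); rewrite -big_split.
by apply: eq_bigr => i _; rewrite scalerDl.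
Qed.
Lemma cospanZ k v : cospan v -> cospan (k *: v).
Proof.
case=> c ->; exists (fun i => k * c i); rewrite scaler_sumr.
by apply: eq_bigr => i _; rewrite scalerA.
Qed.
Lemma cospan_alv i : cospan (alv i).
Proof.
exists (fun j => (j == i)%:R); rewrite (bigD1 i) //= eqxx scale1r big1 ?addr0 // => j ji.
by rewrite (negPf ji) scale0r.
Qed.

Lemma weyl_cospan w v : W w -> cospan (w v - v).
Proof.
move=> Ww; elim/weyl_ind: w / Ww => [|i w _ IH]; first by rewrite subrr; apply: cospan0.
rewrite /= /refl addrAC -scaleNr; apply: cospanD => //.
by apply: cospanZ; apply: cospan_alv.
Qed.

(** * Roots as linear forms on the apartment *)

Section Roots.
Variables (L : lmodType R[i]) (g : kacMoodyAlgebra S L).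

Lemma Delta_weyl a w : Delta g a -> W w -> Delta g (a \o w).
Proof.
case=> b rb <- Ww; elim/weyl_ind: w / Ww b rb => [|i w _ IH] b rb; first by exists b.
by rewrite compA -form_pull; apply: IH; apply: km_roots_refl.
Qed.

Lemma Delta_opp a : Delta g a -> Delta g (\- a).
Proof.
case=> b rb <-; exists (- b); first exact: km_roots_opp.
by apply/funext => v; apply: pairingNl.
Qed.

Lemma Delta_al i : Delta g (al i).
Proof.
exists (sroot S i) => //; apply/km_rootsE; split.
- apply/eqP => a0; have := sroot_scoroot S i i.
  by rewrite a0 pairing0l (kmm_diag (cartanP S)).
- exists (fun j => (j == i)%:Z).
  rewrite (bigD1 i) //= eqxx scale1r big1 ?addr0 // => j ji.
  by rewrite (negPf ji) scale0r.
- exists (km_e g i); first exact: km_e_neq0.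
  exact: weight_e (km_chevalley g) i.
Qed.

Lemma DeltaD a u v : Delta g a -> a (u + v) = a u + a v.
Proof. by case=> b _ <-; rewrite formD. Qed.
Lemma DeltaN a v : Delta g a -> a (- v) = - a v.
Proof. by case=> b _ <-; rewrite formN. Qed.
Lemma DeltaB a u v : Delta g a -> a (u - v) = a u - a v.
Proof. by case=> b _ <-; rewrite formB. Qed.
Lemma DeltaZ a c v : Delta g a -> a (c *: v) = c * a v.
Proof. by case=> b _ <-; rewrite formZ. Qed.

Definition simple_only i (m : I -> nat) := forall j, j != i -> m j = 0%N.

Lemma qsum_simple i m : simple_only i m -> qsum S m = (m i)%:Z *: sroot S i.
Proof.
move=> mi; rewrite /qsum (bigD1 i) //= big1 ?addr0 // => j ji.
by rewrite mi // scale0r.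
Qed.

Lemma Delta_sign a : Delta g a -> exists m, (a = qf m \/ a = \- qf m) /\
  forall i, simple_only i m -> m i = 1%N.
Proof.
case=> b rb <-; have [m mE] := km_roots_sign rb; exists m; split.
  case: mE => ->; [left|right]; rewrite -form_qsum //.
  by apply/funext => v; apply: pairingNl.
move=> i /qsum_simple mi.
have : km_roots g ((m i)%:Z *: sroot S i).
  rewrite -mi; case: mE rb => ->  // /km_roots_opp.
  by rewrite opprK.
by move/km_roots_multiple => [] /eqP; rewrite ?eqz_nat => /eqP.
Qed.

Lemma qsum_pull i m : pull i (qsum S m) =
  qsum S m - ((m i)%:Z * 2 + \sum_(j | j != i) (m j)%:Z * cartan S i j) *: sroot S i.
Proof.
congr (_ - _ *: _); rewrite /qsum pairing_suml (bigD1 i) //= pairingZl intz.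
rewrite sroot_scoroot (kmm_diag (cartanP S)); congr (_ + _).
by apply: eq_bigr => j _; rewrite pairingZl intz sroot_scoroot.
Qed.

Lemma lin_indep_eq (a : I -> 'rV[int]_n) (c d : I -> int) : lin_indep_Z a ->
  \sum_i c i *: a i = \sum_i d i *: a i -> forall i, c i = d i.
Proof.
move=> ai E i; apply/eqP; rewrite -subr_eq0; apply/eqP.
apply: (ai (fun i => c i - d i)).
by under eq_bigr do rewrite scalerBl; rewrite sumrB E subrr.
Qed.

(** A reflection [r_i] changes the i-th coefficient only, and another nonzero coefficient fixes the
    sign: [r_i] permutes the positive roots other than alpha_i. *)
Lemma Delta_refl_pos i m : Delta g (qf m) -> ~ simple_only i m ->
  exists m', [/\ qf m \o rr i = qf m', forall j, j != i -> m' j = m j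
   & (m' i)%:Z = - (m i)%:Z - \sum_(j | j != i) (m j)%:Z * cartan S i j].
Proof.
move=> Dm mi.
have Dp : Delta g (qf m \o rr i) by apply: Delta_weyl => //; apply: weyl_refl.
have [m' [E _]] := Delta_sign Dp; exists m'.
set c := (m i)%:Z * 2 + \sum_(j | j != i) (m j)%:Z * cartan S i j.
have pE : qf m \o rr i = form (\sum_j ((m j)%:Z - (if j == i then c else 0)) *: sroot S j).
  rewrite -form_qsum -form_pull qsum_pull -/c; congr form.
  under [RHS]eq_bigr do rewrite scalerBl.
  rewrite sumrB; congr (_ - _).
  rewrite (bigD1 i) //= eqxx [X in _ = _ + X]big1 ?addr0 // => j ji.
  by rewrite (negPf ji) scale0r.
case: E => E.
  rewrite E; move: pE; rewrite E -form_qsum => /form_inj /(lin_indep_eq (@sroot_indep _ _ S)) mE.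
  split=> // [j ji|]; first by have := mE j; rewrite (negPf ji) subr0 => -[].
  rewrite mE eqxx /c; ring.
have E' : \- qf m' = form (\sum_j (- (m' j)%:Z) *: sroot S j).
  have -> : \sum_j (- (m' j)%:Z) *: sroot S j = - qsum S m'.
    by rewrite -sumrN; apply: eq_bigr => j _; rewrite scaleNr.
  by apply/funext => v; rewrite /form pairingNl -[pairing _ _]/(form _ v) form_qsum.
move: pE; rewrite E E' => /form_inj /(lin_indep_eq (@sroot_indep _ _ S)) mE.
case: mi => j ji; have := mE j; rewrite (negPf ji) subr0; lia.
Qed.

(** The i-th coefficient of the reflected root is still nonnegative, and it is -m_i plus a
    combination of the other m_j. One [K] serves all roots, real or imaginary, which is what
    replaces finiteness in the study of panels. *)
Lemma Delta_coef : exists K : nat, forall i m, Delta g (qf m) -> ~ simple_only i m ->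
  (m i <= K * \sum_(j | j != i) m j)%N.
Proof.
exists (\sum_i \sum_j `|cartan S i j|)%N => i m Dm mi.
have [m' [_ _ m'E]] := Delta_refl_pos Dm mi.
suff : (m i <= \sum_(j | j != i) m j * `|cartan S i j|)%N.
  move/leq_trans; apply; rewrite big_distrr; apply: leq_sum => j _.
  rewrite mulnC leq_mul2r; apply/orP; right.
  by rewrite (bigD1 i) //= (bigD1 j) //= -addnA leq_addr.
have -> : (\sum_(j | j != i) m j * `|cartan S i j|)%N =
    `|(\sum_(j | j != i) (m j)%:Z * cartan S i j)%R|%N.
  have -> : \sum_(j | j != i) (m j)%:Z * cartan S i j =
      - (\sum_(j | j != i) m j * `|cartan S i j|)%N%:Z.
    rewrite -natz natr_sum -sumrN; apply: eq_bigr => j ji.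
    rewrite natz PoszM abszE ler0_norm ?mulrN ?opprK //.
    by apply: (kmm_offdiag (cartanP S)); rewrite eq_sym.
  by rewrite abszN.
lia.
Qed.


Lemma qf_gt0 m v : (forall i, 0 < al i v) -> (exists i, m i != 0%N) -> 0 < qf m v.
Proof.
move=> vp [i mi]; rewrite /qf (bigD1 i) //= ltr_pwDl //.
  by rewrite mulr_gt0 // ltr0n lt0n.
by apply: sumr_ge0 => j _; rewrite mulr_ge0 // ltW.
Qed.

Lemma qf_ge0 m v : (forall i, 0 <= al i v) -> 0 <= qf m v.
Proof. by move=> vp; apply: sumr_ge0 => j _; rewrite mulr_ge0. Qed.

Lemma Delta_nz m : Delta g (qf m) -> exists i, m i != 0%N.
Proof.
case=> b rb; rewrite -form_qsum => /form_inj bE; apply: contrapT => H.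
case/km_rootsE: rb => /eqP + _ _; apply; rewrite bE /qsum big1 // => i _.
have -> : m i = 0%N by apply: contrapT => /eqP mi; apply: H; exists i.
by rewrite scale0r.
Qed.

Lemma Delta_nzN m : Delta g (\- qf m) -> exists i, m i != 0%N.
Proof.
move/Delta_opp; rewrite (_ : \- (\- qf m) = qf m); first exact: Delta_nz.
by apply/funext => v; rewrite /= opprK.
Qed.

(* The first reflection to make a positive root negative meets a simple root. *)
Lemma root_of_sign_change w m : W w -> Delta g (qf m) ->
  (exists m', qf m \o w = \- qf m') -> exists w' i, W w' /\ qf m \o w' = al i.
Proof.
move=> [s ->]; elim: s m => [|i s IH] m Dm /= [m' E].
  have [v vp] := exists_rho (fun=> 1).
  have v0 i : 0 < al i v by rewrite vp.
  have := congr1 (fun h => h v) E => /= E'.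
  have := qf_gt0 v0 (Delta_nz Dm); rewrite E' ltNge oppr_le0.
  by rewrite qf_ge0 // => i; rewrite ltW.
have [mi|mi] := pselect (simple_only i m).
  exists idfun, i; split; first exact: weyl_id.
  rewrite -form_qsum (qsum_simple mi).
  have [m1 [E1 H1]] := Delta_sign Dm.
  case: E1 => E1.
    have -> : m = m1 by apply: (@qsum_inj _ _ S); apply: form_inj; rewrite !form_qsum.
    rewrite H1 ?scale1r // => j ji.
    have <- : m = m1 by apply: (@qsum_inj _ _ S); apply: form_inj; rewrite !form_qsum.
    exact: mi.
  have [v vp] := exists_rho (fun=> 1).
  have v0 k : 0 < al k v by rewrite vp.
  have := congr1 (fun h => h v) E1 => /= E'.
  have := qf_gt0 v0 (Delta_nz Dm); rewrite E' ltNge oppr_le0.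
  by rewrite qf_ge0 // => k; rewrite ltW.
have [m1 [E1 _ _]] := Delta_refl_pos Dm mi.
have [||w' [j [Ww' wj]]] := IH m1.
- by rewrite -E1; apply: Delta_weyl => //; apply: weyl_refl.
- by exists m'; rewrite -E -E1 -compA.
by exists (rr i \o w'), j; split; [apply: weyl_cons|rewrite compA E1].
Qed.

(** * Finitely many roots when W is finite *)

Section FiniteWeyl.
Hypothesis Wfin : finite_set W.

Let Ws_ex : exists s : seq (AA -> AA), uniq s /\ W = [set` s].
Proof.
have /finite_seqP [s sE] := Wfin; exists (undup s); split; first exact: undup_uniq.
by rewrite sE; apply/seteqP; split => x /=; rewrite mem_undup.
Qed.

Let Wsum_refl (s : seq (AA -> AA)) (f : (AA -> AA) -> R) h h' :
  uniq s -> W = [set` s] -> (forall w, W w -> W (h w)) -> cancel h h' ->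
  \sum_(w <- s) f (h w) = \sum_(w <- s) f w.
Proof.
move=> su sE hW hK; rewrite -(big_map h predT); apply: perm_big.
have hu : uniq (map h s) by rewrite map_inj_uniq //; exact: can_inj hK.
apply: uniq_perm => //.
have hs : {subset map h s <= s}.
  move=> x /mapP [w ws ->]; have : W (h w) by apply: hW; rewrite sE.
  by rewrite sE.
by have [|_] := uniq_min_size hu hs; rewrite ?size_map.
Qed.

(** Every root is real. Otherwise the whole orbit of some positive root stays positive, by
    [root_of_sign_change]; the sum of this orbit is W-invariant, so it vanishes on the coroots, and
    yet it is positive at a combination [q] of coroots. *)
Lemma Delta_in_orbit a : Delta g a -> exists w i, W w /\ a \o w = al i.
Proof.
have [s [su sE]] := Ws_ex.
suff pos m : Delta g (qf m) -> exists w i, W w /\ qf m \o w = al i.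
  move=> Da; have [m [[E|E] _]] := Delta_sign Da; first by rewrite E; apply: pos; rewrite -E.
  have [|w [i [Ww wi]]] := pos m.
    rewrite (_ : qf m = \- a); first exact: Delta_opp.
    by rewrite E; apply/funext => v /=; rewrite opprK.
  exists (w \o rr i), i; split; first exact: weyl_rcons.
  apply/funext => v /=; rewrite E /= -[qf m _]/((qf m \o w) (rr i v)) wi.
  by rewrite form_refl opprK.
move=> Dm; apply: contrapT => H.
have pos w : W w -> exists2 m', qf m \o w = qf m' & exists i, m' i != 0%N.
  move=> Ww; have Dw := Delta_weyl Dm Ww.
  have [m' [[E|E] _]] := Delta_sign Dw; first by exists m' => //; apply: Delta_nz; rewrite -E.
  by case: H; apply: (root_of_sign_change Ww Dm); exists m'.
have [rho rhoE] := exists_rho (fun=> 1).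
(* This is |W| rho minus the W-invariant sum of the w rho: each simple root takes the value |W| at
   [q], while every rho - w rho is a combination of coroots. *)
pose q := \sum_(w <- s) (rho - w rho).
have alq j : al j q = (size s)%:R.
  rewrite form_sum; under eq_bigr do rewrite formB rhoE.
  rewrite sumrB; have := Wsum_refl (fun w => al j (w rho)) su sE (@weyl_cons j)
    (h' := fun w => rr j \o w) (fun w => funext (fun v => reflK j (w v))).
  under eq_bigr do rewrite /= form_refl.
  rewrite sumrN => E; have {}E : \sum_(w <- s) al j (w rho) = 0 by lra.
  by rewrite E subr0 big_const_seq count_predT iter_addr_0.
have sW w : w \in s -> W w by rewrite sE.
have qc : cospan q.
  rewrite /q big_seq; apply: big_ind => [|u v|w /sW Ww]; [exact: cospan0|exact: cospanD|].
  by rewrite -opprB -scaleN1r; apply/cospanZ/weyl_cospan.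
pose tau v := \sum_(w <- s) qf m (w v).
have tau_refl i v : tau (rr i v) = tau v.
  apply: (Wsum_refl (fun w => qf m (w v)) su sE (h := fun w => w \o rr i)
    (h' := fun w => w \o rr i)) => [w|w]; first exact: weyl_rcons.
  by apply/funext => u /=; rewrite reflK.
have qfL c u v : qf m (c *: u + v) = c * qf m u + qf m v.
  by rewrite -form_qsum formD formZ.
have tauL c u v : tau (c *: u + v) = c * tau u + tau v.
  rewrite /tau mulr_sumr -big_split /= !big_seq; apply: eq_bigr => w /sW Ww.
  by rewrite weylD // weylZ // qfL.
have tau0 : tau 0 = 0.
  have := tauL 1 0 0; rewrite scale1r addr0 mul1r; lra.
have taualv i : tau (alv i) = 0.
  have := tau_refl i (alv i); rewrite refl_alv -scaleN1r -[_ *: _]addr0 tauL tau0; lra.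
have tauq : tau q = 0.
  case: qc => c ->; elim/big_rec: _ => [|i v _ IH]; first exact: tau0.
  by rewrite tauL taualv IH mulr0 addr0.
have s_id : idfun \in s by have := weyl_id; rewrite sE.
have s_gt0 : 0 < (size s)%:R :> R by rewrite ltr0n; case: (s) s_id.
have qpos w : W w -> 0 < qf m (w q).
  move=> Ww; have [m' E nz] := pos w Ww; rewrite -[qf m _]/((qf m \o w) q) E.
  by apply: qf_gt0 => // j; rewrite alq.
move/eqP: tauq; rewrite /tau big_seq psumr_eq0 => [/allP/(_ _ s_id)|w /sW /qpos /ltW //].
by rewrite s_id /= => /eqP E; have := qpos _ weyl_id; rewrite E ltxx.
Qed.

Lemma Delta_finite : finite_set (Delta g).
Proof.
have : finite_set [set al p.2 \o p.1 | p in W `*` [set: I]].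
  by apply: finite_image; apply: finite_setX => //; apply: finite_finset.
apply: sub_finite_set => a /Delta_in_orbit [w [i [Ww wi]]].
have [w' [Ww' K K']] := weyl_inv Ww; exists (w', i) => //=.
by rewrite -wi; apply/funext => v /=; rewrite K'.
Qed.

End FiniteWeyl.

End Roots.

Lemma seq_argmax (T : eqType) (f : T -> R) (s : seq T) x : x \in s ->
  exists2 y, y \in s & forall z, z \in s -> f z <= f y.
Proof.
elim: s x => // a [|b s] IH x _.
  by exists a; rewrite ?inE // => z; rewrite inE => /eqP ->.
have [y ys ymax] := IH b (mem_head _ _).
have [ay|ya] := leP (f a) (f y).
  by exists y => [|z]; rewrite in_cons ?ys ?orbT // => /predU1P[->|/ymax].
exists a => [|z]; rewrite in_cons ?eqxx // => /predU1P[->//|/ymax].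
by move/le_trans; apply; apply: ltW.
Qed.

(** Over the orbit, maximize a form equal to 1 at each simple coroot: reflecting in a root with a
    negative value would increase it. *)
Lemma weyl_dominant v : finite_set W -> exists2 w, W w & forall i, 0 <= al i (w v).
Proof.
move=> /finite_seqP [s sE].
have s_id : idfun \in s by have := weyl_id; rewrite sE.
have [lam [lamD lamZ lama]] := exists_coweight (fun=> 1).
have [w ws wmax] := seq_argmax (fun w => lam (w v)) s_id.
have Ww : W w by rewrite sE.
exists w => // i; rewrite leNgt; apply/negP => wi.
have : rr i \o w \in s by have := weyl_cons i Ww; rewrite sE.
move/wmax; rewrite /= /refl lamD -scaleNr lamZ lama mulr1 gerDl oppr_le0 leNgt.
by rewrite wi.
Qed.

(** * Unbounded heights when W is infinite *)

Section Heights.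
Variables (L : lmodType R[i]) (g : kacMoodyAlgebra S L).

Lemma finite_bounded_qf k : finite_set [set qf m | m in [set m | forall i, (m i <= k)%N]].
Proof.
have := finite_image (fun t : {ffun I -> 'I_k.+1} => qf (fun i => t i)) (finite_finset (X := setT)).
apply: sub_finite_set => _ [m mk <-]; exists [ffun i => inord (m i)] => //.
by congr qf; apply/funext => i; rewrite ffunE inordK // ltnS.
Qed.

(* On a finite set of roots, B(u,v) = sum_a a(u)a(v) is W-invariant, whence
   2B(alv_i,v) = B(alv_i,alv_i) al_i(v): so no combination of coroots is
   annihilated by all roots. *)
Lemma finite_roots_nondegenerate v : finite_set [set al i \o w | w in W & i in [set: I]] ->
  cospan v -> (forall i, al i v = 0) -> v = 0.
Proof.
move=> /finite_seqP [s0 s0E] [c vE] v0; set s := undup s0.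
have su : uniq s by apply: undup_uniq.
have sP a : a \in s <-> exists w i, W w /\ a = al i \o w.
  rewrite mem_undup; have -> : (a \in s0) = [set` s0] a :> Prop by [].
  rewrite -s0E; split=> [[w Ww [i _ <-]]|[w [i [Ww ->]]]]; first by exists w, i.
  by exists w => //; exists i.
have aL a : a \in s -> forall k u u', a (k *: u + u') = k * a u + a u'.
  by move/sP => [w [i [Ww ->]]] k u u' /=; rewrite weylD // weylZ // formD formZ.
pose B u u' := \sum_(a <- s) a u * a u'.
have Br i u u' : B (rr i u) (rr i u') = B u u'.
  have hs : {subset map (fun a => a \o rr i) s <= s}.
    move=> _ /mapP [a /sP [w [j [Ww ->]]] ->]; apply/sP.
    by exists (w \o rr i), j; split => //; apply: weyl_rcons.
  have hu : uniq (map (fun a => a \o rr i) s).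
    rewrite map_inj_uniq // => a b ab; apply/funext => x.
    by have := congr1 (fun f => f (rr i x)) ab; rewrite /= reflK.
  transitivity (\sum_(a <- map (fun a => a \o rr i) s) a u * a u').
    by rewrite big_map.
  apply: perm_big; apply: uniq_perm => //.
  by have [|_] := uniq_min_size hu hs; rewrite ?size_map.
have BL k u u' u'' : B (k *: u + u') u'' = k * B u u'' + B u' u''.
  rewrite /B mulr_sumr -big_split /= !big_seq; apply: eq_bigr => a /aL ->; ring.
have BLr k u u' u'' : B u'' (k *: u + u') = k * B u'' u + B u'' u'.
  rewrite /B mulr_sumr -big_split /= !big_seq; apply: eq_bigr => a /aL ->; ring.
have B0 u : B 0 u = 0.
  by have := BL 1 0 0 u; rewrite scale1r addr0 mul1r; lra.
have Balv i u : 2 * B (alv i) u = B (alv i) (alv i) * al i u.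
  have BN x y : B (- x) y = - B x y.
    by have := BL (-1) x 0 y; rewrite scaleN1r addr0 B0 mulN1r addr0.
  have := Br i (alv i) u; rewrite refl_alv BN /refl addrC -scaleNr BLr; lra.
have Bpos i : 0 < B (alv i) (alv i).
  have is_ : al i \in s by apply/sP; exists idfun, i; split => //; apply: weyl_id.
  rewrite /B (big_rem _ is_) /= form_alv; apply: ltr_pwDl; first by rewrite mulr_gt0.
  by rewrite sumr_ge0 // => a _; rewrite -expr2 sqr_ge0.
have Bv u : B v u = \sum_i c i * B (alv i) u.
  rewrite vE; elim/big_rec2: _ => [|i x y _ <-]; [exact: B0|exact: BL].
have Bv0 u : B v u = 0.
  rewrite /B big_seq big1 // => a /sP [w [i [Ww ->]]] /=.
  suff -> : w v = v by rewrite v0 mul0r.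
  elim/weyl_ind: w / Ww => // j w _ IH.
  by rewrite /= IH /refl v0 scale0r subr0.
suff c0 i : c i = 0 by rewrite vE big1 // => i _; rewrite c0 scale0r.
have [u uE] := exists_rho (fun j => (j == i)%:R).
have := Bv u; rewrite Bv0 (bigD1 i) //= big1 => [|j ji]; last first.
  have := Balv j u; rewrite uE (negPf ji) mulr0 => /eqP.
  by rewrite mulf_eq0 pnatr_eq0 /= => /eqP ->; rewrite mulr0.
have := Balv i u; rewrite uE eqxx mulr1 addr0 => E /esym/eqP.
rewrite mulf_eq0 => /orP [/eqP //|/eqP BE].
by have := Bpos i; rewrite -E BE mulr0 ltxx.
Qed.

(** An element w is determined by the forms al_i \o w: if w' gives the same ones, then w' v - w v is
    a combination of coroots killed by every simple root, hence 0. So W is parametrized by tuples in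
    a finite set. *)
Lemma finite_roots_finite_weyl :
  finite_set [set al i \o w | w in W & i in [set: I]] -> finite_set W.
Proof.
move=> Pfin; have [s sE] := (finite_seqP _).1 Pfin.
have nth_s w i : W w -> exists k : 'I_(size s), nth (al i) s k = al i \o w.
  move=> Ww; have : al i \o w \in s.
    by have : [set` s] (al i \o w) by rewrite -sE; exists w => //; exists i.
  by move/(nthP (al i)) => [k ks E]; exists (Ordinal ks).
pose F (t : {ffun I -> 'I_(size s)}) :=
  xget (idfun : AA -> AA) [set w | W w /\ forall i, nth (al i) s (t i) = al i \o w].
have := finite_image F (finite_finset (X := setT)).
apply: sub_finite_set => w Ww.
have [t tE] := choice (fun i => nth_s w i Ww).
exists [ffun i => t i] => //; rewrite /F; case: xgetP => [w' _ [Ww' w'E]|/(_ w)[]]; last first.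
  by split => // i; rewrite ffunE tE.
apply/funext => v; apply/eqP; rewrite -subr_eq0; apply/eqP.
apply: finite_roots_nondegenerate => // [|i].
  have -> : w' v - w v = (w' v - v) + -1 *: (w v - v).
    by rewrite scaleN1r opprB addrA subrK.
  by apply: cospanD; [|apply: cospanZ]; apply: weyl_cospan.
rewrite formB; have := w'E i; rewrite ffunE tE => E.
by have := congr1 (fun f => f v) E => /= ->; rewrite subrr.
Qed.

(** Bounded heights would leave finitely many real roots. A negative root al_i \o w is made positive
    by replacing w^-1 with w^-1 \o r_i. *)
Lemma heights_unbounded k : ~ finite_set W ->
  exists w i m, [/\ W w, qf m \o w = al i & (k < \sum_j m j)%N].
Proof.
move=> Winf; apply: contrapT => H; apply/Winf/finite_roots_finite_weyl.
have bd w i m : W w -> qf m \o w = al i -> forall j, (m j <= k)%N.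
  move=> Ww E j; apply: (@leq_trans (\sum_j m j)%N); first by rewrite (bigD1 j) //= leq_addr.
  by rewrite leqNgt; apply: contra_notN H => km; exists w, i, m.
pose X := [set qf m | m in [set m | forall i, (m i <= k)%N]].
have : finite_set (X `|` [set (fun v => - f v) | f in X]).
  by rewrite finite_setU; split; last apply: finite_image; apply: finite_bounded_qf.
apply: sub_finite_set => _ [w Ww [i _ <-]].
have [w' [Ww' K K']] := weyl_inv Ww.
have [m [[E|E] _]] := Delta_sign (Delta_weyl (Delta_al g i) Ww).
  left; exists m => //; apply: (bd w' i) => //.
  by rewrite -E; apply/funext => v /=; rewrite K'.
right; exists (qf m) => //; exists m => //; apply: (bd (w' \o rr i) i).
  exact: weyl_rcons.
have E' : qf m = \- (al i \o w) by rewrite E; apply/funext => v /=; rewrite opprK.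
by rewrite E'; apply/funext => v /=; rewrite K' form_refl opprK.
Qed.

End Heights.
End Weyl.

(** * Faces and chambers of the model apartment *)

Section RowTopology.
Variables (R : realType) (n : nat).
Local Notation AA := 'rV[R]_n.
Implicit Types (x v : AA).

Lemma coord_le_norm v k : `|v ord0 k| <= `|v|.
Proof.
rewrite [leRHS]/Num.norm /= mx_normrE.
exact: (le_bigmax _ (fun ij : 'I_1 * 'I_n => `|v ij.1 ij.2|) (ord0, k)).
Qed.

Lemma form_lip (a : 'rV[int]_n) : exists2 C, 0 < C & forall v, `|form a v| <= C * `|v|.
Proof.
exists (1 + \sum_k `|(a ord0 k)%:~R : R|); first by rewrite ltr_pwDl // sumr_ge0.
move=> v; apply: (le_trans (ler_norm_sum _ _ _)).
rewrite mulrDl mul1r mulr_suml -[leLHS]add0r lerD // ler_sum // => k _.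
by rewrite normrM ler_wpM2l // coord_le_norm.
Qed.

Lemma nbhs_rowP x (Om : set AA) :
  nbhs x Om <-> exists2 e, 0 < e & forall v, `|v| < e -> Om (x + v).
Proof.
split=> [/nbhs_normP [e /= e0 H]|[e e0 H]].
  by exists e => // v ve; apply: H; rewrite /ball_ /= opprD addrA subrr add0r normrN.
apply: (nbhs_normP x Om).2; exists e => //= y; rewrite /ball_ /= => xy.
by rewrite -[y](subrK x) addrC; apply: H; rewrite distrC.
Qed.

Lemma closure_rowP (A : set AA) x :
  closure A x <-> forall e, 0 < e -> exists2 v, A (x + v) & `|v| < e.
Proof.
split=> [Ax e e0|H B /nbhs_rowP [e e0 HB]].
  have [|y [Ay [v ve yE]]] := Ax [set x + v | v in [set v | `|v| < e]].
    by apply/nbhs_rowP; exists e => // v ve; exists v.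
  by exists v => //; rewrite yE.
by have [v Av ve] := H e e0; exists (x + v); split => //; apply: HB.
Qed.

Lemma exists_scale v e : 0 < e -> exists2 t : R, 0 < t & forall s, 0 <= s <= t -> `|s *: v| < e.
Proof.
move=> e0; have v1 : 0 < 1 + `|v| by rewrite ltr_pwDl.
exists (e / 2 / (1 + `|v|)); first by rewrite !divr_gt0.
move=> s /andP[s0 st]; rewrite normrZ ger0_norm //.
apply: (@le_lt_trans _ _ (s * (1 + `|v|))); first by rewrite ler_wpM2l // lerDr.
apply: (@le_lt_trans _ _ (e / 2)); first by rewrite -ler_pdivlMr.
by rewrite ltr_pdivrMr // ltr_pMr // ltr1n.
Qed.

Lemma limit_ge0 (c d : R) (t : R) : 0 < t -> (forall s, 0 < s <= t -> 0 <= c + s * d) -> 0 <= c.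
Proof.
move=> t0 H; rewrite leNgt; apply/negP => c0.
have D : 0 < 1 + `|d| by rewrite ltr_pwDl.
pose s := Num.min t (- c / 2 / (1 + `|d|)).
have s0 : 0 < s by rewrite lt_min t0 !divr_gt0 // oppr_gt0.
have := H s; rewrite s0 ge_min lexx => /(_ isT).
have : s * (1 + `|d|) <= - c / 2 by rewrite -ler_pdivlMr // ge_min lexx orbT.
have := ler_norm d; nra.
Qed.

End RowTopology.

Section Faces.
Variables (R : realType) (I : finType) (n : nat) (S : rootDatum I n).
Variables (L : lmodType R[i]) (g : kacMoodyAlgebra S L).
Local Notation AA := 'rV[R]_n.
Local Notation al i := (@form R n (sroot S i)).
Local Notation alv i := (@vec R n (scoroot S i)).
Local Notation rr := (@refl R I n S).
Local Notation W := (@weyl R I n S).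
Local Notation qf := (@qf R I n S).
Local Notation Fv := (@Fv R I n S).
Local Notation Cvf := (@Cvf R I n S).
Local Notation Delta := (Delta g).
Local Notation face := (face g).
Implicit Types (x v : AA) (V : set AA) (k : (AA -> R) -> option int).

Lemma al_small e : 0 < e ->
  exists2 d, 0 < d & forall v, `|v| < d -> forall i, `|al i v| < e.
Proof.
move=> e0; suff [d d0 H] : exists2 d, 0 < d & forall v, `|v| < d ->
    forall i, i \in enum I -> `|al i v| < e.
  by exists d => // v vd i; apply: H => //; rewrite mem_enum.
elim: (enum I) => [|i s [d d0 IH]]; first by exists 1.
have [C C0 HC] := form_lip R (sroot S i).
exists (Num.min d (e / C)); first by rewrite lt_min d0 divr_gt0.
move=> v; rewrite lt_min => /andP[vd vC] j; rewrite in_cons => /predU1P[->|]; last exact: IH.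
by apply: (le_lt_trans (HC v)); rewrite mulrC -ltr_pdivlMr.
Qed.

Lemma weyl_lip w : W w -> exists2 C, 0 < C & forall v, `|w v| <= C * `|v|.
Proof.
move=> Ww; elim/weyl_ind: w / Ww => [|i w _ [C C0 HC]].
  by exists 1 => // v; rewrite mul1r.
have [D D0 HD] := form_lip R (sroot S i).
exists ((1 + D * `|alv i|) * C); first by rewrite mulr_gt0 // ltr_pwDl // mulr_ge0 // ltW.
move=> v; rewrite /= /refl; apply: (le_trans (ler_normB _ _)).
rewrite normrZ -mulrA mulrDl mul1r.
apply: lerD; first exact: HC.
rewrite mulrAC ler_wpM2r //; apply: (le_trans (HD _)).
by rewrite ler_wpM2l ?HC // ltW.
Qed.

Lemma sgnR_mul b : sgnR R b * sgnR R b = 1.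
Proof. by rewrite /sgnR -expr2 sqrr_sign. Qed.
Lemma sgnRK b v : sgnR R b *: (sgnR R b *: v) = v.
Proof. by rewrite scalerA sgnR_mul scale1r. Qed.
Lemma normr_sgnR b v : `|sgnR R b *: v| = `|v|.
Proof. by rewrite normrZ /sgnR normrX normrN1 expr1n mul1r. Qed.

Lemma Delta_twist a b w : Delta a -> W w ->
  exists2 a', Delta a' & forall u, a (sgnR R b *: w u) = a' u.
Proof.
move=> Da Ww; case: b; last first.
  by exists (a \o w); [apply: Delta_weyl|move=> u; rewrite /sgnR expr0 scale1r].
exists (\- (a \o w)); first exact/Delta_opp/Delta_weyl.
by move=> u; rewrite /sgnR expr1 scaleN1r (DeltaN _ Da).
Qed.

Lemma Fv_nonempty J : Fv J !=set0.
Proof.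
have [v vE] := exists_rho S (fun i => if i \in J then 0 else 1 : R).
by exists v => i; have := vE i; case: ifP => _ ->.
Qed.

Lemma FvZ J t v : 0 < t -> Fv J v -> Fv J (t *: v).
Proof.
move=> t0 Jv i; have := Jv i; rewrite formZ.
by case: ifP => _; [move=> ->; rewrite mulr0|rewrite pmulr_rgt0].
Qed.

Lemma Fv0 : Fv finset.set0 = Cvf.
Proof.
apply/seteqP; split => v H i; first by have := H i; rewrite finset.inE.
by rewrite inE.
Qed.

Lemma vface_nonempty V : vface S V -> V !=set0.
Proof.
case=> b [w [J [Ww ->]]]; have [v Jv] := Fv_nonempty J.
by exists (sgnR R b *: w v); exists v.
Qed.

Lemma vfaceZ V t v : vface S V -> 0 < t -> V v -> V (t *: v).
Proof.
case=> b [w [J [Ww ->]]] t0 [u Ju <-]; exists (t *: u); first exact: FvZ.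
by rewrite (weylZ _ _ Ww) !scalerA mulrC.
Qed.

Lemma vface_small V e : vface S V -> 0 < e -> exists2 v, V v & `|v| < e.
Proof.
move=> VV e0; have [v Vv] := vface_nonempty VV.
have [t t0 H] := exists_scale v e0; exists (t *: v); first exact: vfaceZ.
by apply: H; rewrite lexx ltW.
Qed.

Definition pos_on (a : AA -> R) V := forall v, V v -> 0 < a v.
Definition zero_on (a : AA -> R) V := forall v, V v -> a v = 0.

Lemma Fv_sign m J : pos_on (qf m) (Fv J) \/ zero_on (qf m) (Fv J).
Proof.
have [[j [jJ mj]]|H] := pselect (exists j, j \notin J /\ m j != 0%N); [left|right] => v Jv.
  rewrite /qf (bigD1 j) //=; apply: ltr_pwDl.
    by rewrite mulr_gt0 // ?ltr0n ?lt0n //; have := Jv j; rewrite (negPf jJ).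
  apply: sumr_ge0 => i _; rewrite mulr_ge0 //; have := Jv i.
  by case: ifP => _; [move=> ->|apply: ltW].
rewrite /qf big1 // => i _; have := Jv i; case: ifPn => [_ ->|iJ _]; first by rewrite mulr0.
have -> : m i = 0%N by apply: contrapT => /eqP mi; apply: H; exists i.
by rewrite mul0r.
Qed.

Lemma vface_sign a V : Delta a -> vface S V ->
  [\/ pos_on a V, zero_on a V | pos_on (\- a) V].
Proof.
move=> Da [b [w [J [Ww ->]]]].
have [a' Da' aE] := Delta_twist b Da Ww.
have [m [[E|E] _]] := Delta_sign Da'; have [H|H] := Fv_sign m J.
- by constructor 1 => _ [u Ju <-]; rewrite aE E; apply: H.
- by constructor 2 => _ [u Ju <-]; rewrite aE E; apply: H.
- by constructor 3 => _ [u Ju <-] /=; rewrite aE E opprK; apply: H.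
- by constructor 2 => _ [u Ju <-]; rewrite aE E /= H // oppr0.
Qed.

(** For a small vector, all simple coordinates lie between 0 and those of v1, so a single [d] serves
    infinitely many roots. *)
Lemma vface_dominate V v1 : vface S V -> V v1 ->
  exists2 d, 0 < d & forall v, V v -> `|v| < d -> forall a, Delta a -> a v1 <= 0 -> a v1 <= a v.
Proof.
case=> b [w [J [Ww VE]]]; rewrite VE => -[u1 Ju1 <-].
have [w' [Ww' K K']] := weyl_inv Ww.
have [C C0 HC] := weyl_lip Ww'.
have [e e0 eu1] : exists2 e, 0 < e & forall i, i \notin J -> e <= al i u1.
  have : forall i, i \in enum [predC J] -> 0 < al i u1.
    by move=> i; rewrite mem_enum inE => iJ; have := Ju1 i; rewrite (negPf iJ).
  suff H (s : seq I) : (forall i, i \in s -> 0 < al i u1) -> exists2 e, 0 < e & forall i, i \in s -> e <= al i u1.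
    by move=> /H [e e0 He]; exists e => // i iJ; apply: He; rewrite mem_enum inE.
  elim: s => [|i s IH] H; first by exists 1.
  have [|e e0 He] := IH; first by move=> j js; apply: H; rewrite in_cons js orbT.
  exists (Num.min e (al i u1)); first by rewrite lt_min e0 H // mem_head.
  move=> j; rewrite in_cons => /predU1P[->|/He ej]; first by rewrite ge_min lexx orbT.
  by rewrite ge_min ej.
have [d d0 Hd] := al_small e0.
exists (d / C); first by rewrite divr_gt0.
move=> _ [u Ju <-] vd a Da.
have [a' Da' aE] := Delta_twist b Da Ww; rewrite !aE.
have ud : `|u| < d.
  rewrite -[u]K; apply: (le_lt_trans (HC _)).
  by rewrite mulrC -ltr_pdivlMr // -(normr_sgnR b).
have uu1 i : 0 <= al i u <= al i u1.
  have := Ju i; have := Ju1 i; case: ifPn => [_ -> ->|iJ _ /ltW ->]; first by rewrite lexx.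
  apply: le_trans (eu1 _ iJ); apply: ltW; apply: le_lt_trans (Hd _ ud i).
  exact: ler_norm.
have [m [[E|E] _]] := Delta_sign Da'; rewrite E.
  by move/le_trans; apply; apply: qf_ge0 => i; case/andP: (uu1 i).
move=> _ /=; rewrite lerN2 /qf ler_sum // => i _.
by rewrite ler_wpM2l //; case/andP: (uu1 i).
Qed.

Lemma vface_tits V v : vface S V -> V v -> tits S v \/ tits S (- v).
Proof.
case=> b [w [J [Ww ->]]] [u Ju <-].
have tu : tits S (w u).
  exists w => //; exists u => //; apply/closure_rowP => e e0.
  have [rho rhoE] := exists_rho S (fun=> 1 : R).
  have [t t0 Ht] := exists_scale rho e0; exists (t *: rho); last by rewrite Ht // lexx ltW.
  move=> i; rewrite formD formZ rhoE mulr1; apply: ltr_wpDl => //.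
  by have := Ju i; case: ifP => _; [move=> ->|apply: ltW].
case: b; [right|left]; rewrite /sgnR ?expr0 ?scale1r //.
by rewrite expr1 scaleN1r opprK.
Qed.

Definition chull k k' := \bigcap_(a in Delta) (half a (k a) `&` ohalf a (k' a)).

Lemma faceE x V E : face x V E <-> exists k k', chull k k' `<=` E /\
  exists2 e, 0 < e & forall v, V v -> `|v| < e -> chull k k' (x + v).
Proof.
split=> [[k [k' [Om [/nbhs_rowP [e e0 H] DE OD]]]]|[k [k' [DE [e e0 H]]]]]; exists k, k'.
  split => //; exists e => // v Vv ve; apply: OD; split; first exact: H.
  by exists v.
exists [set x + v | v in [set v | `|v| < e]]; split => //.
  by apply/nbhs_rowP; exists e => // v ve; exists v.
by move=> _ [[v ve <-] [v' Vv' /addrI E']]; rewrite -E' in ve *; apply: H.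
Qed.

Lemma chullP x V k k' e : 0 < e -> (forall v, V v -> `|v| < e -> chull k k' (x + v)) ->
  face x V (chull k k').
Proof. by move=> e0 H; apply/faceE; exists k, k'; split => //; exists e. Qed.

Lemma face_near x V E : face x V E -> exists2 e, 0 < e & forall v, V v -> `|v| < e -> E (x + v).
Proof.
by move=> /faceE [k [k' [DE [e e0 H]]]]; exists e => // v Vv ve; apply/DE/H.
Qed.

Lemma faceS x V E E' : E `<=` E' -> face x V E -> face x V E'.
Proof.
move=> EE' /faceE [k [k' [DE H]]]; apply/faceE; exists k, k'; split => //.
exact: subset_trans EE'.
Qed.

Definition omin (k1 k2 : option int) : option int :=
  match k1, k2 with
  | Some z1, Some z2 => Some (Num.min z1 z2)
  | Some z, None | None, Some z => Some z
  | None, None => None end.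

Lemma half_omin a (k1 k2 : option int) : half a (omin k1 k2) = half a k1 `&` half a k2 :> set AA.
Proof.
case: k1 k2 => [z1|] [z2|] /=; rewrite ?setIT ?setTI //; apply/seteqP; split => x /=.
  by case: (leP z1 z2) => [h1|/ltW h1] h2; split => //; apply: (le_trans h2);
    rewrite lerD2l ler_int.
by case=> h1 h2; rewrite minEle; case: ifP.
Qed.

Lemma ohalf_omin a (k1 k2 : option int) : ohalf a (omin k1 k2) = ohalf a k1 `&` ohalf a k2 :> set AA.
Proof.
case: k1 k2 => [z1|] [z2|] /=; rewrite ?setIT ?setTI //; apply/seteqP; split => x /=.
  by case: (leP z1 z2) => [h1|/ltW h1] h2; split => //; apply: (lt_le_trans h2);
    rewrite lerD2l ler_int.
by case=> h1 h2; rewrite minEle; case: ifP.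
Qed.

Lemma faceI x V E E' : face x V E -> face x V E' -> face x V (E `&` E').
Proof.
move=> /faceE [k1 [k1' [DE1 [e1 e10 H1]]]] /faceE [k2 [k2' [DE2 [e2 e20 H2]]]].
apply/faceE; exists (fun a => omin (k1 a) (k2 a)), (fun a => omin (k1' a) (k2' a)).
have -> : chull (fun a => omin (k1 a) (k2 a)) (fun a => omin (k1' a) (k2' a)) =
    chull k1 k1' `&` chull k2 k2'.
  apply/seteqP; split => [y H|y [h1 h2] a Da].
    by split => a /H; rewrite half_omin ohalf_omin => -[[? ?] [? ?]].
  by rewrite half_omin ohalf_omin; have [? ?] := h1 a Da; have [? ?] := h2 a Da.
split; first by move=> y [/DE1 ? /DE2].
exists (Num.min e1 e2); first by rewrite lt_min e10.
by move=> v Vv; rewrite lt_min => /andP[? ?]; split; [apply: H1|apply: H2].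
Qed.

Definition only (a : AA -> R) (o : option int) (b : AA -> R) : option int :=
  if pselect (b = a) then o else None.

Lemma chull_half a o : Delta a -> chull (only a o) (fun=> None) = half a o.
Proof.
move=> Da; apply/seteqP; split => [y /(_ a Da) [+ _]|y H b Db].
  by rewrite /only; case: pselect.
by split => //; rewrite /only; case: pselect => // E /=; rewrite E.
Qed.

Lemma chull_ohalf a o : Delta a -> chull (fun=> None) (only a o) = ohalf a o.
Proof.
move=> Da; apply/seteqP; split => [y /(_ a Da) [_]|y H b Db].
  by rewrite /only; case: pselect.
by split => //; rewrite /only; case: pselect => // E /=; rewrite E.
Qed.

Lemma face_half x V a o e : Delta a -> 0 < e ->
  (forall v, V v -> `|v| < e -> half a o (x + v)) -> face x V (half a o).
Proof. by move=> Da e0 H; rewrite -(chull_half o Da); apply: (chullP e0); rewrite chull_half. Qed.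

Lemma face_ohalf x V a o e : Delta a -> 0 < e ->
  (forall v, V v -> `|v| < e -> ohalf a o (x + v)) -> face x V (ohalf a o).
Proof. by move=> Da e0 H; rewrite -(chull_ohalf o Da); apply: (chullP e0); rewrite chull_ohalf. Qed.

Lemma Delta_small a e : Delta a -> 0 < e -> exists2 d, 0 < d & forall v, `|v| < d -> `|a v| < e.
Proof.
move=> [b rb <-] e0; have [C C0 HC] := form_lip R b.
exists (e / C); first by rewrite divr_gt0.
by move=> v vd; apply: (le_lt_trans (HC v)); rewrite mulrC -ltr_pdivlMr.
Qed.

(** Every face decides every wall: by the sign of a(x) + z, or, when this is 0, by the constant sign
    of [a] on V. *)
Lemma face_trichotomy x V a (z : int) : Delta a -> vface S V ->
  face x V (ohalf a (Some z)) \/ face x V (half (\- a) (Some (- z))).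
Proof.
move=> Da VV; have DNa := Delta_opp Da.
have [c|c|c] := ltgtP (a x + z%:~R) 0.
- have c0 : 0 < - (a x + z%:~R) by rewrite oppr_gt0.
  have [d d0 Hd] := Delta_small Da c0; right; apply: (face_half DNa d0) => v _ /Hd.
  rewrite /half /= (DeltaD _ _ Da) intrN => /(le_lt_trans (ler_norm _)) /ltW; lra.
- have [d d0 Hd] := Delta_small Da c; left; apply: (face_ohalf Da d0) => v _ /Hd.
  by rewrite /ohalf /= (DeltaD _ _ Da) ltr_norml => /andP[]; lra.
have [H|H|H] := vface_sign Da VV.
- left; apply: (face_ohalf Da ltr01) => v Vv _; rewrite /ohalf /= (DeltaD _ _ Da).
  by have := H v Vv; lra.
- right; apply: (face_half DNa ltr01) => v Vv _; rewrite /half /= (DeltaD _ _ Da) intrN.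
  by rewrite (H v Vv); lra.
- right; apply: (face_half DNa ltr01) => v Vv _; rewrite /half /= (DeltaD _ _ Da) intrN.
  by have := H v Vv; rewrite /=; lra.
Qed.


Lemma chull_closed k : closed (chull k (fun=> None)).
Proof.
move=> x /closure_rowP H a Da; split=> //; case E : (k a) => [z|] //=.
rewrite leNgt; apply/negP => c0.
have c1 : 0 < - (a x + z%:~R) by rewrite oppr_gt0.
have [d d0 Hd] := Delta_small Da c1; have [v /(_ a Da) [+ _] /Hd] := H d d0.
rewrite E /= (DeltaD _ _ Da) => h1 /(le_lt_trans (ler_norm _)); lra.
Qed.

Lemma face_closure_chull x V k k' : vface S V -> face x V (chull k k') ->
  forall a z, Delta a -> k a = Some z \/ k' a = Some z -> 0 <= a x + z%:~R.
Proof.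
move=> VV /face_near [e e0 H] a z Da kE.
rewrite leNgt; apply/negP => c0.
have c1 : 0 < - (a x + z%:~R) by rewrite oppr_gt0.
have [d d0 Hd] := Delta_small Da c1.
have [|v Vv] := vface_small VV (e := Num.min d e); first by rewrite lt_min d0.
rewrite lt_min => /andP[/Hd vd ve].
have : 0 <= a (x + v) + z%:~R.
  by have := H v Vv ve a Da; case: kE => -> [] //= _ /ltW.
by rewrite (DeltaD _ _ Da); have := le_lt_trans (ler_norm _) vd; lra.
Qed.

(** * The chamber on a given side of a panel *)

Section ChamberAtPanel.
Variables (z : AA) (i : I) (c : int) (x : AA) (V : set AA).
Hypothesis zc : al i z = c%:~R.
Hypothesis VV : vface S V.
Local Notation Fi := (Fv [set i]%SET).
Hypothesis Fclos : forall Z, fclosure (face x V) Z -> face z Fi Z.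
Hypothesis Fside : face x V (ohalf (al i) (Some (- c))).

Let rho_i_ex : exists v, (al i v = 0) /\ forall j, j != i -> al j v = 1.
Proof.
have [v vE] := exists_rho S (fun j => if j == i then 0 else 1 : R).
by exists v; split => [|j ji]; rewrite vE ?eqxx // (negPf ji).
Qed.

Let Fi_small (v : AA) e : al i v = 0 -> (forall j, j != i -> al j v = 1) -> 0 < e ->
  exists2 t, 0 < t & forall s, 0 < s <= t -> Fi (s *: v) /\ `|s *: v| < e.
Proof.
move=> vi vj e0; have [t t0 Ht] := exists_scale v e0; exists t => // s /andP[s0 st].
split; last by apply: Ht; rewrite st ltW.
move=> j; rewrite finset.in_set1 formZ; case: eqVneq => [->|/vj ->]; first by rewrite vi mulr0.
by rewrite mulr1.
Qed.

Let ht (m : I -> nat) := (\sum_j m j)%N.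
Let hti (m : I -> nat) := (\sum_(j | j != i) m j)%N.

Let qf_hti m v t : al i v = 0 -> (forall j, j != i -> al j v = 1) ->
  qf m (t *: v) = t * (hti m)%:R.
Proof.
move=> vi vj; rewrite /qf (bigD1 i) //= formZ vi !mulr0 add0r natr_sum mulr_sumr.
by apply: eq_bigr => j ji; rewrite formZ vj // mulr1 mulrC.
Qed.

Let qf_ht m v t : (forall j, `|al j v| <= t) -> `|qf m v| <= t * (ht m)%:R.
Proof.
move=> vt; apply: (le_trans (ler_norm_sum _ _ _)).
rewrite natr_sum mulr_sumr ler_sum // => j _.
by rewrite normrM normr_nat mulrC ler_wpM2r.
Qed.

Let ht_hti : exists2 K : R, 1 <= K & forall m, Delta (qf m) -> ~ simple_only i m ->
  (ht m)%:R <= K * (hti m)%:R /\ 1 <= (hti m)%:R :> R.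
Proof.
have [K HK] := Delta_coef g; exists (1 + K%:R) => [|m Dm mi]; first by rewrite lerDl.
split.
  rewrite /ht (bigD1 i) //= natrD mulrDl mul1r addrC lerD2l -natrM ler_nat.
  exact: HK.
rewrite ler1n lt0n; apply/eqP => h0; apply: mi => j ji.
by move/eqP: h0; rewrite /hti sum_nat_eq0 => /forallP/(_ j)/implyP/(_ ji)/eqP.
Qed.

Let DeltaqfN m : Delta (\- qf m) -> Delta (qf m).
Proof.
move/Delta_opp; rewrite (_ : \- (\- qf m) = qf m) //.
by apply/funext => v; rewrite /= opprK.
Qed.

Let simple_al m : Delta (qf m) -> simple_only i m -> qf m = al i.
Proof.
move=> Dm mi; have [m1 [E H]] := Delta_sign Dm.
have [v vE] := exists_rho S (fun=> 1 : R).
have v0 j : 0 < al j v by rewrite vE.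
case: E => E; last first.
  have := congr1 (fun h => h v) E => /= E'.
  have := qf_gt0 v0 (Delta_nz Dm); rewrite E' ltNge oppr_le0.
  by rewrite qf_ge0 // => j; rewrite ltW.
have mm : m = m1 by apply: (@qsum_inj _ _ S); apply: (@form_inj R); rewrite !form_qsum.
by rewrite -form_qsum (qsum_simple S mi) mm H ?scale1r // -mm.
Qed.

(** The panel lies in the closure, so the constraints hold weakly at z and slightly along the panel.
    For positive roots the step into [Cvf] makes them strict; for -alpha_i integrality and the
    chosen side do; any other negative root of height ht has at z a reserve proportional to ht, by
    [Delta_coef]. *)
Lemma chamber_sub E : face x V E -> face z Cvf E.
Proof.
move=> FE; have /faceE [k [k' [DE HD]]] := FE.
have FD : face x V (chull k k') by case: HD => e e0 H; apply: (chullP e0).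
apply: (faceS DE).
have [e e0 He] : exists2 e, 0 < e & forall v, Fi v -> `|v| < e -> closure (chull k k') (z + v).
  by apply: face_near; apply: Fclos; exists (chull k k').
have [rho [ri rj]] := rho_i_ex.
have [t t0 Ht] := Fi_small ri rj e0.
have bnd a q s : Delta a -> k a = Some q \/ k' a = Some q -> 0 < s <= t ->
    0 <= a (z + s *: rho) + q%:~R.
  move=> Da kE st; have [Fis se] := Ht s st.
  have := He _ Fis se; pose k1 := only a (Some q).
  have sub : chull k k' `<=` chull k1 (fun=> None).
    rewrite chull_half // => y /(_ a Da) /=.
    by case: kE => -> [] //= _ /ltW.
  move/(closureS sub)/(@chull_closed k1); rewrite chull_half //.
have bnd0 a q : Delta a -> k a = Some q \/ k' a = Some q -> 0 <= a z + q%:~R.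
  move=> Da kE; apply: (@limit_ge0 _ _ (a rho) t t0) => s st.
  have := bnd a q s Da kE st; rewrite (DeltaD _ _ Da) (DeltaZ _ _ Da).
  by rewrite addrAC.
have [K K1 HK] := ht_hti.
(* The bound 1/2 serves -alpha_i, whose constraint, if not an equality at z, has a reserve of at
   least 1 there. The bound t/(2K) serves the other negative roots: their variation tau ht is at
   most half of the reserve t hti. *)
pose tau := Num.min (2^-1) (t / (2 * K)).
have K0 : 0 < K by lra.
have tau0 : 0 < tau by rewrite lt_min invr_gt0 ltr0n divr_gt0 // mulr_gt0.
have [d d0 Hd] := al_small tau0.
suff H v : Cvf v -> `|v| < d -> forall a q, Delta a -> k a = Some q \/ k' a = Some q ->
    0 < a (z + v) + q%:~R.
  apply: (chullP d0) => v Cv vd a Da; split.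
    by case E1 : (k a) => [q|] //=; apply/ltW/H => //; left.
  by case E1 : (k' a) => [q|] //=; apply/H => //; right.
move=> Cv vd a q Da kE; rewrite (DeltaD _ _ Da).
have h0 := bnd0 a q Da kE.
have vt j : `|al j v| <= tau by apply/ltW/Hd.
have [m [[aE|aE] _]] := Delta_sign Da; subst a.
  have : 0 < qf m v by apply: qf_gt0 => //; apply: Delta_nz Da.
  lra.
have Dm := DeltaqfN Da.
have [mi|mi] := pselect (simple_only i m).
  have E1 := simple_al Dm mi; rewrite /= E1 zc in h0 *.
  have viT : al i v <= 2^-1.
    by apply: le_trans (ler_norm _) _; apply: le_trans (vt i) _; rewrite ge_min lexx.
  have [q0|q0] := eqVneq q c; last first.
    have : 1 <= - c%:~R + q%:~R :> R.
      rewrite -intrN -intrD ler1z; move: h0; rewrite -intrN -intrD ler0z; lia.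
    lra.
  exfalso; have /face_near [e1 e10 H1] := faceI FD Fside.
  have [v1 Vv1 /(H1 _ Vv1) [/(_ _ Da) D1]] := vface_small VV e10.
  rewrite /ohalf /= intrN => D2.
  case: kE D1 => -> [] /=; rewrite E1 q0; lra.
have [h1 h2] := HK m Dm mi.
have := bnd _ q t Da kE; rewrite lexx t0 => /(_ isT).
rewrite (DeltaD _ _ Da) /= (qf_hti m t ri rj).
have := qf_ht m vt; rewrite ler_norml => /andP[_ qv].
have tK : tau * (2 * K) <= t by rewrite -ler_pdivlMr ?mulr_gt0 // ge_min lexx orbT.
have : tau * (ht m)%:R <= tau * (K * (hti m)%:R) by rewrite ler_wpM2l // ltW.
have : 0 < t * (hti m)%:R by rewrite mulr_gt0 //; lra.
have : tau * (2 * K) * (hti m)%:R <= t * (hti m)%:R by rewrite ler_wpM2r.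
lra.
Qed.


Lemma vface_Cvf : vface S Cvf.
Proof.
exists false, idfun, finset.set0; split; first exact: weyl_id.
rewrite Fv0; apply/seteqP; split => [v Cv|_ [v Cv <-]]; last by rewrite /sgnR expr0 scale1r.
by exists v => //; rewrite /sgnR expr0 scale1r.
Qed.

(** The difficulty is uniformity over infinitely many constraints. Roots nonnegative on V hold on
    all of x + V; those negative on V have at x a reserve growing with their height, so only
    finitely many need separate neighbourhoods. *)
Lemma chamber_sup E : face z Cvf E -> face x V E.
Proof.
move=> /faceE [k [k' [DE [e e0 He]]]]; apply: (faceS DE) => {E DE}.
pose kE a q := k a = Some q \/ k' a = Some q.
have bnd a q v : Delta a -> kE a q -> Cvf v -> `|v| < e -> 0 <= a (z + v) + q%:~R.
  by move=> Da kEa Cv ve; have := He v Cv ve a Da; case: kEa => -> [] //= _ /ltW.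
(* One constraint at a time: the opposite closed half-apartment would, by [chamber_sub], contain z +
   v for all small v in [Cvf]. *)
have strict a q : Delta a -> kE a q -> face x V (ohalf a (Some q)).
  move=> Da kEa; have [//|/chamber_sub /face_near [e2 e20 H2]] := face_trichotomy x q Da VV.
  have [|v Cv] := vface_small vface_Cvf (e := Num.min e e2); first by rewrite lt_min e0.
  rewrite lt_min => /andP[ve ve2].
  (* Both weak inequalities hold at v and at v/2, which forces a(v) = 0; but no root vanishes on the
     open chamber. *)
  have C2 : Cvf (2^-1 *: v) by apply: (vfaceZ vface_Cvf).
  have v2 : `|2^-1 *: v| <= `|v|.
    by rewrite normrZ ger0_norm ?invr_ge0 // ler_piMl // invf_le1 // ler1n.
  have a1 := bnd a q v Da kEa Cv ve; have a2 := bnd a q _ Da kEa C2 (le_lt_trans v2 ve).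
  have := H2 v Cv ve2; have := H2 _ C2 (le_lt_trans v2 ve2).
  move: a1 a2; rewrite /half /= !(DeltaD _ _ Da) (DeltaZ _ _ Da) intrN => a1 a2 a3 a4.
  have av0 : a v = 0 by lra.
  have [m [aE _]] := Delta_sign Da.
  have : 0 < qf m v.
    by apply: qf_gt0 => //; case: aE Da => ->; [apply: Delta_nz|apply: Delta_nzN].
  by case: aE av0 => -> /=; lra.
have strict_nonneg a q v : Delta a -> kE a q -> (pos_on a V \/ zero_on a V) -> V v ->
    0 < a (x + v) + q%:~R.
  move=> Da kEa aV Vv; have /face_near [e2 e20 H2] := strict a q Da kEa.
  have {}H2 u : V u -> `|u| < e2 -> 0 < a x + a u + q%:~R.
    by move=> Vu ue; have := H2 u Vu ue; rewrite /ohalf /= (DeltaD _ _ Da).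
  rewrite (DeltaD _ _ Da); case: aV => aV; last first.
    have [u Vu ue] := vface_small VV e20; have := H2 u Vu ue.
    by rewrite (aV u Vu) (aV v Vv).
  suff : 0 <= a x + q%:~R by have := aV v Vv; lra.
  have [t t0 Ht] := exists_scale v e20.
  apply: (@limit_ge0 _ _ (a v) t t0) => s /andP[s0 st].
  have sv : `|s *: v| < e2 by apply: Ht; rewrite st ltW.
  by have := H2 (s *: v) (vfaceZ VV s0 Vv) sv; rewrite (DeltaZ _ _ Da); lra.
(* The smallest integral half-apartments containing x, for the forms nonnegative on V, contain x + V
   and so, by [Fclos], the panel. This compares a root at z and at x with an error less than 1. *)
pose kT (b : AA -> R) := if pselect (forall v, V v -> 0 <= b v) then Some (Num.ceil (- b x)) else None.
have [e3 e30 H3] : exists2 e3, 0 < e3 & forall v, Fi v -> `|v| < e3 ->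
    chull kT (fun=> None) (z + v).
  apply: face_near; apply: Fclos; exists (chull kT (fun=> None)).
    apply: (chullP ltr01) => v Vv _ b Db; split => //; rewrite /kT.
    case: pselect => //= /(_ v Vv) bv; rewrite (DeltaD _ _ Db).
    by have := ceil_ge (- b x); lra.
  by have /closure_id <- := @chull_closed kT.
have test a v : Delta a -> pos_on (\- a) V -> Fi v -> `|v| < e3 -> a z + a v - 1 < a x.
  move=> Da aV Fv_v ve; have := H3 v Fv_v ve _ (Delta_opp Da); rewrite /kT.
  case: pselect => [_ [/= + _]|[]]; last by move=> u /aV /ltW.
  rewrite opprK (DeltaD _ _ Da); have := ceilB1_lt (a x); rewrite intrB; lra.
have [rho rhoE] := exists_rho S (fun=> 1 : R).
have [t1 t10 Ht1] := exists_scale rho e0.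
have Crho s : 0 < s -> Cvf (s *: rho) by move=> s0 j; rewrite formZ rhoE mulr1.
have [rhoi [ri rj]] := rho_i_ex.
have [t2 t20 Ht2] := Fi_small ri rj e30.
(* For a negative root, the constraint at z + t1 rho gives a reserve t1 ht at z; moving by t along
   the panel uses at most half of it. *)
pose t := Num.min t2 (t1 / 2).
have t0 : 0 < t by rewrite lt_min t20 divr_gt0.
have t_t2 : t <= t2 by rewrite ge_min lexx.
have t_t1 : t <= t1 / 2 by rewrite ge_min lexx orbT.
have [K K1 HK] := ht_hti.
have K0 : 0 < K by lra.
pose cst := t / K.
have cst0 : 0 < cst by rewrite divr_gt0.
have cstK : cst * K = t by rewrite /cst divfK // gt_eqF.
have qf_rho m s : qf m (s *: rho) = s * (ht m)%:R.
  rewrite /qf natr_sum mulr_sumr; apply: eq_bigr => j _.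
  by rewrite formZ rhoE mulr1 mulrC.
have lower a m q : Delta a -> kE a q -> pos_on (\- a) V -> a <> al i ->
    a = qf m \/ a = \- qf m -> cst * (ht m)%:R - 1 < a x + q%:~R.
  move=> Da kEa aV ai aE.
  have := test a (t *: rhoi) Da aV; have [|Ft te] := Ht2 t; first by rewrite t0.
  move=> /(_ Ft te).
  have hti_le : (hti m)%:R <= (ht m)%:R :> R.
    by rewrite ler_nat /ht (bigD1 i) //= leq_addl.
  case: aE => aE.
    have mi : ~ simple_only i m.
      by move=> mi; apply: ai; rewrite aE simple_al // -aE.
    have [h1 h2] : (ht m)%:R <= K * (hti m)%:R /\ 1 <= (hti m)%:R :> R.
      by apply: HK => //; rewrite -aE.
    have azq : 0 <= a z + q%:~R.
      apply: (@limit_ge0 _ _ (a rho) t1 t10) => s /andP[s0 st].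
      have se : `|s *: rho| < e by apply: Ht1; rewrite st ltW.
      have := bnd a q (s *: rho) Da kEa (Crho s s0) se.
      rewrite (DeltaD _ _ Da) (DeltaZ _ _ Da); lra.
    rewrite {2}aE (qf_hti m t ri rj).
    have : cst * (ht m)%:R <= cst * (K * (hti m)%:R) by rewrite ler_wpM2l // ltW.
    rewrite mulrA cstK; lra.
  have t1e : `|t1 *: rho| < e by apply: Ht1; rewrite lexx ltW.
  have := bnd a q (t1 *: rho) Da kEa (Crho t1 t10) t1e.
  rewrite (DeltaD _ _ Da).
  have -> : a (t1 *: rho) = - (t1 * (ht m)%:R) by rewrite aE /= qf_rho.
  have -> : a (t *: rhoi) = - (t * (hti m)%:R) by rewrite aE /= (qf_hti m t ri rj).
  have : t * (hti m)%:R <= t * (ht m)%:R by rewrite ler_wpM2l // ltW.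
  have : t * (ht m)%:R <= t1 / 2 * (ht m)%:R by rewrite ler_wpM2r.
  have : cst * (ht m)%:R <= t * (ht m)%:R.
    by rewrite ler_wpM2r // /cst ler_pdivrMr // ler_peMr // ltW.
  lra.
(* The reserve cst ht - 1 exceeds the variation (cst/2) ht as soon as cst ht > 2. The finitely many
   roots of [X] are left to [strict]. *)
pose N := (Num.bound (2 / cst)).+1.
pose X := [set a | Delta a /\ exists2 m, (a = qf m \/ a = \- qf m) & forall j, (m j <= N)%N].
have Xfin : finite_set X.
  pose Y := [set qf m | m in [set m | forall j, (m j <= N)%N]].
  have : finite_set (Y `|` [set (fun v => - f v) | f in Y]).
    by rewrite finite_setU; split; last apply: finite_image; apply: finite_bounded_qf.
  apply: sub_finite_set => a [_ [m [->|->] mN]]; first by left; exists m.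
  by right; exists (qf m) => //; exists m.
have [e4 e40 H4] : exists2 e4, 0 < e4 & forall v, V v -> `|v| < e4 ->
    forall a q, X a -> kE a q -> 0 < a (x + v) + q%:~R.
  have /finite_seqP [s sE] := Xfin.
  have sX a : a \in s -> X a by rewrite sE.
  suff [e4 e40 H4] : exists2 e4, 0 < e4 & forall v, V v -> `|v| < e4 ->
      forall a q, a \in s -> kE a q -> 0 < a (x + v) + q%:~R.
    by exists e4 => // v Vv ve a q; rewrite sE; apply: H4.
  elim: s sX {sE} => [|a s IH] sX; first by exists 1.
  have [|e4 e40 H4] := IH; first by move=> b bs; apply: sX; rewrite in_cons bs orbT.
  have Da : Delta a by have [] := sX a (mem_head _ _).
  have near_o o : (forall q, o = Some q -> kE a q) -> face x V (ohalf a o).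
    case: o => [q|] oE; first by apply: strict => //; apply: oE.
    by apply: (face_ohalf Da ltr01).
  have /face_near [e5 e50 H5] := near_o (k a) (fun q => @or_introl _ _).
  have /face_near [e6 e60 H6] := near_o (k' a) (fun q => @or_intror _ _).
  exists (Num.min e4 (Num.min e5 e6)); first by rewrite !lt_min e40 e50.
  move=> v Vv; rewrite !lt_min => /and3P[v4 v5 v6] b q.
  rewrite in_cons => /predU1P[->|]; last exact: H4.
  by case=> E; [have := H5 v Vv v5|have := H6 v Vv v6]; rewrite E.
have cst2 : 0 < cst / 2 by rewrite divr_gt0.
have [e5 e50 H5] := al_small cst2.
suff main v : V v -> `|v| < Num.min e4 e5 -> forall a q, Delta a -> kE a q ->
    0 < a (x + v) + q%:~R.
  apply: (@chullP _ _ _ _ (Num.min e4 e5)); first by rewrite lt_min e40.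
  move=> v Vv ve a Da; split.
    by case E1 : (k a) => [q|] //=; apply/ltW/main => //; left.
  by case E1 : (k' a) => [q|] //=; apply: main => //; right.
move=> Vv; rewrite lt_min => /andP[v4 v5] a q Da kEa.
have [aV|aV|aV] := vface_sign Da VV; try by apply: strict_nonneg => //; auto.
have [Xa|NXa] := pselect (X a); first exact: H4.
have [m [aE _]] := Delta_sign Da.
have ai : a <> al i.
  move=> ai; apply: NXa; split => //; exists (fun j => (j == i) : nat); last first.
    by move=> j; case: (j == i).
  left; rewrite ai; apply/funext => u; rewrite /qf (bigD1 i) //= eqxx mul1r big1 ?addr0 //.
  by move=> j ji; rewrite (negPf ji) mul0r.
have big : 2 < cst * (ht m)%:R.
  rewrite ltNge; apply/negP => small; apply: NXa; split => //; exists m => // j.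
  apply: (@leq_trans (ht m)); first by rewrite /ht (bigD1 j) //= leq_addr.
  rewrite -(ler_nat R); apply: (@le_trans _ _ (2 / cst)).
    by rewrite ler_pdivlMr // mulrC.
  by apply: ltW; apply: lt_trans (archi_boundP _) _; [rewrite ltW // divr_gt0|rewrite ltr_nat].
have := lower a m q Da kEa aV ai aE.
have : `|a v| <= cst / 2 * (ht m)%:R.
  have -> : `|a v| = `|qf m v| by case: aE => -> //=; rewrite normrN.
  by apply: qf_ht => j; apply/ltW/H5.
rewrite ler_norml (DeltaD _ _ Da) => /andP[+ _]; lra.
Qed.

Lemma chamber_eq : face x V = face z Cvf.
Proof. by apply/seteqP; split => E; [apply: chamber_sub|apply: chamber_sup]. Qed.

End ChamberAtPanel.


(** * Faces and closures under the affine Weyl group *)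

Section AffineWeyl.
Local Notation Wa := (@affine_weyl R I n S).
Local Notation Q := (@coroot_lattice R I n S).

Lemma coroot_lattice0 : Q 0.
Proof.
exists (fun=> 0); rewrite big1 => [|i _]; last by rewrite scale0r.
by apply/rowP => j; rewrite !mxE.
Qed.

Lemma coroot_latticeD q q' : Q q -> Q q' -> Q (q + q').
Proof.
move=> [m ->] [m' ->]; exists (fun i => m i + m' i).
have -> : \sum_i (m i + m' i) *: scoroot S i = \sum_i m i *: scoroot S i + \sum_i m' i *: scoroot S i.
  by rewrite -big_split; apply: eq_bigr => i _; rewrite scalerDl.
by apply/rowP => j; rewrite !mxE intrD.
Qed.

Lemma coroot_latticeN q : Q q -> Q (- q).
Proof.
move=> [m ->]; exists (fun i => - m i).
have -> : \sum_i - m i *: scoroot S i = - \sum_i m i *: scoroot S i.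
  by rewrite -sumrN; apply: eq_bigr => i _; rewrite scaleNr.
by apply/rowP => j; rewrite !mxE intrN.
Qed.

Lemma coroot_lattice_alv (c : int) i : Q (c%:~R *: alv i).
Proof.
exists (fun j => if j == i then c else 0).
rewrite (bigD1 i) //= eqxx big1 ?addr0 => [|j ji]; last by rewrite (negPf ji) scale0r.
by apply/rowP => j; rewrite !mxE intrM.
Qed.

Lemma coroot_lattice_form b q : Q q -> exists c : int, form b q = c%:~R.
Proof. by case=> m ->; eexists; rewrite /form /vec pairing_intr. Qed.

Lemma weyl_coroot_lattice w q : W w -> Q q -> Q (w q).
Proof.
move=> Ww Qq; elim/weyl_ind: w / Ww => // i w _ IH /=; rewrite /refl.
have [c ->] := coroot_lattice_form (sroot S i) IH.
by apply: coroot_latticeD => //; apply/coroot_latticeN/coroot_lattice_alv.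
Qed.

Lemma affine_weyl_id : Wa idfun.
Proof.
exists idfun, 0; split; [exact: weyl_id|exact: coroot_lattice0|].
by apply/funext => x /=; rewrite addr0.
Qed.

Lemma affine_weyl_lin w : W w -> Wa w.
Proof.
move=> Ww; exists w, 0; split=> //; first exact: coroot_lattice0.
by apply/funext => x /=; rewrite addr0.
Qed.

Lemma affine_weyl_comp h h' : Wa h -> Wa h' -> Wa (h \o h').
Proof.
move=> [w [q [Ww Qq ->]]] [w' [q' [Ww' Qq' ->]]].
exists (w \o w'), (w q' + q); split; first exact: weyl_comp.
  by apply: coroot_latticeD => //; apply: weyl_coroot_lattice.
by apply/funext => x /=; rewrite (weylD _ _ Ww) addrA.
Qed.

Lemma affine_weyl_inv h : Wa h -> exists h', [/\ Wa h', cancel h h' & cancel h' h].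
Proof.
move=> [w [q [Ww Qq ->]]]; have [w' [Ww' K K']] := weyl_inv Ww.
exists (fun x => w' x + - w' q); split.
- exists w', (- w' q); split => //; apply: coroot_latticeN.
  exact: weyl_coroot_lattice.
- by move=> x; rewrite (weylD _ _ Ww') K addrK.
- by move=> x; rewrite (weylB _ _ Ww) !K' subrK.
Qed.

Lemma chull_pull h k k' : Wa h -> exists k1 k1', chull k1 k1' = h @^-1` chull k k'.
Proof.
move=> [w [q [Ww Qq ->]]]; have [w' [Ww' K K']] := weyl_inv Ww.
(* On roots, b(w' q) is an integer, which [Num.floor] reads off. *)
pose k1 (k0 : (AA -> R) -> option int) b := omap (fun z => z + Num.floor (b (w' q))) (k0 (b \o w')).
have aq b : Delta b -> b (w' q) = (Num.floor (b (w' q)))%:~R.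
  case=> b0 _ <-; have [c ->] := coroot_lattice_form b0 (weyl_coroot_lattice Ww' Qq).
  by rewrite intrKfloor.
have E b x : Delta b -> b x + b (w' q) = (b \o w') (w x + q).
  by move=> Db; rewrite /= (weylD _ _ Ww') K (DeltaD _ _ Db).
have H k0 b x : Delta b -> (half b (k1 k0 b) x <-> half (b \o w') (k0 (b \o w')) (w x + q))
    /\ (ohalf b (k1 k0 b) x <-> ohalf (b \o w') (k0 (b \o w')) (w x + q)).
  move=> Db; rewrite /k1; case: (k0 _) => [z|] //=; rewrite intrD -(aq b Db).
  by rewrite [_%:~R + _]addrC addrA -[b (w' (_ + _))]/((b \o w') _) -(E b x Db).
exists (k1 k), (k1 k'); apply/seteqP; split => x /= Hx a Da.
  have Db : Delta (a \o w) by apply: Delta_weyl.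
  have ab : (a \o w) \o w' = a by apply/funext => y /=; rewrite K'.
  have [] := Hx _ Db; have [h1 _] := H k _ x Db; have [_ h2] := H k' _ x Db.
  by move=> /h1 + /h2; rewrite ab; split.
have Db : Delta (a \o w') by apply: Delta_weyl.
have [] := Hx _ Db; have [h1 _] := H k _ x Da; have [_ h2] := H k' _ x Da.
by move=> /h1 ? /h2 ?; split.
Qed.

Lemma face_pull w q x V E : W w -> Q q ->
  face (w x + q) (w @` V) E -> face x V ((fun y => w y + q) @^-1` E).
Proof.
move=> Ww Qq /faceE [k [k' [DE [e e0 He]]]].
have [|k1 [k1' E1]] := @chull_pull (fun y => w y + q) k k'; first by exists w, q.
apply/faceE; exists k1, k1'; rewrite E1; split; first by move=> y; apply: DE.
have [C C0 HC] := weyl_lip Ww.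
exists (e / C); first by rewrite divr_gt0.
move=> v Vv ve /=; rewrite (weylD _ _ Ww) addrAC; apply: He; first by exists v.
by apply: (le_lt_trans (HC _)); rewrite mulrC -ltr_pdivlMr.
Qed.

Lemma fmap_face w q x V : W w -> Q q ->
  fmap (fun y => w y + q) (face x V) = face (w x + q) (w @` V).
Proof.
move=> Ww Qq; apply/seteqP; split => E; last exact: face_pull.
have [w' [Ww' K K']] := weyl_inv Ww.
rewrite /fmap /= => H.
have Qq' : Q (- w' q) by apply/coroot_latticeN/weyl_coroot_lattice.
have := @face_pull w' (- w' q) (w x + q) (w @` V) ((fun y => w y + q) @^-1` E) Ww' Qq'.
have -> : w' (w x + q) + - w' q = x by rewrite (weylD _ _ Ww') K addrK.
have -> : w' @` (w @` V) = V.
  apply/seteqP; split => [_ [_ [v Vv <-] <-]|v Vv]; first by rewrite K.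
  by exists (w v); [exists v|rewrite K].
move/(_ H); apply: faceS => y /=.
by rewrite (weylD _ _ Ww) (weylN _ Ww) !K' subrK.
Qed.

Lemma vface_weyl w V : W w -> vface S V -> vface S (w @` V).
Proof.
move=> Ww [b [w1 [J [Ww1 ->]]]]; exists b, (w \o w1), J; split; first exact: weyl_comp.
apply/seteqP; split => [_ [_ [v Jv <-] <-]|_ [v Jv <-]].
  by exists v => //; rewrite (weylZ _ _ Ww).
by exists (sgnR R b *: w1 v); [exists v|rewrite (weylZ _ _ Ww)].
Qed.

Lemma is_face_weyl h F : Wa h -> is_face g F -> is_face g (fmap h F).
Proof.
move=> [w [q [Ww Qq ->]]] [x [V [VV ->]]].
exists (w x + q), (w @` V); split; [exact: vface_weyl|exact: fmap_face].
Qed.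

Lemma affine_subspace_pull h (E : set AA) : Wa h -> affine_subspace E ->
  affine_subspace (h @^-1` E).
Proof.
move=> Wh; have [h' [_ K K']] := affine_weyl_inv Wh.
case: Wh K K' => w [q [Ww Qq ->]] K K' [[y Ey] H]; split.
  by exists (h' y); rewrite /= K'.
move=> a b t /= Ea Eb; have := H _ _ t Ea Eb; rewrite [X in E X -> _](_ : _ = w (a + t *: (b - a)) + q) //.
by rewrite (weylD _ _ Ww) (weylZ _ _ Ww) (weylB _ _ Ww) opprD addrACA subrr addr0 addrAC.
Qed.

Lemma is_chamber_weyl h F : Wa h -> is_chamber g F -> is_chamber g (fmap h F).
Proof.
move=> Wh [Ff [aT FT Fmin]]; split; first exact: is_face_weyl.
split=> // E aE FE y _; have [h' [_ K K']] := affine_weyl_inv Wh.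
by rewrite -[y]K'; apply: (Fmin _ (affine_subspace_pull Wh aE) FE).
Qed.

Lemma fclosure_weyl h F Z : Wa h -> fclosure (fmap h F) Z -> fclosure F (h @^-1` Z).
Proof.
move=> [w [q [Ww Qq ->]]] [E FE EZ]; exists ((fun y => w y + q) @^-1` E) => //.
move=> y /closure_rowP H; apply: EZ; apply/closure_rowP => e e0.
have [C C0 HC] := weyl_lip Ww.
have [|v Ev ve] := H (e / C); first by rewrite divr_gt0.
exists (w v); first by move: Ev; rewrite /= (weylD _ _ Ww) addrAC.
by apply: (le_lt_trans (HC _)); rewrite mulrC -ltr_pdivlMr.
Qed.

End AffineWeyl.

(** A chamber lies strictly on one side of the wall. The reflection in the wall fixes the panel and
    exchanges the sides, so [chamber_eq] settles both cases. *)
Lemma panel_chambers z i (c : int) F : al i z = c%:~R -> is_chamber g F ->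
  (forall Z, fclosure F Z -> face z (Fv [set i]%SET) Z) ->
  F = face z Cvf \/ F = fmap (fun y => rr i y + c%:~R *: alv i) (face z Cvf).
Proof.
move=> zc [[x [V [VV ->]]] FT] Fcl.
pose h y := rr i y + c%:~R *: alv i.
have Wh : affine_weyl S h.
  exists (rr i), (c%:~R *: alv i); split => //; first exact: weyl_refl.
  exact: coroot_lattice_alv.
have hz : h z = z by rewrite /h /refl zc subrK.
have hK : involutive h.
  move=> y; rewrite /h reflD reflK reflZ refl_alv scalerN.
  by rewrite -addrA addNr addr0.
have rF : rr i @` Fv [set i]%SET = Fv [set i]%SET.
  have E v : Fv [set i]%SET v -> rr i v = v.
    move=> /(_ i); rewrite finset.in_set1 eqxx /refl => ->.
    by rewrite scale0r subr0.
  apply/seteqP; split => [_ [v Fv_v <-]|v Fv_v]; first by rewrite E.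
  by exists v => //; apply: E.
have side x' V' : vface S V' -> is_support (face x' V') setT ->
    face x' V' (ohalf (al i) (Some (- c))) \/ face x' V' (ohalf (\- al i) (Some c)).
  move=> VV' FT'; have Da := Delta_al g i.
  have [?|H] := face_trichotomy x' (- c) Da VV'; first by left.
  have [?|H'] := face_trichotomy x' c (Delta_opp Da) VV'; first by right.
  (* A face on neither open side would lie in the wall, against its full support. *)
  exfalso; have HF := faceI H H'; case: FT' => _ _ FT'.
  have aff : affine_subspace (half (\- al i) (Some (- - c)) `&` half (\- (\- al i)) (Some (- c)) : set AA).
    split; first by exists z; split; rewrite /half /= zc ?opprK ?intrN; lra.
    move=> u v t; rewrite /half /= !opprK => -[u1 u2] [v1 v2].
    move: u1 u2 v1 v2; rewrite !intrN => u1 u2 v1 v2.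
    have uE : al i u = c%:~R by lra.
    have vE : al i v = c%:~R by lra.
    by rewrite formD formZ formB uE vE subrr mulr0 addr0; split; lra.
  have [v vE] := exists_rho S (fun=> c%:~R + 1 : R).
  have [] := FT' _ aff HF v Logic.I; rewrite /half /= !vE !opprK intrN; lra.
have [H|H] := side x V VV FT; first by left; apply: chamber_eq H.
right; rewrite -(_ : fmap h (fmap h (face x V)) = face x V); last first.
  by apply/seteqP; split => E; rewrite /fmap /= /preimage /=; under eq_set do rewrite hK.
congr (fmap h _).
have fE : fmap h (face x V) = face (h x) (rr i @` V).
  by apply: fmap_face; [apply: weyl_refl|apply: coroot_lattice_alv].
rewrite fE; apply: (chamber_eq zc).
- by apply: vface_weyl => //; apply: weyl_refl.
- move=> Z; rewrite -fE => /(fclosure_weyl Wh)/Fcl FZ.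
  have : fmap h (face z (Fv [set i]%SET)) Z by [].
  have -> : fmap h (face z (Fv [set i]%SET)) = face (h z) (rr i @` Fv [set i]%SET).
    by apply: fmap_face; [apply: weyl_refl|apply: coroot_lattice_alv].
  by rewrite hz rF.
- rewrite -fE; apply: faceS H => y; rewrite /ohalf /= /h formD form_refl formZ form_alv intrN; lra.
Qed.

End Faces.

(** * Sector-germs and retractions *)

Section Norm.
Variables (R : realType) (n : nat) (N : 'rV[R]_n -> R).
Hypothesis NN : is_norm N.

Lemma is_norm0 : N 0 = 0.
Proof. by case: NN => _ NZ _; rewrite -[0 in LHS](scale0r 0) NZ normr0 mul0r. Qed.

Lemma is_normN v : N (- v) = N v.
Proof. by case: NN => _ NZ _; rewrite -scaleN1r NZ normrN1 mul1r. Qed.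

Lemma is_norm_ge0 v : 0 <= N v.
Proof.
case: (NN) => ND NZ _; have := ND v (- v); rewrite subrr is_norm0 is_normN; lra.
Qed.

Lemma is_norm_le : exists2 C, 0 < C & forall v, N v <= C * `|v|.
Proof.
case: (NN) => ND NZ _.
pose e (k : 'I_n) : 'rV[R]_n := \row_j (j == k)%:R.
exists (1 + \sum_k N (e k)); first by rewrite ltr_pwDl // sumr_ge0 // => k _; apply: is_norm_ge0.
move=> v; have vE : v = \sum_k v ord0 k *: e k.
  apply/rowP => j; rewrite summxE (bigD1 j) //= !mxE eqxx mulr1 big1 ?addr0 // => k kj.
  by rewrite !mxE eq_sym (negPf kj) mulr0.
have : N v <= \sum_k `|v ord0 k| * N (e k).
  rewrite {1}vE; elim/big_ind2: _ => [|x a y b xa yb|k _]; first by rewrite is_norm0.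
    by apply: (le_trans (ND _ _)); apply: lerD.
  by rewrite NZ.
move/le_trans; apply; rewrite mulrDl mul1r mulr_suml -[leLHS]add0r lerD // ler_sum // => k _.
by rewrite mulrC ler_wpM2l ?is_norm_ge0 // coord_le_norm.
Qed.

Lemma is_norm_ge : exists2 c, 0 < c & forall v, c * `|v| <= N v.
Proof.
case: (NN) => ND NZ N0.
pose A := [set v : 'rV[R]_n | `|v| = 1].
have [A0|/set0P/negP/negPn/eqP A0] := pselect (A !=set0); last first.
  exists 1 => // v; have [->|v0] := eqVneq v 0; first by rewrite normr0 mulr0 is_norm_ge0.
  have : A (`|v|^-1 *: v) by rewrite /A /= normrZ normfV normr_id mulVf // normr_eq0.
  by rewrite A0.
have Ncont : continuous N.
  have [C C0 HC] := is_norm_le.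
  move=> v B /nbhs_normP [e /= e0 H]; apply/nbhs_rowP.
  exists (e / C); first by rewrite divr_gt0.
  move=> d de; apply: H; rewrite /ball_ /=.
  apply: (@le_lt_trans _ _ (C * `|d|)); last by rewrite mulrC -ltr_pdivlMr.
  have h1 := ND v d; have h2 := ND (v + d) (- d); rewrite addrK is_normN in h2.
  by rewrite ler_norml; have := HC d; lra.
have Acompact : compact A.
  apply: bounded_closed_compact.
    by exists 1; split => // x x1 v /= ->; apply: ltW.
  have -> : A = (fun v => `|v|) @^-1` [set 1] by [].
  apply: preimage_closed => [v _|]; first exact: norm_continuous.
  exact: closed_eq.
have [c Ac cmin] := EVT_min_rV A0 Acompact (continuous_subspaceT Ncont).
have c1 : `|c| = 1 by move: Ac; rewrite inE.
exists (N c).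
  rewrite lt_def is_norm_ge0 andbT; apply/eqP => /N0 c0.
  by move/eqP: c1; rewrite c0 normr0 eq_sym oner_eq0.
move=> v; have [->|v0] := eqVneq v 0; first by rewrite normr0 mulr0 is_norm_ge0.
have nv : 0 < `|v| by rewrite normr_gt0.
have : N c <= N (`|v|^-1 *: v).
  by apply: cmin; rewrite inE /A /= normrZ normfV normr_id mulVf // gt_eqF.
by rewrite NZ normfV normr_id ler_pdivlMl // mulrC.
Qed.

End Norm.

Lemma lattice_small (R : realType) n (y : 'rV[int]_n) : `|vec R y| < 1 -> y = 0.
Proof.
move=> y1; apply/rowP => k; rewrite mxE.
have : `|(y ord0 k)%:~R : R| < 1.
  by apply: le_lt_trans y1; have := coord_le_norm (vec R y) k; rewrite /vec mxE.
by rewrite -intr_norm ltrz1; move: (y ord0 k) => z; lia.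
Qed.

(** * Sector-germs of the model apartment *)

Section ModelGerms.
Variables (R : realType) (I : finType) (n : nat) (S : rootDatum I n).
Variables (L : lmodType R[i]) (g : kacMoodyAlgebra S L).
Local Notation AA := 'rV[R]_n.
Local Notation al i := (@form R n (sroot S i)).
Local Notation W := (@weyl R I n S).
Local Notation Cvf := (@Cvf R I n S).
Local Notation Delta := (Delta g).
Local Notation face := (face g).
Local Notation chull := (chull g).
Implicit Types (x v u : AA) (V : set AA).

Definition cone b : set AA := [set sgnR R b *: v | v in Cvf].
Definition deep b u : set AA := [set v | forall i, 0 < al i (sgnR R b *: (v - u))].

Lemma coneP b v : cone b v <-> forall i, 0 < al i (sgnR R b *: v).
Proof.
split=> [[u Cu <-] i|H]; first by rewrite sgnRK.
by exists (sgnR R b *: v); rewrite ?sgnRK.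
Qed.

Lemma cone_vface b : vface S (cone b).
Proof.
exists b, idfun, finset.set0; split; first exact: weyl_id.
by rewrite Fv0.
Qed.

Lemma translate_cone b u : translate u (cone b) = deep b u.
Proof.
apply/seteqP; split => [_ [v /coneP Cv <-] i|v H].
  by rewrite addrAC subrr add0r.
by exists (v - u); [apply/coneP|rewrite addrC subrK].
Qed.

Lemma exists_deep b (vs : seq AA) : exists u, cone b u /\ forall v, v \in vs -> deep b v u.
Proof.
have [rho rhoE] := exists_rho S (fun=> 1 : R).
have [C C0 HC] : exists2 C, 0 < C & forall v, v \in vs -> forall i, `|al i v| < C.
  elim: vs => [|v vs [C C0 HC]]; first by exists 1.
  exists (C + \sum_i (1 + `|al i v|)).
    by rewrite ltr_pwDl // sumr_ge0 // => i _; rewrite addr_ge0.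
  move=> v'; rewrite in_cons => /predU1P[->|/HC H] i; last first.
    by apply: (lt_le_trans (H i)); rewrite lerDl sumr_ge0 // => j _; rewrite addr_ge0.
  rewrite (bigD1 i) //=; apply: (@lt_le_trans _ _ (C + (1 + `|al i v|))); first by lra.
  by rewrite lerD2l lerDl sumr_ge0 // => j _; rewrite addr_ge0.
have E i : al i (sgnR R b *: (sgnR R b *: (C *: rho))) = C by rewrite sgnRK formZ rhoE mulr1.
exists (sgnR R b *: (C *: rho)); split; first by apply/coneP => i; rewrite E.
move=> v /HC H i; rewrite scalerBr formB E subr_gt0 formZ.
apply: le_lt_trans (H i); apply: le_trans (ler_norm _) _.
by rewrite normrM /sgnR normrX normrN1 expr1n mul1r.
Qed.

Lemma deep_trans b u v w : deep b u v -> deep b v w -> deep b u w.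
Proof.
move=> uv vw i; have := uv i; have := vw i.
rewrite !scalerBr !formB; lra.
Qed.

Lemma germ_inftyP b Z : germ_infty S b Z <-> exists u, deep b u `<=` Z.
Proof.
split=> [[u _]|[u uZ]]; rewrite ?add0r ?translate_cone; first by exists u.
have [p [Cp Hp]] := exists_deep b [:: u].
exists p; first exact: subset_closure.
rewrite add0r -/(cone b) translate_cone => v pv; apply: uZ.
by apply: deep_trans pv; apply: Hp; rewrite mem_head.
Qed.

Lemma germ_inftyI b (Z Z' : set AA) : germ_infty S b Z -> germ_infty S b Z' -> germ_infty S b (Z `&` Z').
Proof.
move=> /germ_inftyP [u uZ] /germ_inftyP [u' uZ']; apply/germ_inftyP.
have [p [_ Hp]] := exists_deep b [:: u; u']; exists p => v pv.
by split; [apply: uZ|apply: uZ']; apply: deep_trans pv; apply: Hp; rewrite !inE eqxx ?orbT.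
Qed.

Lemma germ_inftyS b (Z Z' : set AA) : Z `<=` Z' -> germ_infty S b Z -> germ_infty S b Z'.
Proof. by move=> ZZ' /germ_inftyP [u uZ]; apply/germ_inftyP; exists u; apply: subset_trans ZZ'. Qed.

Lemma deep_near b u v : deep b u v -> exists2 e, 0 < e & forall d, `|d| < e -> deep b u (v + d).
Proof.
move=> uv.
suff [e e0 He] : exists2 e, 0 < e & forall d, `|d| < e ->
    forall i, i \in enum I -> 0 < al i (sgnR R b *: (v + d - u)).
  by exists e => // d de i; apply: He => //; rewrite mem_enum.
elim: (enum I) => [|i s [e e0 IH]]; first by exists 1.
have [e' e'0 He'] := al_small S (uv i).
exists (Num.min e e'); first by rewrite lt_min e0.
move=> d; rewrite lt_min => /andP[de de'] j; rewrite in_cons => /predU1P[->|]; last exact: IH.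
rewrite addrAC scalerDr formD; have := He' (sgnR R b *: d); rewrite normr_sgnR => /(_ de' i).
by rewrite ltr_norml => /andP[+ _]; lra.
Qed.

Lemma deep_span b u (E : set AA) : affine_subspace E -> deep b u `<=` E -> E = setT.
Proof.
move=> [_ aE] uE; apply/seteqP; split => // y _.
have [p [_ /(_ u (mem_head _ _)) up]] := exists_deep b [:: u].
have [e e0 He] := deep_near up.
have [t t0 Ht] := exists_scale (y - p) e0.
have Eq : E (p + t *: (y - p)) by apply/uE/He/Ht; rewrite lexx ltW.
have := aE p _ t^-1 (uE _ up) Eq.
by rewrite addrAC subrr add0r scalerA mulVf ?gt_eqF // scale1r addrC subrK.
Qed.

Lemma chullN k : chull k (fun=> None) = \bigcap_(a in Delta) half a (k a).
Proof. by apply/seteqP; split => x H a /H; [case|move=> ?; split]. Qed.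

Lemma enclosureP F Z : enclosure g F Z <->
  exists k, F (chull k (fun=> None)) /\ chull k (fun=> None) `<=` Z.
Proof. by split=> -[k]; rewrite -?chullN => H; exists k; rewrite ?chullN // -chullN. Qed.

Lemma al_inj i j : al i = al j -> i = j.
Proof.
have [v vE] := exists_rho S (fun j => if j == i then 1 else 0 : R).
move=> /(congr1 (fun f => f v)); rewrite !vE eqxx; case: eqP => // _ /eqP.
by rewrite oner_eq0.
Qed.

Lemma chull_simple b (m : I -> int) : exists k, forall v,
  chull k (fun=> None) v <-> forall i, (m i)%:~R <= al i (sgnR R b *: v).
Proof.
pose f i : AA -> R := fun v => al i (sgnR R b *: v).
have Df i : Delta (f i).
  have [a Da aE] := Delta_twist b (Delta_al g i) (weyl_id R S).
  by rewrite (_ : f i = a) //; apply/funext => v; rewrite -aE.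
have finj i j : f i = f j -> i = j.
  move=> ij; apply: al_inj; apply/funext => v.
  by have := congr1 (fun h => h (sgnR R b *: v)) ij; rewrite /f sgnRK.
pose k (a : AA -> R) := if [pick i | `[< a = f i >]] is Some i then Some (- m i) else None.
have kf i : k (f i) = Some (- m i).
  rewrite /k; case: pickP => [j /asboolP /finj -> //|/(_ i)].
  by move/asboolPn; case.
exists k => v; split=> [H i|H a Da].
  by have [+ _] := H _ (Df i); rewrite kf /half /= intrN /f; lra.
split => //; rewrite /k; case: pickP => [i /asboolP ->|//] /=.
by rewrite intrN /f; have := H i; lra.
Qed.

(** This makes (MA3) and (MA4), stated for germs of chimneys, applicable to sector-germs. *)
Lemma chimney_germ_infty b : chimney_germ g (face 0 (cone b)) (cone b) = germ_infty S b.
Proof.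
apply/seteqP; split => Z.
  move=> [u clu /enclosureP [k [[E FE EV] DZ]]]; apply/germ_inftyP.
  have [e e0 He] := face_near FE.
  have [v Cv ve] := vface_small (cone_vface b) e0.
  exists (u + v) => p; rewrite -translate_cone => -[c Cc <-]; apply/DZ/EV.
  exists (u + v); last by exists c.
  by have := He v Cv ve; rewrite /= add0r.
move=> /germ_inftyP [u uZ].
(* Enclosures only give weak inequalities with integral constants; rounding up and adding 1 makes
   them strict beyond u. *)
have [k kE] := chull_simple b (fun i => Num.ceil (al i (sgnR R b *: u)) + 1).
have [k0 k0E] := chull_simple b (fun=> 0).
have [rho rhoE] := exists_rho S (fun i => (Num.ceil (al i (sgnR R b *: u)) + 1)%:~R : R).
have [u' [Cu' Hu']] := exists_deep b [:: sgnR R b *: rho].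
have {}Hu' i : (Num.ceil (al i (sgnR R b *: u)) + 1)%:~R <= al i (sgnR R b *: u').
  have := Hu' _ (mem_head _ _) i; rewrite scalerBr formB sgnRK rhoE; lra.
exists u'; first exact: subset_closure.
apply/enclosureP; exists k; split; last first.
  move=> v /kE H; apply: uZ => i; have := H i; rewrite scalerBr formB intrD.
  by have := ceil_ge (al i (sgnR R b *: u)); lra.
exists [set u' + y | y in chull k0 (fun=> None)].
  rewrite /fmap /=; apply: faceS (chullP ltr01 (k := k0) (k' := fun=> None) _) => [y Hy|v /coneP Cv _].
    by exists y.
  by rewrite add0r; apply/k0E => i; apply: ltW.
move=> _ [_ [y /k0E Hy <-] [v /coneP Cv <-]]; apply/kE => i.
rewrite !scalerDr !formD; have := Hy i; have := Cv i; have := Hu' i; lra.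
Qed.

Lemma is_support_chimney_cone b : is_support (chimney g (face 0 (cone b)) (cone b)) setT.
Proof.
split; first by split; [exists 0|].
  by apply/enclosureP; exists (fun=> None); split => //; exists setT => //;
    apply: (faceS (E := chull (fun=> None) (fun=> None))) => //; apply: (chullP ltr01).
move=> E aE /enclosureP [k [[E' FE' EV] DE]].
have [e e0 He] := face_near FE'.
have [v Cv ve] := vface_small (cone_vface b) e0.
rewrite (deep_span aE (b := b) (u := v)) // => p; rewrite -translate_cone => -[c Cc <-].
apply/DE/EV; exists v; last by exists c.
by have := He v Cv ve; rewrite add0r.
Qed.

Lemma spherical_cone b : spherical S (cone b).
Proof.
have [p [Cp _]] := exists_deep b [::].
exists p; split=> //.
have tC c : Cvf c -> tits S c.
  by move=> Cc; exists idfun; [exact: weyl_id|exists c => //; apply: subset_closure].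
have tI c : Cvf c -> interior (tits S) c.
  move=> Cc; apply/nbhs_rowP.
  have [|e e0 He] := @deep_near false 0 c.
    by move=> i; rewrite subr0 /sgnR expr0 scale1r; apply: Cc.
  exists e => // d de; apply: tC => i; have := He d de i.
  by rewrite subr0 /sgnR expr0 scale1r.
case: Cp => c Cc <-; case: b; rewrite /sgnR ?expr0 ?scale1r; last by left; apply: tI.
by right; exists c; [apply: tI|rewrite expr1 scaleN1r].
Qed.

Lemma germ_infty_splayed b : is_splayed_chimney_germ g (germ_infty S b).
Proof.
exists (face 0 (cone b)), (cone b); split.
- by exists 0, (cone b); split => //; apply: cone_vface.
- exact: cone_vface.
- exact: spherical_cone.
- by rewrite chimney_germ_infty.
Qed.

Lemma germ_infty_solid b : is_solid_chimney_germ g (germ_infty S b).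
Proof.
exists (face 0 (cone b)), (cone b); split.
- by exists 0, (cone b); split => //; apply: cone_vface.
- exact: cone_vface.
- exists setT; split; first exact: is_support_chimney_cone.
  apply: sub_finite_set (finite_set1 (idfun : AA -> AA)) => w [Ww H].
  by apply/funext => v; have := H 0 v Logic.I Logic.I; rewrite subr0.
- by rewrite chimney_germ_infty.
Qed.

Lemma sector_germ_modelE b F : sector_germ_model S b F ->
  exists2 w, W w & F = fmap w (germ_infty S b).
Proof.
move=> [x [V [[w [Ww ->]] ->]]]; exists w => //.
have [w' [Ww' K K']] := weyl_inv Ww.
have VE v : [set sgnR R b *: w v | v in Cvf] v <-> cone b (w' v).
  split=> [[c Cc <-]|[c Cc E]]; first by exists c => //; rewrite (weylZ _ _ Ww') K.
  by exists c => //; rewrite -[v]K' -E (weylZ _ _ Ww).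
have tr u v : translate u [set sgnR R b *: w v | v in Cvf] v <-> deep b (w' u) (w' v).
  rewrite -translate_cone; split=> [[c /VE Cc <-]|[c Cc E]].
    by exists (w' c) => //; rewrite (weylD _ _ Ww').
  exists (w c); first by apply/VE; rewrite K.
  by rewrite -[v]K' -E (weylD _ _ Ww) K'.
apply/seteqP; split => Z.
  move=> [u _ uZ]; apply/germ_inftyP; exists (w' (x + u)) => v /= H.
  by apply/uZ/tr; rewrite K.
move=> /germ_inftyP [u uZ].
have [p [Cp Hp]] := exists_deep b [:: u - w' x].
exists (w p); first by apply: subset_closure; apply/VE; rewrite K.
move=> v /tr; rewrite (weylD _ _ Ww') K => H; rewrite -[v]K'; apply: uZ.
apply: deep_trans H; have := Hp _ (mem_head _ _) => H i.
by have := H i; rewrite opprB addrA (addrC p).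
Qed.

End ModelGerms.

(** * Apartments containing a sector-germ *)

Section Masure.
Variables (R : realType) (I : finType) (n : nat) (S : rootDatum I n).
Variables (L : lmodType R[i]) (g : kacMoodyAlgebra S L).
Variables (M : Type) (apt : set (set M)) (isom : set M -> set ('rV[R]_n -> M)).
Hypothesis MM : masure g apt isom.
Local Notation AA := 'rV[R]_n.
Local Notation al i := (@form R n (sroot S i)).
Local Notation W := (@weyl R I n S).
Local Notation Wa := (@affine_weyl R I n S).
Local Notation Fv := (@Fv R I n S).
Local Notation face := (face g).
Local Notation chull := (chull g).
Local Notation cl k := (chull k (fun=> None)).
Local Notation weyl_iso := (weyl_iso S isom).
Local Notation encl_by := (encl_by g).
Implicit Types (A B : set M) (f : AA -> M) (U s : set_system M) (p : M -> M).

Lemma isom_inj A f : apt A -> isom A f -> injective f.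
Proof.
move=> /(MA1 MM) [f0 [f0i _ ->]] [h Wh <-].
have [h' [_ K _]] := affine_weyl_inv Wh.
exact: inj_comp f0i (can_inj K).
Qed.

Lemma isom_range A f : apt A -> isom A f -> range f = A.
Proof.
move=> /(MA1 MM) [f0 [_ <- ->]] [h Wh <-].
have [h' [_ _ K]] := affine_weyl_inv Wh.
apply/seteqP; split => [_ [x _ <-]|_ [x _ <-]]; first by exists (h x).
by exists (h' x) => //=; rewrite K.
Qed.

Lemma isom_in A f x : apt A -> isom A f -> A (f x).
Proof. by move=> aA iA; rewrite -(isom_range aA iA); exists x. Qed.

Lemma isom_surj A f y : apt A -> isom A f -> A y -> exists x, y = f x.
Proof. by move=> aA iA; rewrite -(isom_range aA iA) => -[x _ <-]; exists x. Qed.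

Lemma isom_comp A f h : apt A -> isom A f -> Wa h -> isom A (f \o h).
Proof.
move=> /(MA1 MM) [f0 [_ _ ->]] [h0 Wh0 <-] Wh; exists (h0 \o h) => //.
exact: affine_weyl_comp.
Qed.

Lemma isom_exists A : apt A -> exists f, isom A f.
Proof. by move=> /(MA1 MM) [f0 [_ _ ->]]; exists f0, idfun => //; apply: affine_weyl_id. Qed.

Lemma isom_rel A f f' : apt A -> isom A f -> isom A f' -> exists2 h, Wa h & f' = f \o h.
Proof.
move=> /(MA1 MM) [f0 [_ _ ->]] [h0 Wh0 <-] [h1 Wh1 <-].
have [h0' [Wh0' K K']] := affine_weyl_inv Wh0.
exists (h0' \o h1); first exact: affine_weyl_comp.
by apply/funext => x /=; rewrite K'.
Qed.

Lemma weyl_iso_isom A B p f : apt B -> weyl_iso A B p -> isom A f -> isom B (p \o f).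
Proof.
move=> aB pAB iA; have [f' iB] := isom_exists aB.
by have [h Wh ->] := pAB f f' iA iB; apply: isom_comp.
Qed.

Lemma fmap_eq_on (T T' : Type) (F : set_system T) (f f' : T -> T') E :
  (forall X Y, F X -> F Y -> F (X `&` Y)) -> (forall X Y, X `<=` Y -> F X -> F Y) ->
  F E -> (forall x, E x -> f x = f' x) -> fmap f F = fmap f' F.
Proof.
move=> FI FS FE ff'; apply/seteqP; split => Z FZ.
  by apply: FS (FI _ _ FE FZ) => x [Ex]; rewrite /preimage /= ff'.
by apply: FS (FI _ _ FE FZ) => x [Ex]; rewrite /preimage /= ff'.
Qed.

Lemma encl_byP A f U E : apt A -> isom A f ->
  encl_by f U E <-> exists k, U (f @` cl k) /\ f @` cl k `<=` E.
Proof.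
move=> aA iA; split => [/enclosureP [k [Uk kE]]|[k [Uk kE]]].
  by exists k; split => // _ [x kx <-]; apply: kE.
by apply/enclosureP; exists k; split => // x kx; apply: kE; exists x.
Qed.

Lemma fixes_encl A f U p : apt A -> isom A f -> fixes p (encl_by f U) ->
  exists k, U (f @` cl k) /\ forall x, cl k x -> p (f x) = f x.
Proof.
move=> aA iA [E /(encl_byP _ _ aA iA) [k [Uk kE]] pE].
by exists k; split => // x kx; apply/pE/kE; exists x.
Qed.

Lemma preimage_image_inj f E : injective f -> f @^-1` (f @` E) = E.
Proof.
by move=> fi; apply/seteqP; split => [x [y Ey /fi <-]|x Ex] //; exists x.
Qed.

Lemma point_containment A B f a : apt A -> apt B -> isom A f -> B (f a) ->
  exists k, cl k a /\ f @` cl k `<=` B.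
Proof.
move=> aA aB iA Ba.
have [|] := MA2 MM (A := A) (A' := B) (f := f) (U := fmap f (globally [set a])).
  split => //; last by move=> x ->.
  by exists (globally [set a]); split => //; constructor 1; exists a.
move=> /(encl_byP _ _ aA iA) [k [Uk kE]] _.
exists k; split; last by move=> x /kE [].
by have [x kx /(isom_inj aA iA) <-] := Uk a erefl.
Qed.

(** Points are not among the filters of (MA3) and (MA4). The minimal vectorial face [Fv [set: I]] is
    killed by all roots, so the face it defines at a belongs to the same enclosed sets as a and
    stands for this point. *)
Lemma face_point_cl a k : cl k a -> face a (Fv [set: I]%SET) (cl k).
Proof.
move=> ka; apply: (chullP ltr01) => v Fv_v _ b Db; split => //.
have [+ _] := ka b Db; case: (k b) => [z|] //=; rewrite (DeltaD _ _ Db).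
have -> : b v = 0; last by rewrite addr0.
have v0 i : al i v = 0 by have := Fv_v i; rewrite finset.inE.
have [m [[->|->] _]] := Delta_sign Db; rewrite /= /qf big1 ?oppr0 // => i _;
  by rewrite v0 mulr0.
Qed.

Lemma vface_FvT : vface S (Fv [set: I]%SET).
Proof.
exists false, idfun, [set: I]%SET; split; first exact: weyl_id.
apply/seteqP; split => [v Fv_v|_ [v Fv_v <-]]; last by rewrite /sgnR expr0 scale1r.
by exists v => //; rewrite /sgnR expr0 scale1r.
Qed.

Lemma FvT0 : Fv [set: I]%SET 0.
Proof. by move=> i; rewrite finset.inE form0. Qed.

Lemma face_point a E : face a (Fv [set: I]%SET) E -> E a.
Proof. by move=> /face_near [e e0 H]; rewrite -[a]addr0; apply: H; rewrite ?normr0 //; apply: FvT0. Qed.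

(* MA2 for the germ of ]x, x + v] with v in V: the roots being of constant
   sign on V, its enclosure contains the face. *)
Lemma face_containment A B f x V : apt A -> apt B -> isom A f -> vface S V ->
  fmap f (face x V) B ->
  [/\ exists2 k, face x V (cl k) & f @` cl k `<=` B
    & exists2 p, weyl_iso A B p &
        exists2 k, face x V (cl k) & forall y, cl k y -> p (f y) = f y].
Proof.
move=> aA aB iA VV FB.
suff [U [UM UB Uface]] : exists U, [/\ exists F, MA2_filter g F /\ U = fmap f F, U B
    & forall k, U (f @` cl k) -> face x V (cl k)].
  have [|H [p [piso pfix]]] := MA2 MM (A := A) (A' := B) (f := f) (U := U); first by [].
  split.
    move/(encl_byP _ _ aA iA): H => [k [Uk kE]]; exists k; first exact: Uface.
    by move=> y /kE [].
  have [k [Uk kp]] := fixes_encl aA iA pfix.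
  by exists p => //; exists k => //; apply: Uface.
have [e e0 He] := face_near FB.
have [v Vv ve] := vface_small VV e0.
have Vt t : 0 < t -> V (t *: v) by move=> t0; apply: (vfaceZ VV).
(* If V contains 0, every root vanishes on V, by constancy of sign, and (MA2) for the point x
   suffices; there is no interval to use. *)
have [v0|v0] := eqVneq v 0.
  have V0 : V 0 by rewrite -v0.
  exists (fmap f (globally [set x])); split.
  - by exists (globally [set x]); split => //; constructor 1; exists x.
  - move=> _ ->; have := He 0 V0; rewrite normr0 addr0; exact.
  - move=> k Uk; have : cl k x by have [y ky /(isom_inj aA iA) <-] := Uk x erefl.
    move=> kx; apply: (chullP ltr01) => u Vu _ b Db; split => //.
    have [+ _] := kx b Db; case: (k b) => [z|] //=; rewrite (DeltaD _ _ Db).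
    have b0 : b 0 = 0 by rewrite -(subrr x) (DeltaB _ _ Db) subrr.
    have -> : b u = 0; last by rewrite addr0.
    have [H|H|H] := vface_sign Db VV; last 1 first.
    + by have := H 0 V0; rewrite /= b0 oppr0 ltxx.
    + by have := H 0 V0; rewrite b0 ltxx.
    + exact: H.
exists (fmap f (within (segment x (x + v) `\ x) (nbhs x))); split.
- exists (within (segment x (x + v) `\ x) (nbhs x)); split => //; constructor 2.
  exists x, (x + v); split; last by right.
    by move=> /eqP; rewrite -{1}[x]addr0 (inj_eq (addrI x)) eq_sym (negPf v0).
  rewrite /preordered addrAC subrr add0r opprD addrA subrr add0r.
  exact: vface_tits VV Vv.
- apply/nbhs_rowP; exists 1 => // u _ [[t /andP[t0 t1] uE] ux].
  rewrite uE addrAC subrr add0r; apply: He.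
    apply: Vt; rewrite lt_def t0 andbT; apply/eqP => tz; apply: ux.
    by rewrite uE tz scale0r addr0.
  rewrite normrZ ger0_norm //; apply: le_lt_trans ve.
  by rewrite -[leRHS]mul1r ler_wpM2r.
move=> k /nbhs_rowP [e1 e10 He1].
have [t0 t00 Ht0] := exists_scale v e10.
pose t1 := Num.min t0 1.
have t10 : 0 < t1 by rewrite lt_min t00 ltr01.
have seg t : 0 < t <= t1 -> cl k (x + t *: v).
  move=> /andP[tp]; rewrite le_min => /andP[tt0 tt1].
  have tv : `|t *: v| < e1 by apply: Ht0; rewrite tt0 ltW.
  have [|y ky /(isom_inj aA iA) <-] := He1 _ tv; last by [].
  split; first by exists t; [rewrite tt1 ltW|rewrite addrAC subrr add0r].
  move=> /eqP; rewrite -[X in _ == X]addr0 (inj_eq (addrI x)) scaler_eq0 (negPf v0) orbF.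
  by rewrite gt_eqF.
(* The point x + t1 v already controls all roots negative on V at once; the others are controlled by
   x, as a limit, or by constancy. *)
have [d d0 Hd] := vface_dominate g VV (Vt _ t10).
apply: (chullP d0) => u Vu ud b Db; split => //.
case kb : (k b) => [z|] //=; rewrite (DeltaD _ _ Db).
have seg' t : 0 < t <= t1 -> 0 <= b x + t * b v + z%:~R.
  by move=> /seg /(_ b Db) [+ _]; rewrite kb /half /= (DeltaD _ _ Db) (DeltaZ _ _ Db).
have [H|H|H] := vface_sign Db VV.
- have : 0 <= b x + z%:~R.
    by apply: (@limit_ge0 _ _ (b v) t1) => // s /seg'; rewrite addrAC.
  by have := H u Vu; lra.
- by rewrite (H u Vu); have := seg' t1; rewrite t10 lexx (H v Vv) mulr0; exact.
- have := Hd u Vu ud b Db; rewrite (DeltaZ _ _ Db).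
  have t1v : 0 < t1 * - b v by rewrite mulr_gt0 //; apply: H v Vv.
  have := seg' t1; rewrite t10 lexx => /(_ isT) h1 h2.
  have := h2; rewrite mulrN in t1v; lra.
Qed.

Section SectorGerm.
Variables (b : bool) (s : set_system M).
Hypothesis ss : sector_germ S apt isom b s.

Lemma sector_germ_isom : exists A f, [/\ apt A, isom A f & s = fmap f (germ_infty S b)].
Proof.
case: ss => A [f [F [aA iA /sector_germ_modelE [w Ww FE] sE]]].
exists A, (f \o w); split => //; first by apply: isom_comp => //; apply: affine_weyl_lin.
by rewrite sE FE.
Qed.

Lemma sector_splayed : in_apartment apt isom (is_splayed_chimney_germ g) s.
Proof.
have [A [f [aA iA sE]]] := sector_germ_isom.
by exists A, f, (germ_infty S b); split => //; apply: germ_infty_splayed.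
Qed.

Lemma sector_solid : in_apartment apt isom (MA3_filter g) s.
Proof.
have [A [f [aA iA sE]]] := sector_germ_isom.
by exists A, f, (germ_infty S b); split => //; right; apply: germ_infty_solid.
Qed.

Lemma sectorI E E' : s E -> s E' -> s (E `&` E').
Proof. by have [A [f [_ _ ->]]] := sector_germ_isom; apply: germ_inftyI. Qed.

Lemma sectorS E E' : E `<=` E' -> s E -> s E'.
Proof.
have [A [f [_ _ ->]]] := sector_germ_isom => EE'.
by apply: germ_inftyS => x; apply: EE'.
Qed.

Lemma sector_iso A B U f : apt A -> apt B -> isom A f ->
  in_apartment apt isom (MA3_filter g) U -> s A -> s B -> U A -> U B ->
  exists p, [/\ weyl_iso A B p,
    exists k, [/\ s (f @` cl k), U (f @` cl k) & forall x, cl k x -> p (f x) = f x],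
    MA4_data g apt isom A B f s U & fixes p (encl_by f (fcup s U))].
Proof.
move=> aA aB iA HU sA sB UA UB.
have D : MA4_data g apt isom A B f s U.
  by split => //; split => //; apply: sector_splayed.
have [p [piso pfix]] := MA4 MM D.
exists p; split => //; have [k [[E1 s1 [E2 U2 E12]] kp]] := fixes_encl aA iA pfix.
exists k; split => //; first by apply: sectorS s1; rewrite -E12 => x; left.
suff US X Y : X `<=` Y -> U X -> U Y by apply: US U2; rewrite -E12 => x; right.
move=> XY; case: HU => A' [f' [F [_ _ HF ->]]]; rewrite /fmap /=.
case: HF => [[x [V [_ ->]]]|[F0 [V [_ _ _ ->]]]].
  by apply: faceS => y; apply: XY.
move=> [u cu /enclosureP [k' [H1 H2]]]; exists u => //; apply/enclosureP; exists k'.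
by split => // y /H2; apply: XY.
Qed.

Lemma sector_in B : apt B -> s B -> exists f, isom B f /\ s = fmap f (germ_infty S b).
Proof.
move=> aB sB; have [A [f [aA iA sE]]] := sector_germ_isom.
have sA : s A.
  rewrite sE; apply/germ_inftyP; exists 0 => x _ /=; exact: (isom_in x aA iA).
have [p [piso [k [sk _ kp]] _ _]] := sector_iso aA aB iA sector_solid sA sB sA sB.
exists (p \o f); split; first exact: weyl_iso_isom piso iA.
rewrite sE; apply: (@fmap_eq_on _ _ _ _ _ (cl k)).
- by move=> X Y; apply: germ_inftyI.
- by move=> X Y; apply: germ_inftyS.
- by move: sk; rewrite sE /fmap /= preimage_image_inj //; apply: isom_inj iA.
- by move=> x kx /=; rewrite kp.
Qed.

Lemma affine_eq_deep (w w' : AA -> AA) t t' u : W w -> W w' ->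
  (forall x, deep S b u x -> w x + t = w' x + t') -> forall x, w x + t = w' x + t'.
Proof.
move=> Ww Ww' H x.
have aE : affine_subspace [set x | w x + t = w' x + t'].
  split.
    have [q [_ /(_ u (mem_head _ _)) uq]] := exists_deep S b [:: u].
    by exists q; apply: H.
  move=> y z c /= yE zE; rewrite (weylD _ _ Ww) (weylD _ _ Ww') (weylZ _ _ Ww) (weylZ _ _ Ww').
  rewrite (weylB _ _ Ww) (weylB _ _ Ww').
  have -> : w z - w y = w' z - w' y.
    by rewrite -[w z](addrK t) zE -[w y](addrK t) yE opprB addrA subrK opprD addrACA subrr addr0.
  by rewrite addrAC yE addrAC.
have := deep_span aE H => /seteqP [_ /(_ x)]; exact.
Qed.

(* By (MA4), for each point of A and B there is an isomorphism A -> B fixing s and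
   that point; as it fixes s, it agrees with p. *)
Lemma retraction_fix A B p f : apt A -> apt B -> isom A f -> s A -> s B ->
  weyl_iso A B p -> (exists k, s (f @` cl k) /\ forall x, cl k x -> p (f x) = f x) ->
  forall a, B (f a) -> p (f a) = f a.
Proof.
move=> aA aB iA sA sB piso [k [sk kp]] a Ba.
pose U := fmap f (face a (Fv [set: I]%SET)).
have [k1 [k1a k1B]] := point_containment aA aB iA Ba.
have UB : U B.
  by apply: faceS (face_point_cl k1a) => x kx; apply: k1B; exists x.
have UA : U A by apply: faceS (face_point_cl k1a) => x _; apply: (isom_in x aA iA).
have HU : in_apartment apt isom (MA3_filter g) U.
  exists A, f, (face a (Fv [set: I]%SET)); split => //; left.
  by exists a, (Fv [set: I]%SET); split => //; apply: vface_FvT.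
have [p' [p'iso [k' [sk' Uk' k'p]] _ _]] := sector_iso aA aB iA HU sA sB UA UB.
have fi := isom_inj aA iA.
have p'a : p' (f a) = f a.
  by apply: k'p; move/face_point: Uk'; rewrite /preimage /= => -[x kx /fi <-].
have iB := weyl_iso_isom aB piso iA.
have [h Wh hE] := isom_rel aB iB (weyl_iso_isom aB p'iso iA).
suff hid x : h x = x by rewrite -[RHS]p'a -[p' (f a)]/((p' \o f) a) hE /= hid.
have [f1 [iA1 sE]] := sector_in aA sA.
have [h1 Wh1 f1E] := isom_rel aA iA iA1.
have [u uk] : exists u, forall x, deep S b u x -> cl k (h1 x) /\ cl k' (h1 x).
  have := sectorI sk sk'; rewrite sE => /germ_inftyP [u uk]; exists u => x' /uk [].
  rewrite /preimage /= f1E => -[y ky /fi yE] [y' ky' /fi y'E].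
  by split; [rewrite -yE|rewrite -y'E].
have hh1 y : deep S b u y -> h (h1 y) = h1 y.
  move=> /uk [kx kx']; have := congr1 (fun q => q (h1 y)) hE => /=.
  rewrite k'p // => E; apply: (isom_inj aB iB) => /=.
  by rewrite -E kp.
have [h1' [Wh1' K K']] := affine_weyl_inv Wh1.
have [w [q [Ww Qq wE]]] := affine_weyl_comp Wh Wh1.
have [w1 [q1 [Ww1 Qq1 w1E]]] := Wh1.
have := @affine_eq_deep w w1 q q1 u Ww Ww1 _ (h1' x).
rewrite -[w _ + q]/((fun y => w y + q) (h1' x)) -wE.
rewrite -[w1 _ + q1]/((fun y => w1 y + q1) (h1' x)) -w1E /= K'; apply.
move=> y yu; rewrite -[w _ + q]/((fun y => w y + q) y) -wE.
by rewrite -[w1 _ + q1]/((fun y => w1 y + q1) y) -w1E /= hh1.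
Qed.

Lemma point_sector_apartment x : exists A, [/\ apt A, s A & A x].
Proof.
have [A aA Ax] : (\bigcup_(A in apt) A) x by rewrite (masure_cover MM).
have [f iA] := isom_exists aA; have [a xE] := isom_surj aA iA Ax.
have HU : in_apartment apt isom (MA3_filter g) (fmap f (face a (Fv [set: I]%SET))).
  exists A, f, (face a (Fv [set: I]%SET)); split => //; left.
  by exists a, (Fv [set: I]%SET); split => //; apply: vface_FvT.
have [B [aB sB UB]] := MA3 MM sector_splayed HU.
by exists B; split => //; rewrite xE; apply: (face_point UB).
Qed.

Section Group.
Variables (G : groupType) (act : G -> M -> M).
Hypothesis GG : strongly_transitive g apt isom act.

Lemma sector_group_iso A B U f : apt A -> apt B -> isom A f ->
  in_apartment apt isom (MA3_filter g) U -> s A -> s B -> U A -> U B ->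
  exists p a, [/\ weyl_iso A B p, forall x, A x -> act a x = p x &
    exists k, [/\ s (f @` cl k), U (f @` cl k) & forall x, cl k x -> p (f x) = f x]].
Proof.
move=> aA aB iA HU sA sB UA UB.
have [p [piso pk D pfix]] := sector_iso aA aB iA HU sA sB UA UB.
by have [a aE] := act_MA4 GG D piso pfix; exists p, a; split.
Qed.

Lemma sector_group_image A B : apt A -> apt B -> s A -> s B -> exists a, act a @` A = B.
Proof.
move=> aA aB sA sB; have [f iA] := isom_exists aA.
have [p [a [piso aE _]]] := sector_group_iso aA aB iA sector_solid sA sB sA sB.
exists a; rewrite -(isom_range aB (weyl_iso_isom aB piso iA)).
apply/seteqP; split => [_ [x Ax <-]|_ [x _ <-]].
  by have [y yE] := isom_surj aA iA Ax; exists y => //=; rewrite aE // yE.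
by exists (f x); [apply: (isom_in x aA iA)|rewrite aE //; apply: (isom_in x aA iA)].
Qed.

End Group.
End SectorGerm.
End Masure.

(** * Finite Weyl groups *)

Section Automorphisms.
Variables (R : realType) (I : finType) (n : nat) (S : rootDatum I n).
Local Notation AA := 'rV[R]_n.
Local Notation al i := (@form R n (sroot S i)).
Local Notation alv i := (@vec R n (scoroot S i)).
Local Notation W := (@weyl R I n S).
Local Notation Wa := (@affine_weyl R I n S).

Lemma root_coroot_linear a av : root_coroot S a av ->
  [/\ forall u v : AA, a (u + v) = a u + a v, forall c v, a (c *: v) = c * a v & a av = 2].
Proof.
move=> [w [i [Ww aw ->]]]; have [w' [Ww' K K']] := weyl_inv Ww.
have aE v : a v = al i (w' v) by rewrite -aw /= K'.
split=> [u v|c v|]; rewrite !aE; first by rewrite (weylD _ _ Ww') formD.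
  by rewrite (weylZ _ _ Ww') formZ.
by rewrite K form_alv.
Qed.

(** The wall of al_i \o w through 0 is sent to the hyperplane al_i = al_i(t), which must be a wall
    of some root [be] with the same coroot alpha_i^vee. Then t - c alpha_i^vee, with c = al_i(t)/2,
    is killed by al_i and hence by [be]; both roots take the value 2 at the coroot, so al_i(t) =
    be(t) is an integer. *)
Lemma vw_aut_integral h : vw_aut S h ->
  exists w t, [/\ W w, h = (fun x => w x + t) & forall i, exists c : int, al i t = c%:~R].
Proof.
move=> [[w [t [Ww hE]]] [l [t' [hl _ H]]]]; exists w, t; split => // i.
have lw x : l x = w x.
  have tt : t' = t.
    have : l (0 : AA) + t' = w (0 : AA) + t by rewrite -[LHS]/((fun x => l x + t') 0) -hl hE.
    by rewrite (weyl0 Ww) (raddf0 l) !add0r.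
  by have := congr1 (fun f => f x) hE; rewrite hl /= tt => /addIr.
have [w' [Ww' K K']] := weyl_inv Ww.
have : wall_coroots S (h @` wall (al i \o w) 0, l (w' (alv i))).
  rewrite -H; exists (wall (al i \o w) 0, w' (alv i)) => //.
  exists (al i \o w), (w' (alv i)), 0; split => //; exists w', i; split => //.
  by apply/funext => x /=; rewrite K'.
move=> [be [bv [k [rb [wE lE]]]]].
have [beD beZ be2] := root_coroot_linear rb.
have wallE : h @` wall (al i \o w) 0 = fun x => al i x = al i t.
  apply/seteqP; split => [_ [y + <-]|y /= yt]; rewrite ?/wall /= ?mulr0z ?addr0 hE.
    by move=> y0; rewrite formD y0 add0r.
  exists (w' (y - t)); last by rewrite K' subrK.
  by rewrite /wall /= addr0 K' formB yt subrr.
have in_wall x : al i x = al i t <-> be x + k%:~R = 0.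
  by have := congr1 (fun f => f x) wE; rewrite wallE /wall /= => ->.
have bt : be t + k%:~R = 0 by apply/in_wall.
have aE : alv i = bv by rewrite -lE lw K'.
exists (- k); rewrite intrN; pose c := al i t / 2.
have : al i (t - c *: alv i + c *: alv i) = al i t by rewrite subrK.
have d0 : be (t - c *: alv i) = 0.
  have e1 : al i (t - c *: alv i) = 0.
    by rewrite formB formZ form_alv /c divfK ?subrr.
  have : be (t + (t - c *: alv i)) + k%:~R = 0.
    by apply/in_wall; rewrite formD e1 addr0.
  by rewrite beD; lra.
have : be t = c * 2.
  by rewrite -[t in LHS](subrK (c *: alv i)) beD d0 add0r beZ aE be2.
rewrite /c divfK // => E _; lra.
Qed.

Lemma wall_coroots_affine_weyl w q p : W w -> coroot_lattice S q ->
  wall_coroots S p -> wall_coroots S ((fun x => w x + q) @` p.1, w p.2) :> Prop.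
Proof.
move=> Ww Qq [a [av [k [ra ->]]]] /=; have [aD aZ _] := root_coroot_linear ra.
have [w' [Ww' K K']] := weyl_inv Ww.
have [c cE] : exists c : int, a (w' q) = c%:~R.
  case: ra => w1 [i [Ww1 aw _]]; have [w1' [Ww1' K1 K1']] := weyl_inv Ww1.
  have -> : a (w' q) = al i (w1' (w' q)) by rewrite -aw /= K1'.
  by apply: (@coroot_lattice_form _ _ _ S); do 2!apply: weyl_coroot_lattice => //.
exists (a \o w'), (w av), (k - c); split.
  case: ra => w1 [i [Ww1 aw ->]]; exists (w \o w1), i; split => //; first exact: weyl_comp.
  by rewrite -aw; apply/funext => x /=; rewrite K.
congr (_, _); apply/seteqP; split => [_ [x ax <-]|x] /=; rewrite /wall /= intrD intrN.
  by rewrite (weylD _ _ Ww') K aD cE; move: ax; rewrite /wall /=; lra.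
move=> H; exists (w' (x - q)); last by rewrite K' subrK.
have <- : a (w' x) + (k%:~R - c%:~R) = a (w' (x - q)) + k%:~R; last exact: H.
have := aD (w' (x - q)) (w' q); rewrite -(weylD _ _ Ww') subrK cE; lra.
Qed.

Lemma affine_weyl_aut h : Wa h -> vw_aut S h.
Proof.
move=> Wh; have [h' [Wh' K K']] := affine_weyl_inv Wh.
have [w [q [Ww Qq hE]]] := Wh.
split; first by exists w, q.
have wl : linear w by move=> c u v; rewrite (weylD _ _ Ww) (weylZ _ _ Ww).
pose l : {linear AA -> AA} := HB.pack w (GRing.isLinear.Build R AA AA *:%R w wl).
exists l, q; split => //; first by exists h'.
apply/seteqP; split => [_ [p wp <-]|p wp].
  by rewrite hE; apply: wall_coroots_affine_weyl.
have [w' [Ww' K1 K1']] := weyl_inv Ww.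
have h'E : h' = fun x => w' x + - w' q.
  apply/funext => x; rewrite -[x in RHS]K' hE (weylD _ _ Ww') K1 addrK //.
exists (h' @` p.1, w' p.2).
  rewrite h'E; apply: wall_coroots_affine_weyl => //.
  exact/coroot_latticeN/weyl_coroot_lattice.
case: p {wp} => P v /=; congr (_, _); last exact: K1'.
apply/seteqP; split => [_ [_ [x Px <-] <-]|x Px]; first by rewrite K'.
by exists (h' x); [exists x|rewrite K'].
Qed.

Lemma weyl_translations_aut h : vw_aut S h -> exists w t, W w /\ h = (fun x => w x + t).
Proof. by case. Qed.

End Automorphisms.

(** * Vertices in an apartment, and the distance *)

Section Orbit.
Variables (R : realType) (I : finType) (n : nat) (S : rootDatum I n).
Variables (L : lmodType R[i]) (g : kacMoodyAlgebra S L).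
Variables (M : Type) (apt : set (set M)) (isom : set M -> set ('rV[R]_n -> M)).
Hypothesis MM : masure g apt isom.
Variables (G : groupType) (act : G -> M -> M).
Hypothesis GG : strongly_transitive g apt isom act.
Variables (A0 : set M) (iota : 'rV[R]_n -> M).
Hypotheses (aA0 : apt A0) (iA0 : isom A0 iota).
Hypothesis G_stab : stabilizer_induces_weyl_Y S act A0 iota.
Local Notation AA := 'rV[R]_n.
Local Notation al i := (@form R n (sroot S i)).
Local Notation W := (@weyl R I n S).
Local Notation orb := (orbit_of act (iota 0)).

Lemma orbit_act a x : orb x -> orb (act a x).
Proof. by move=> [c _ <-]; exists (a * c)%g => //; rewrite (act_mul GG). Qed.

Lemma orbit_act_inv a x : orb (act a x) -> orb x.
Proof.
by move/(orbit_act a^-1%g); rewrite -(act_mul GG) mulVg (act_one GG).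
Qed.

(** If c sends the origin to iota v, (MA2) at this point gives some d taking c A0 back to A0 and
    fixing it. Then d c stabilizes A0 and sends the origin to iota v, and the stabilizer induces
    translations by Y only, up to W. *)
Lemma orbit_lattice v : orb (iota v) -> exists y, v = vec R y.
Proof.
move=> [c _ cE]; set A := act c @` A0.
have aA : apt A by apply: (act_apt GG).
have [f iA] := isom_exists MM aA.
have Av : A (iota v) by exists (iota 0) => //; apply: (isom_in MM _ aA0 iA0).
have [a va] := isom_surj MM aA iA Av.
have D : MA2_data g apt isom A A0 f (fmap f (globally [set a])).
  split => //; first by exists (globally [set a]); split => //; constructor 1; exists a.
  by move=> _ ->; rewrite /= -va; apply: (isom_in MM _ aA0 iA0).
have [_ [p [piso pfix]]] := MA2 MM D.
have [d dE] := act_MA2 GG D piso pfix.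
have [k [Uk kp]] := fixes_encl aA iA pfix.
have pa : p (f a) = f a.
  by apply: kp; have [y ky /(isom_inj MM aA iA) <-] := Uk a erefl.
have dcA : act (d * c)%g @` A0 = A0.
  rewrite -[RHS](isom_range MM aA0 (weyl_iso_isom MM aA0 piso iA)).
  apply/seteqP; split => [_ [x Ax <-]|_ [x _ <-]].
    have [y yE] := isom_surj MM aA iA (ex_intro2 _ _ x Ax erefl : A (act c x)).
    by exists y => //=; rewrite (act_mul GG) dE; [rewrite yE|exists x].
  have [y Ay yE] : A (f x) by apply: (isom_in MM x aA iA).
  exists y => //; rewrite (act_mul GG) yE dE //.
  exact: (isom_in MM x aA iA).
have dciso : vw_iso S isom A0 A0 (act (d * c)%g) by rewrite -{2}dcA; apply: (act_iso GG).
have [h _ hE] := dciso iota iota iA0 iA0.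
have : weyl_Y S h by rewrite -G_stab; exists (d * c)%g.
move=> [w [y [Ww hE']]]; exists y.
apply: (isom_inj MM aA0 iA0); rewrite va -pa -dE -?va // -cE -(act_mul GG).
by rewrite -[act _ _]/((act (d * c)%g \o iota) 0) hE /= hE' (weyl0 Ww) add0r.
Qed.

Lemma germ_infty_sector b A f : apt A -> isom A f ->
  sector_germ S apt isom b (fmap f (germ_infty S b)).
Proof.
move=> aA iA; exists A, f, (germ_infty S b); split => //.
exists 0, [set sgnR R b *: v | v in @Cvf R I n S]; split => //.
by exists idfun; split => //; apply: weyl_id.
Qed.

(** Some apartment contains a sector-germ of A0 and one of A; two apartments sharing a sector-germ
    are conjugate by (MA4). *)
Lemma apartment_transitive A : apt A -> exists a, act a @` A0 = A.
Proof.
move=> aA; have [f iA] := isom_exists MM aA.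
have s0 := germ_infty_sector false aA0 iA0; have s1 := germ_infty_sector false aA iA.
have [B [aB B0 B1]] := MA3 MM (sector_splayed MM s0) (sector_solid MM s1).
have in0 A' f' : apt A' -> isom A' f' -> fmap f' (germ_infty S false) A'.
  by move=> aA' iA'; apply/germ_inftyP; exists 0 => x _; apply: (isom_in MM x aA' iA').
have [c cE] := sector_group_image MM s0 GG aA0 aB (in0 _ _ aA0 iA0) B0.
have [d dE] := sector_group_image MM s1 GG aB aA B1 (in0 _ _ aA iA).
exists (d * c)%g; rewrite -dE -cE.
apply/seteqP; split => [_ [x Ax <-]|_ [_ [x Ax <-] <-]].
  by exists (act c x); [exists x|rewrite (act_mul GG)].
by exists x => //; rewrite (act_mul GG).
Qed.

(** Elements of G act by vectorially Weyl isomorphisms only, so in the coordinates [f] the vertices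
    lie in a translate of Y, not necessarily in Y. The offset is integral on the simple roots, which
    suffices for roots to be integral at vertices. *)
Lemma apartment_vertices A f : apt A -> isom A f -> exists t,
  [/\ forall i, exists c : int, al i t = c%:~R, orb (f t)
    & forall a, orb (f a) -> exists y, a = vec R y + t].
Proof.
move=> aA iA; have [c cE] := apartment_transitive aA.
have ciso : vw_iso S isom A0 A (act c) by rewrite -cE; apply: (act_iso GG).
have [h /vw_aut_integral [w [t [Ww hE ti]]] fE] := ciso iota f iA0 iA.
exists t; split => // [|a oa].
  have <- : act c (iota 0) = f t.
    by rewrite -[LHS]/((act c \o iota) 0) fE /= hE (weyl0 Ww) add0r.
  by exists c.
have [w' [Ww' K K']] := weyl_inv Ww.
have fa : act c (iota (w' (a - t))) = f a.
  by rewrite -[LHS]/((act c \o iota) _) fE /= hE K' subrK.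
have [y yE] : exists y, w' (a - t) = vec R y.
  by apply/orbit_lattice/(orbit_act_inv (a := c)); rewrite fa.
have [y' y'E] := weyl_lattice y Ww; exists y'.
by rewrite -y'E -yE K' subrK.
Qed.

Lemma isom_model_iso A f : apt A -> isom A f -> model_iso S isom A f.
Proof.
move=> aA iA f' iA'; have [h Wh ->] := isom_rel MM aA iA' iA.
by exists h => //; apply: affine_weyl_aut.
Qed.

Section SectorDistance.
Variables (N : AA -> R) (b : bool) (s : set_system M).
Hypothesis NN : is_norm N.
Hypothesis ss : sector_germ S apt isom b s.

(** The infimum of an empty set is a default value; nonemptiness lets [dtheta_lt] extract an actual
    pair. *)
Lemma sector_U_nonempty x y : sector_U S apt isom b s x y !=set0.
Proof.
have [A [aA sA Ax]] := point_sector_apartment MM ss x.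
have [B [aB sB By]] := point_sector_apartment MM ss y.
have [f [iA sE]] := sector_in MM ss aA sA.
have [p [piso [k [sk _ kp]] _ _]] := sector_iso MM ss aA aB iA (sector_solid MM ss) sA sB sA sB.
have iB := weyl_iso_isom MM aB piso iA.
have [a1 xE] := isom_surj MM aA iA Ax; have [a2 yE] := isom_surj MM aB iB By.
have gk : germ_infty S b (chull g k (fun=> None)).
  by move: sk; rewrite sE /fmap /= preimage_image_inj //; apply: (isom_inj MM aA iA).
have sE2 : fmap (p \o f) (germ_infty S b) = s.
  rewrite sE; apply/esym/(fmap_eq_on _ _ gk) => [X Y|X Y|z kz] /=.
  - exact: germ_inftyI.
  - exact: germ_inftyS.
  - by rewrite kp.
have /germ_inftyP [u uk] := gk.
have [q [_ Hq]] := exists_deep S b [:: a1; a2; u].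
have Cq a : a \in [:: a1; a2; u] -> closure (Cvf S) (sgnR R b *: (q - a)).
  by move=> /Hq H; apply: subset_closure => i; apply: H.
exists (sgnR R b *: (q - a1), sgnR R b *: (q - a2)); split => /=.
- by apply: Cq; rewrite mem_head.
- by apply: Cq; rewrite !inE eqxx orbT.
- exists (f q); split.
    exists A, f, a1; split; first by split => //; apply: isom_model_iso.
    by split => //; rewrite sgnRK addrC subrK.
  exists B, (p \o f), a2; split; first by split => //; apply: isom_model_iso.
  split => //; rewrite sgnRK addrC subrK /= kp //.
  by apply/uk/Hq; rewrite !inE eqxx !orbT.
Qed.

Lemma dtheta_lt x y e : dtheta S apt isom N b s x y < e ->
  exists2 p, sector_U S apt isom b s x y p & N p.1 + N p.2 < e.
Proof.
move=> H; apply: contrapT => Hn; move: H; apply/negP; rewrite -leNgt.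
have [p Up] := sector_U_nonempty x y.
apply: lb_le_inf; first by exists (N p.1 + N p.2), p.
move=> _ [q Uq <-]; rewrite leNgt; apply/negP => qe; apply: Hn; by exists q.
Qed.

Lemma dtheta_le x y p : sector_U S apt isom b s x y p ->
  dtheta S apt isom N b s x y <= N p.1 + N p.2.
Proof.
move=> Up; apply: ge_inf; last by exists p.
by exists 0 => _ [q _ <-]; rewrite addr_ge0 // is_norm_ge0.
Qed.

Lemma finite_Delta_lip : finite_set (@weyl R I n S) ->
  exists2 C, 0 < C & forall a v, Delta g a -> `|a v| <= C * `|v|.
Proof.
move=> Wfin; have /finite_seqP [r rE] := Delta_finite g Wfin.
suff [C C0 HC] : exists2 C, 0 < C & forall a v, a \in r -> Delta g a -> `|a v| <= C * `|v|.
  by exists C => // a v Da; apply: HC => //; have : [set` r] a by rewrite -rE.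
elim: r {rE} => [|a r [C C0 IH]]; first by exists 1.
have [[b' rb aE]|Da] := pselect (Delta g a); last first.
  exists C => // a' v; rewrite in_cons => /predU1P[-> /Da //|]; exact: IH.
have [D D0 HD] := form_lip R b'.
exists (C + D); first by rewrite addr_gt0.
move=> a' v; rewrite in_cons mulrDl => /predU1P[-> _|ar Da'].
  by rewrite -aE; apply: (le_trans (HD v)); rewrite lerDr mulr_ge0 // ltW.
by apply: (le_trans (IH _ v ar Da')); rewrite lerDl mulr_ge0 // ltW.
Qed.

Lemma finite_weyl_lip : finite_set (@weyl R I n S) ->
  exists2 C, 0 < C & forall w v, W w -> `|w v| <= C * `|v|.
Proof.
move=> /finite_seqP [r rE].
suff [C C0 HC] : exists2 C, 0 < C & forall w v, w \in r -> W w -> `|w v| <= C * `|v|.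
  by exists C => // w v Ww; apply: HC => //; have : [set` r] w by rewrite -rE.
elim: r {rE} => [|w r [C C0 IH]]; first by exists 1.
have [Ww|Ww] := pselect (W w); last first.
  exists C => // w' v; rewrite in_cons => /predU1P[-> /Ww //|]; exact: IH.
have [D D0 HD] := weyl_lip Ww.
exists (C + D); first by rewrite addr_gt0.
move=> w' v; rewrite in_cons mulrDl => /predU1P[-> _|ar Ww'].
  by apply: (le_trans (HD v)); rewrite lerDr mulr_ge0 // ltW.
by apply: (le_trans (IH _ v ar Ww')); rewrite lerDl mulr_ge0 // ltW.
Qed.

Lemma Delta_integral a v : Delta g a -> (forall i, exists c : int, al i v = c%:~R) ->
  exists c : int, a v = c%:~R.
Proof.
move=> Da vi; have [d dE] := choice vi.
have qE m : qf S m v = (\sum_i (m i)%:Z * d i)%:~R.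
  by rewrite rmorph_sum; apply: eq_bigr => i _; rewrite dE rmorphM.
have [m [[->|->] _]] := Delta_sign Da; first by eexists; apply: qE.
by exists (- \sum_i (m i)%:Z * d i); rewrite intrN -qE.
Qed.

Lemma finite_weyl_discrete : finite_set (@weyl R I n S) ->
  discrete_for (dtheta S apt isom N b s) orb.
Proof.
move=> Wfin x ox.
have [c c0 Hc] := is_norm_ge NN.
have [C1 C10 HC1] := finite_Delta_lip Wfin.
have [C2 C20 HC2] := finite_weyl_lip Wfin.
(* Chosen so that C2 eta < 1, which makes the final vector of Y zero, and C1 C2 eta < 1, which makes
   every root vary by less than 1 between x and z. *)
pose eta := (1 + C2 + C1 * C2)^-1.
have eta0 : 0 < eta by rewrite invr_gt0 !addr_gt0 // mulr_gt0.
exists (c * eta); first by rewrite mulr_gt0.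
move=> y oy /dtheta_lt [[u u'] [/= _ _ [z [zx zy]]] uu'].
case: zx => A [psi [a [[aA sA psiA] [_ xE zE]]]].
case: zy => B [psi' [a' [[aB sB psiB] [_ yE zE']]]].
have small : `|u| + `|u'| < eta.
  rewrite -(ltr_pM2l c0) mulrDr; apply: le_lt_trans uu'.
  by apply: lerD.
have C2eta : C2 * eta < 1.
  by rewrite ltr_pdivrMr ?mul1r ?addr_gt0 // ?mulr_gt0 //; have := mulr_gt0 C10 C20; lra.
have C12eta : C1 * (C2 * eta) < 1.
  rewrite mulrA ltr_pdivrMr ?mul1r ?addr_gt0 // ?mulr_gt0 //; lra.
have eu : `|u| < eta by have := normr_ge0 u'; lra.
have [f iA] := isom_exists MM aA.
have [h /weyl_translations_aut [w [t [Ww hE]]] psiE] := psiA f iA.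
set q := h (a + sgnR R b *: u).
have zq : z = f q by rewrite zE psiE.
have xf : x = f (h a) by rewrite xE psiE.
have qa : q - h a = w (sgnR R b *: u).
  by rewrite /q hE (weylD _ _ Ww) opprD addrACA subrr addr0 addrAC subrr add0r.
have [f' iB] := isom_exists MM aB.
have Bz : B z.
  by rewrite zE'; have [h' _ ->] := psiB f' iB; apply: (isom_in MM _ aB iB).
rewrite zq in Bz.
have [k1 [k1q k1B]] := point_containment MM aA aB iA Bz.
pose U := fmap f (face g q (Fv S [set: I]%SET)).
have UB : U B by apply: faceS (face_point_cl k1q) => r kr; apply: k1B; exists r.
have UA : U A by apply: faceS (face_point_cl k1q) => r _; apply: (isom_in MM r aA iA).
have HU : in_apartment apt isom (MA3_filter g) U.
  exists A, f, (face g q (Fv S [set: I]%SET)); split => //; left.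
  by exists q, (Fv S [set: I]%SET); split => //; apply: vface_FvT.
have [p [gam [piso gamE [k [_ Uk kp]]]]] := sector_group_iso MM ss GG aA aB iA HU sA sB UA UB.
have kq : chull g k (fun=> None) q.
  by move/face_point: Uk; rewrite /preimage /= => -[r kr /(isom_inj MM aA iA) <-].
have [t0 [t0i _ orbE]] := apartment_vertices aA iA.
have [y1 ha] : exists y1, h a = vec R y1 + t0 by apply: orbE; rewrite -xf.
have wu_small : C1 * `|w (sgnR R b *: u)| < 1.
  apply: le_lt_trans C12eta; rewrite ler_pM2l //.
  apply: (le_trans (HC2 w _ Ww)); rewrite normr_sgnR ler_pM2l //; exact: ltW.
(* An integer greater than -1 is nonnegative: this rounding carries each constraint from z to the
   vertex x. *)
have ka : chull g k (fun=> None) (h a).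
  move=> d Dd; split => //; have [+ _] := kq d Dd.
  case: (k d) => [m|] //=.
  have [e eE] : exists e : int, d (h a) = e%:~R.
    apply: (Delta_integral Dd) => i; have [e eE] := t0i i.
    exists (pairing (sroot S i) y1 + e).
    by rewrite ha formD eE intrD /form /vec pairing_intr.
  have -> : d q = d (h a) + d (w (sgnR R b *: u)) by rewrite -(DeltaD _ _ Dd) -qa addrC subrK.
  have := le_lt_trans (HC1 d _ Dd) wu_small.
  rewrite ltr_norml eE -intrD => /andP[_ d1] h0.
  rewrite ler0z; have : -1 < (e + m)%:~R :> R by rewrite intrD in h0 *; lra.
  have -> : (-1 : R) = (-1 : int)%:~R by rewrite intrN.
  rewrite ltr_int; clear; move: e m => e m; lia.
have px : p x = x by rewrite xf kp.
have iB' := weyl_iso_isom MM aB piso iA.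
have [h' /weyl_translations_aut [w' [t' [Ww' hE']]] psiE'] := psiB _ iB'.
have yf : y = p (f (h' a')) by rewrite yE psiE'.
have qh' : q = h' (a' + sgnR R b *: u').
  apply: (isom_inj MM aB iB'); rewrite /= kp // -zq zE' psiE' //.
(* As p is induced by [gam], the preimage of y in A is a vertex too, in the same translate of Y as
   x. *)
have [y2 ha'] : exists y2, h' a' = vec R y2 + t0.
  apply: orbE; apply: (orbit_act_inv (a := gam)).
  by rewrite gamE; [rewrite -yf|apply: (isom_in MM _ aA iA)].
have qa' : q - h' a' = w' (sgnR R b *: u').
  by rewrite qh' hE' (weylD _ _ Ww') opprD addrACA subrr addr0 addrAC subrr add0r.
have y12 : vec R (y1 - y2) = w' (sgnR R b *: u') - w (sgnR R b *: u).
  rewrite -qa -qa' opprB [RHS]addrC addrA subrK ha ha' opprD addrACA subrr addr0.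
  by apply/rowP => j; rewrite !mxE intrB.
have : y1 - y2 = 0.
  apply: (@lattice_small R); rewrite y12; apply: le_lt_trans C2eta.
  apply: (le_trans (ler_normB _ _)).
  apply: le_trans (lerD (HC2 _ _ Ww') (HC2 _ _ Ww)) _.
  by rewrite !normr_sgnR -mulrDr ler_pM2l // addrC ltW.
move/eqP; rewrite subr_eq0 => /eqP y1y2.
by rewrite yf ha' -y1y2 -ha -xf.
Qed.


Lemma form_FvT a v : Delta g a -> closure (Fv S [set: I]%SET) v -> a v = 0.
Proof.
move=> Da /closure_rowP H; apply/eqP; apply: contraT => a0.
have [d d0 Hd] := Delta_small Da (e := `|a v|) ltac:(by rewrite normr_gt0).
have [u Fu ud] := H d d0.
have E : a (v + u) = 0.
  have [m [[->|->] _]] := Delta_sign Da; rewrite /= /qf big1 ?oppr0 // => i _;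
  by have := Fu i; rewrite finset.inE => ->; rewrite mulr0.
have := Hd u ud; move: E; rewrite (DeltaD _ _ Da) => /eqP; rewrite addr_eq0 => /eqP ->.
by rewrite normrN ltxx.
Qed.

Lemma cl_FvT k x v : chull g k (fun=> None) x -> closure (Fv S [set: I]%SET) v ->
  chull g k (fun=> None) (x + v).
Proof.
move=> kx Fv_v a Da; split => //; have [+ _] := kx a Da.
by case: (k a) => [z|] //=; rewrite (DeltaD _ _ Da) (form_FvT Da Fv_v) addr0.
Qed.

Lemma closure_FvT0 : closure (Fv S [set: I]%SET) (0 : AA).
Proof. by apply: subset_closure; apply: FvT0. Qed.

(* The direction of Fv setT being killed by all roots, r(F, Fv setT) = cl(F). *)
Lemma chimney_germ_FvT x V Z :
  chimney_germ g (face g x V) (Fv S [set: I]%SET) Z <-> enclosure g (face g x V) Z.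
Proof.
split.
  move=> [u clu /enclosureP [k [[E FE EV] kZ]]]; apply/enclosureP; exists k; split => //.
  apply: faceS FE => y Ey; have clNu : closure (Fv S [set: I]%SET) (- u).
    apply: subset_closure => i; rewrite finset.inE formN.
    by rewrite (form_FvT (Delta_al g i) clu) oppr0.
  rewrite -[y](addKr u) addrC; apply: cl_FvT => //.
  by apply: EV; exists (u + y) => //; exists 0; [apply: FvT0|rewrite addr0].
move=> /enclosureP [k [Fk kZ]]; exists 0; first exact: closure_FvT0.
apply/enclosureP; exists k; split => //; exists (chull g k (fun=> None)).
  by rewrite /fmap /=; apply: faceS Fk => y; rewrite /preimage /= add0r.
by move=> _ [y ky [v Fv_v <-]]; apply: cl_FvT => //; apply: subset_closure.
Qed.

Lemma finite_weyl_tits : finite_set (@weyl R I n S) -> tits S = setT :> set AA.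
Proof.
move=> Wfin; apply/seteqP; split => // v _.
have [w Ww wv] := weyl_dominant v Wfin.
have [w' [Ww' K K']] := weyl_inv Ww.
exists w' => //; exists (w v) => //; apply/closure_rowP => e e0.
have [rho rhoE] := exists_rho S (fun=> 1 : R).
have [t t0 Ht] := exists_scale rho e0; exists (t *: rho); last by rewrite Ht // lexx ltW.
by move=> i; rewrite formD formZ rhoE mulr1 ltr_wpDl.
Qed.

(** The Tits cone is the whole space, so the minimal vectorial face, which contains 0, is spherical
    and any face F spans with it a splayed chimney, whose germ is cl(F). Thus (MA3) and (MA4) apply
    to two arbitrary faces. *)
Lemma finite_weyl_building : finite_set (@weyl R I n S) -> is_building g apt isom.
Proof.
move=> Wfin.
have chim A f x V : apt A -> isom A f -> vface S V ->
    in_apartment apt isom (is_splayed_chimney_germ g)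
      (fmap f (chimney_germ g (face g x V) (Fv S [set: I]%SET))).
  move=> aA iA VV; exists A, f, (chimney_germ g (face g x V) (Fv S [set: I]%SET)).
  split => //; exists (face g x V), (Fv S [set: I]%SET); split => //.
  - by exists x, V.
  - exact: vface_FvT.
  - exists 0; split; first exact: FvT0.
    left; rewrite finite_weyl_tits // interiorT //.
have down (f : AA -> M) x V Z : fmap f (chimney_germ g (face g x V) (Fv S [set: I]%SET)) Z ->
    fmap f (face g x V) Z.
  rewrite /fmap /= => /chimney_germ_FvT /enclosureP [k [Fk kZ]].
  exact: faceS Fk.
split => //; first exact: (MA1 MM).
- move=> U U' [A [f [F [aA iA [x [V [VV ->]]] ->]]]] HU'.
  have HU'3 : in_apartment apt isom (MA3_filter g) U'.
    by case: HU' => A' [f' [F' [? ? ? ->]]]; exists A', f', F'; split => //; left.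
  have [B [aB UB U'B]] := MA3 MM (chim A f x V aA iA VV) HU'3.
  by exists B; split => //; apply: down.
- move=> A A' U U' aA aA' [B [f [F [aB iB [x [V [VV ->]]] ->]]]] HU' UA U'A UA' U'A'.
  have HU'3 : in_apartment apt isom (MA3_filter g) U'.
    by case: HU' => C [f' [F' [? ? ? ->]]]; exists C, f', F'; split => //; left.
  set U1 := fmap f (chimney_germ g (face g x V) (Fv S [set: I]%SET)).
  (* The axiom speaks of cl(F), the goal of F: an apartment containing a face contains its
     enclosure. *)
  have up C : apt C -> fmap f (face g x V) C -> U1 C.
    move=> aC UC; have [[k Fk kC] _] := face_containment MM aB aC iB VV UC.
    apply/chimney_germ_FvT/enclosureP; exists k; split => // y ky.
    by apply: kC; exists y.
  have [fA iA] := isom_exists MM aA.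
  have D : MA4_data g apt isom A A' fA U1 U'.
    split => //; first by split => //; apply: chim aB iB VV.
    by split => //; apply: up.
  have [p [piso pfix]] := MA4 MM D.
  have [k [[E1 s1 [E2 U2 E12]] kp]] := fixes_encl aA iA pfix.
  exists p; split => //.
    exists E1; first exact: down.
    move=> y Ey; have : (fA @` chull g k (fun=> None)) y by rewrite -E12; left.
    by move=> [r kr <-]; apply: kp.
  exists E2 => // y Ey; have : (fA @` chull g k (fun=> None)) y by rewrite -E12; right.
  by move=> [r kr <-]; apply: kp.
Qed.

End SectorDistance.
End Orbit.

(** * Infinite Weyl groups *)

Section Panels.
Variables (R : realType) (I : finType) (n : nat) (S : rootDatum I n).
Variables (L : lmodType R[i]) (g : kacMoodyAlgebra S L).
Local Notation al i := (@form R n (sroot S i)).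
Local Notation alv i := (@vec R n (scoroot S i)).
Local Notation Fi i := (@Fv R I n S [set i]%SET).

Lemma vface_Fi i : vface S (Fi i).
Proof.
exists false, idfun, [set i]%SET; split; first exact: weyl_id.
apply/seteqP; split => [v Fv_v|_ [v Fv_v <-]]; last by rewrite /sgnR expr0 scale1r.
by exists v => //; rewrite /sgnR expr0 scale1r.
Qed.

Lemma is_panel_Fi i z (c : int) : al i z = c%:~R -> is_panel g (face g z (Fi i)).
Proof.
move=> zc; split; first by exists z, (Fi i); split => //; apply: vface_Fi.
exists (al i), (- c); split.
  by exists (alv i), idfun, i; split => //; apply: weyl_id.
have Da := Delta_al g i.
split.
- split; first by exists z; rewrite /wall /= zc intrN subrr.
  move=> x y t; rewrite /wall /= intrN => x0 y0; rewrite formD formZ formB.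
  have -> : al i y - al i x = 0 by lra.
  by rewrite mulr0 addr0.
- have h1 : face g z (Fi i) (half (al i) (Some (- c))).
    apply: (face_half Da ltr01) => v /(_ i); rewrite finset.in_set1 eqxx => v0 _.
    by rewrite /half /= formD v0 zc intrN addr0 subrr.
  have h2 : face g z (Fi i) (half (\- al i) (Some c)).
    apply: (face_half (Delta_opp Da) ltr01) => v /(_ i); rewrite finset.in_set1 eqxx => v0 _.
    by rewrite /half /= formD v0 zc addr0 addNr.
  apply: faceS (faceI h1 h2) => y [+ +]; rewrite /half /wall /= intrN; lra.
- move=> E [_ aE] /face_near [e e0 He] y; rewrite /wall /= intrN => yc.
  have [rho [ri rj]] : exists v, al i v = 0 /\ forall j, j != i -> al j v = 1.
    have [v vE] := exists_rho S (fun j => if j == i then 0 else 1 : R).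
    by exists v; split => [|j ji]; rewrite vE ?eqxx // (negPf ji).
  have e20 : 0 < e / 2 by rewrite divr_gt0.
  have [t t0 Ht] := exists_scale rho e20.
  have [d d0 Hd] := al_small S t0.
  have de : 0 < Num.min d (e / 2) by rewrite lt_min d0.
  have [r r0 Hr] := exists_scale (y - z) de.
  have yz : al i (y - z) = 0 by rewrite formB zc; lra.
  have inE c' : 0 < c' <= 1 -> E (z + c' *: (t *: rho + r *: (y - z))) /\ E (z + c' *: (t *: rho)).
    move=> /andP[c0 c1].
    have rn : `|r *: (y - z)| < Num.min d (e / 2) by apply: Hr; rewrite lexx ltW.
    have tn : `|t *: rho| < e / 2 by apply: Ht; rewrite lexx ltW.
    move: rn; rewrite lt_min => /andP[/Hd rd re].
    have cn v : `|v| < e -> `|c' *: v| < e.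
      by move=> ve; rewrite normrZ ger0_norm ?ltW //; apply: le_lt_trans ve; rewrite ler_piMl.
    split; apply: He.
    - apply: FvZ => // j; rewrite finset.in_set1 formD !formZ; case: eqVneq => [->|ji].
        by rewrite ri yz !mulr0 addr0.
      rewrite rj // mulr1; have := rd j; rewrite formZ ltr_norml => /andP[+ _]; lra.
    - by apply: cn; apply: le_lt_trans (ler_normD _ _) _; lra.
    - apply: FvZ => // j; rewrite finset.in_set1 formZ; case: eqVneq => [->|ji].
        by rewrite ri mulr0.
      by rewrite rj // mulr1.
    - by apply: cn; lra.
  have line c' : 0 < c' <= 1 -> E (z + c' *: (t *: rho) + (y - z)).
    move=> c01; have [H1 H2] := inE c' c01; have /andP[c0 _] := c01.
    have := aE _ _ (c' * r)^-1 H2 H1.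
    have -> : z + c' *: (t *: rho + r *: (y - z)) - (z + c' *: (t *: rho)) = (c' * r) *: (y - z).
      by rewrite [c' *: (_ + _)]scalerDr opprD addrACA subrr add0r addrAC subrr add0r scalerA.
    by rewrite (scalerA _ (c' * r)) mulVf ?scale1r // gt_eqF // mulr_gt0.
  (* The point z is not in z + [Fi i], so the value c' = 0 is reached by extrapolating from c' = 1
     through c' = 1/2; it gives y. *)
  have := aE _ _ 2 (line 1 _) (line (2^-1) _).
  rewrite ltr01 lexx => /(_ isT); rewrite invr_gt0 ltr0n invf_le1 // ler1n => /(_ isT).
  by congr E; apply/rowP => j; rewrite !mxE; field.
Qed.

End Panels.

Section Infinite.
Variables (R : realType) (I : finType) (n : nat) (S : rootDatum I n).
Variables (L : lmodType R[i]) (g : kacMoodyAlgebra S L).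
Variables (M : Type) (apt : set (set M)) (isom : set M -> set ('rV[R]_n -> M)).
Hypothesis MM : masure g apt isom.
Hypothesis MT : thick_loc_finite g apt isom.
Variables (G : groupType) (act : G -> M -> M).
Hypothesis GG : strongly_transitive g apt isom act.
Variables (A0 : set M) (iota : 'rV[R]_n -> M).
Hypotheses (aA0 : apt A0) (iA0 : isom A0 iota).
Hypothesis G_stab : stabilizer_induces_weyl_Y S act A0 iota.
Local Notation AA := 'rV[R]_n.
Local Notation al i := (@form R n (sroot S i)).
Local Notation W := (@weyl R I n S).
Local Notation orb := (orbit_of act (iota 0)).
Local Notation face := (face g).
Local Notation cl k := (chull g k (fun=> None)).
Local Notation Fi i := (@Fv R I n S [set i]%SET).
Variables (N : AA -> R) (b : bool) (s : set_system M).
Hypothesis NN : is_norm N.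
Hypothesis ss : sector_germ S apt isom b s.

Lemma deep_ray (u t v : AA) : cone S b v -> exists2 c, 1 <= c & deep S b u (t + c *: v).
Proof.
move=> /coneP Cv.
suff [c c1 Hc] : exists2 c, 1 <= c & forall i, i \in enum I ->
    0 < al i (sgnR R b *: (t + c *: v - u)).
  by exists c => // i; apply: Hc; rewrite mem_enum.
elim: (enum I) => [|i r [c c1 IH]]; first by exists 1.
have vi := Cv i; pose d := al i (sgnR R b *: (t - u)).
exists (c + (1 + `|d|) / al i (sgnR R b *: v)).
  by rewrite (le_trans c1) // lerDl divr_ge0 // ?ltW // addr_gt0.
have pos j : 0 <= al j (sgnR R b *: v) by apply: ltW.
have E j c' : al j (sgnR R b *: (t + c' *: v - u)) =
    al j (sgnR R b *: (t - u)) + c' * al j (sgnR R b *: v).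
  by rewrite -formZ -formD scalerA mulrC -scalerA -scalerDr addrAC.
move=> j; rewrite in_cons => /predU1P[->|jr]; rewrite E mulrDl.
  rewrite divfK ?gt_eqF // -/d; have : 0 <= c * al i (sgnR R b *: v).
    by rewrite mulr_ge0 //; lra.
  have := ler_norm (- d); rewrite normrN; lra.
have := IH j jr; rewrite E.
have : 0 <= (1 + `|d|) / al i (sgnR R b *: v) * al j (sgnR R b *: v).
  by rewrite mulr_ge0 // divr_ge0 // addr_ge0.
lra.
Qed.

Lemma face_finite_and x V (a : I -> AA -> R) (c : I -> int) :
  (forall j, face x V (ohalf (a j) (Some (c j)))) ->
  face x V [set y | forall j, 0 < a j y + (c j)%:~R].
Proof.
move=> H; have : face x V [set y | forall j, j \in enum I -> 0 < a j y + (c j)%:~R].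
  elim: (enum I) => [|i r IH].
    by apply: (faceS (E := chull g (fun=> None) (fun=> None))) => //; apply: (chullP ltr01).
  apply: faceS (faceI (H i) IH) => y [yi yr] j.
  by rewrite in_cons => /predU1P[->|]; [exact: yi|exact: yr].
by apply: faceS => y Hy j; apply: Hy; rewrite mem_enum.
Qed.

(** * A vertex isolated among its images leaves two chambers at a nearby panel *)

Section Branching.
Variables (A : set M) (f : AA -> M) (t : AA) (w : AA -> AA) (i : I) (z : AA) (c : int).
Hypotheses (aA : apt A) (iA : isom A f) (sf : s = fmap f (germ_infty S b)).
Hypothesis ti : forall j, exists c : int, al j t = c%:~R.
Hypothesis Ww : W w.
Hypothesis zc : al i z = c%:~R.
Hypothesis zt : deep S b t (w z).
(** All that discreteness has to provide: an isomorphism fixing s and f (w z) moves the vertex f t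
    by a small distance only, hence not at all. *)
Hypothesis isolated : forall B p a, apt B -> weyl_iso S isom A B p ->
  (forall x, A x -> act a x = p x) -> s B -> B (f (w z)) ->
  (exists k, s (f @` cl k) /\ forall x, cl k x -> p (f x) = f x) -> p (f (w z)) = f (w z) ->
  p (f t) = f t.
Local Notation F0 := (face z (Fi i)).
Local Notation f1 := (f \o w).

(** The sector at t in the direction of s, in the coordinates f \o w that put the panel on a wall of
    the simple root al_i. It is an open neighbourhood of the panel, on which the isomorphisms
    considered turn out to be the identity. *)
Let Om : set AA := [set x | deep S b t (w x)].

(** Since t is integral on the simple roots, [Om] is cut out by finitely many open half-apartments,
    so face filters can be tested against it. *)
Let OmE : exists (a : I -> AA -> R) (d : I -> int), (forall j, Delta g (a j)) /\
  Om = [set y | forall j, 0 < a j y + (d j)%:~R].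
Proof.
have H j : exists a : AA -> R, Delta g a /\ forall y, al j (sgnR R b *: w y) = a y.
  have [w' [Ww' K K']] := weyl_inv Ww.
  have [a Da aE] := Delta_twist b (Delta_al g j) Ww'.
  have D2 : Delta g (a \o w \o w).
    by apply: Delta_weyl => //; apply: Delta_weyl.
  by exists (a \o w \o w); split => // y /=; rewrite -aE K.
have [a aP] := choice H; have [d dE] := choice ti.
exists a, (fun j => - (if b then - d j else d j)); split=> [j|]; first by case: (aP j).
suff E j y : al j (sgnR R b *: (w y - t)) = a j y + (- (if b then - d j else d j))%:~R.
  by apply/seteqP; split => y Hy j; have := Hy j; rewrite -?E // E.
rewrite scalerBr formB (proj2 (aP j)) intrN; congr (_ - _).
by rewrite formZ dE /sgnR; case: b; rewrite ?expr0 ?expr1 ?mul1r // mulN1r intrN.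
Qed.

Let F0_Om : F0 Om.
Proof.
have [a [d [Da E]]] := OmE; rewrite E; apply: face_finite_and => j.
have zj : 0 < a j z + (d j)%:~R.
  by have : Om z by []; rewrite E => /(_ j).
have [e e0 He] := Delta_small (Da j) zj.
apply: (face_ohalf (Da j) e0) => v _ /He; rewrite /ohalf /= (DeltaD _ _ (Da j)).
by rewrite ltr_norml => /andP[]; lra.
Qed.

(** Take B containing s and the chamber, and p : A -> B fixing s. It fixes f t by isolation, then
    the sector f(t + ...) by (MAO). The chamber, seen in B through p \o f1, lies in [Om], so f1
    gives the same filter. *)
Lemma chamber_in_apartment Ch : chambers_around g apt isom (fmap f1 F0) Ch ->
  exists F, [/\ is_chamber g F, forall Z, fclosure F Z -> F0 Z & Ch = fmap f1 F].
Proof.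
move=> [A'' [f'' [F'' [aA'' iA'' [[x [V [VV FE]]] supp] -> around]]]].
have FFc : is_chamber g F'' by split => //; exists x, V.
rewrite FE in around *.
have HCh : in_apartment apt isom (MA3_filter g) (fmap f'' (face x V)).
  by exists A'', f'', (face x V); split => //; left; exists x, V.
have [B [aB sB ChB]] := MA3 MM (sector_splayed MM ss) HCh.
have [[k1 Fk1 k1B] [p2 p2iso [k2 Fk2 p2f]]] := face_containment MM aA'' aB iA'' VV ChB.
have UB : fmap f1 F0 B.
  apply: around; exists (cl k1) => //.
  rewrite -(closure_id _).1; last exact: chull_closed.
  by move=> y ky; apply: k1B; exists y.
have iA1 : isom A f1 by apply: (isom_comp MM aA iA); apply: affine_weyl_lin.
have [[k3 Fk3 k3B] _] := face_containment MM aA aB iA1 (vface_Fi R S i) UB.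
have Bz : B (f (w z)).
  apply: k3B; exists z => //= a Da; split => //; case E : (k3 a) => [q|] //=.
  by apply: (face_closure_chull (vface_Fi R S i) Fk3 Da); left.
have sA : s A by rewrite sf; apply/germ_inftyP; exists 0 => y _; apply: (isom_in MM y aA iA).
have [p [a [piso aE [k4 [sk4 _ pf]]]]] :=
  sector_group_iso MM ss GG aA aB iA (sector_solid MM ss) sA sB sA sB.
have fixAB : forall a, B (f a) -> p (f a) = f a.
  by apply: (retraction_fix MM ss aA aB iA sA sB piso); exists k4.
have pt : p (f t) = f t.
  by apply: (isolated aB piso aE sB Bz); [exists k4|apply: fixAB].
have iB := weyl_iso_isom MM aB piso iA.
have fi := isom_inj MM aA iA.
have [u uk] : exists u, deep S b u `<=` cl k4.
  by apply/germ_inftyP; move: sk4; rewrite sf /fmap /= preimage_image_inj.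
(* The ray from t through y ends up deep in s, where p is the identity. So y lies on a segment
   between two points of both A and B, hence in B, and [fixAB] applies. *)
have BOm y : deep S b t y -> p (f y) = f y.
  move=> ty; apply: fixAB.
  have Cv : cone S b (y - t) by apply/coneP.
  have [l l1 Hl] := deep_ray u t Cv.
  have pl : p (f (t + l *: (y - t))) = f (t + l *: (y - t)) by apply/pf/uk.
  have l0 : 0 < l by lra.
  have lv : cone S b (l *: (y - t)) by apply: (@vfaceZ R I n S _ l (y - t) (cone_vface R S b)).
  have tit (x' : AA) : Cvf S x' -> tits S x'.
    by move=> Cx; exists idfun; [exact: weyl_id|exists x' => //; apply: subset_closure].
  have yseg : t + l^-1 *: (l *: (y - t)) = y.
    by rewrite scalerA mulVf ?gt_eqF // scale1r addrC subrK.
  have l01 : 0 <= l^-1 <= 1 by rewrite invr_ge0 ltW //= invf_le1.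
  (* (MAO) asks for ordered endpoints: for a negative germ the segment runs from the far point to
     t. *)
  case: lv => v' Cv' v'E; move: v'E; case Eb : b => v'E.
    have := MAO MM (a := t + l *: (y - t)) (b := t) aA aB iA iB (esym pl) (esym pt).
    have -> : t - (t + l *: (y - t)) = v'.
      by rewrite opprD addrA subrr add0r -v'E /sgnR expr1 scaleN1r opprK.
    move=> /(_ (tit _ Cv')) E.
    have : (f @` segment (t + l *: (y - t)) t) (f y).
      exists y => //; exists (1 - l^-1).
        by rewrite subr_ge0 gerBl; case/andP: l01 => -> ->.
      rewrite opprD addrA subrr add0r scalerN scalerBl scale1r opprB.
      by rewrite addrACA subrr addr0 yseg.
    by rewrite E => -[y' _ <-]; apply: (isom_in MM y' aB iB).
  have := MAO MM (a := t) (b := t + l *: (y - t)) aA aB iA iB (esym pt) (esym pl).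
  have -> : t + l *: (y - t) - t = v'.
    by rewrite addrAC subrr add0r -v'E /sgnR expr0 scale1r.
  move=> /(_ (tit _ Cv')) E.
  have : (f @` segment t (t + l *: (y - t))) (f y).
    exists y => //; exists l^-1 => //.
    by rewrite addrAC subrr add0r yseg.
  by rewrite E => -[y' _ <-]; apply: (isom_in MM y' aB iB).
have iB1 : isom B (p \o f1) by apply: (weyl_iso_isom MM aB piso iA1).
have iB2 := weyl_iso_isom MM aB p2iso iA''.
have [h Wh hE] := isom_rel MM aB iB1 iB2.
have ChE : fmap f'' (face x V) = fmap (p \o f1) (fmap h (face x V)).
  transitivity (fmap (p2 \o f'') (face x V)); last by rewrite hE.
  apply: (fmap_eq_on _ _ Fk2) => [X Y|X Y|y ky] /=; [exact: faceI|exact: faceS|].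
  by rewrite p2f.
have Fch : is_chamber g (fmap h (face x V)) by apply: is_chamber_weyl => //; rewrite -FE.
(* [around] speaks of the coordinates f''; on [Om] the coordinates f1 and p \o f1 agree, which
   translates it into those of A. *)
have Fcl Z : fclosure (fmap h (face x V)) Z -> F0 Z.
  move=> [E FE' EZ].
  have FE2 := faceI FE' Fk2.
  have : fmap f1 F0 (f'' @` closure (h @^-1` E `&` cl k2)).
    apply: around; exists (h @^-1` E `&` cl k2) => //.
    by move=> y cy; exists y.
  rewrite {1}/fmap /= => H; apply: faceS (faceI H F0_Om) => y [[r cr ry] Omy].
  have k2r : cl k2 r.
    rewrite (closure_id (cl k2)).1; last exact: chull_closed.
    by apply: closureS cr => ? [].
  have hr : closure E (h r).
    have : closure (h @^-1` E) r by apply: closureS cr => ? [].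
    have [w1 [q1 [Ww1 _ h1E]]] := Wh.
    move=> /closure_rowP Hc; apply/closure_rowP => e e0.
    have [C C0 HC] := weyl_lip Ww1.
    have [|v Ev ve] := Hc (e / C); first by rewrite divr_gt0.
    exists (w1 v); first by move: Ev; rewrite h1E /= (weylD _ _ Ww1) addrAC.
    by apply: (le_lt_trans (HC _)); rewrite mulrC -ltr_pdivlMr.
  apply: EZ; suff -> : y = h r by [].
  apply: (isom_inj MM aB iB1) => /=; rewrite (BOm _ Omy).
  have := congr1 (fun q => q r) hE; rewrite /= p2f // => <-.
  by rewrite ry.
exists (fmap h (face x V)); split => //; rewrite ChE.
(* Otherwise the chamber would lie in a closed half-apartment opposite to one of those cutting out
   [Om], and so would the panel, which is in the closure of the chamber. *)
have FOm : fmap h (face x V) Om.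
  have [a' [d [Da E]]] := OmE.
  have [[x' [V' [VV' F'E]]] _] := Fch.
  rewrite F'E E; apply: face_finite_and => j.
  have [//|H] := face_trichotomy x' (d j) (Da j) VV'.
  exfalso.
  have clo : F0 (half (\- a' j) (Some (- d j))).
    apply: Fcl; rewrite F'E; exists (half (\- a' j) (Some (- d j))) => //.
    rewrite -(chull_half _ (Delta_opp (Da j))) -(closure_id _).1 //; exact: chull_closed.
  have [e e0 He] := face_near (faceI clo F0_Om).
  have [v Fv_v ve] := vface_small (vface_Fi R S i) e0.
  have [] := He v Fv_v ve; rewrite E => + /(_ j); rewrite /half /= intrN; lra.
have [[x' [V' [VV' F'E]]] _] := Fch.
rewrite F'E in FOm *.
apply: (fmap_eq_on _ _ FOm) => [X Y|X Y|y Oy] /=; [exact: faceI|exact: faceS|].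
exact: BOm.
Qed.

Lemma branching_absurd : False.
Proof.
have iA1 : isom A f1 by apply: (isom_comp MM aA iA); apply: affine_weyl_lin.
have HU : in_apartment apt isom (is_panel g) (fmap f1 F0).
  by exists A, f1, F0; split => //; apply: is_panel_Fi zc.
have [_ /pcard_leP/unsquash h3] := MT HU.
pose Cp := fmap f1 (face z (Cvf S)).
pose Cm := fmap f1 (fmap (fun y => refl S i y + c%:~R *: @vec R n (scoroot S i)) (face z (Cvf S))).
have two Ch : chambers_around g apt isom (fmap f1 F0) Ch -> Ch = Cp \/ Ch = Cm.
  move=> /chamber_in_apartment [F [FFc Fcl ->]].
  by have [->|->] := panel_chambers zc FFc Fcl; [left|right].
have inj j k : (j < 3)%N -> (k < 3)%N -> h3 j = h3 k -> j = k.
  by move=> j3 k3; apply: (inj (f := h3)); rewrite inE.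
have ch j : (j < 3)%N -> h3 j = Cp \/ h3 j = Cm.
  by move=> j3; apply: two; apply: funS.
have := inj 0%N 1%N isT isT; have := inj 0%N 2%N isT isT; have := inj 1%N 2%N isT isT.
have [|->|->] // := ch 0%N; have [|->|->] // := ch 1%N; have [|->|->] // := ch 2%N;
  by move=> H1 H2 H3; first [have := H1 erefl | have := H2 erefl | have := H3 erefl].
Qed.

End Branching.

Lemma discrete_finite_weyl : discrete_for (dtheta S apt isom N b s) orb -> finite_set W.
Proof.
move=> disc; apply: contrapT => Winf.
have [A [f [aA iA sf]]] := sector_germ_isom MM ss.
have [t [ti ot _]] := apartment_vertices MM GG aA0 iA0 G_stab aA iA.
have [e e0 He] := disc _ ot.
have [rho rhoE] := exists_rho S (fun=> 1 : R).
(* The height exceeds 2 N(rho)/e, so that u = rho/ht satisfies 2 N(u) < e, while the root of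
   coefficients m takes the value 1 at u and an integer at t. *)
have [w [i [m [Ww mw htm]]]] := heights_unbounded g (Num.bound (2 * N rho / e)) Winf.
set ht := (\sum_j m j)%N in htm.
have ht0 : 0 < ht%:R :> R by rewrite ltr0n (leq_ltn_trans _ htm).
have htN : 2 * N rho / e < ht%:R.
  apply: lt_trans (archi_boundP _) _; last by rewrite ltr_nat.
  by apply: divr_ge0; [apply: mulr_ge0 => //; apply: is_norm_ge0 NN _|apply: ltW].
pose u := ht%:R^-1 *: rho.
have uE j : al j u = ht%:R^-1 by rewrite formZ rhoE mulr1.
have Nu : N u + N u < e.
  case: (NN) => _ NZ _; rewrite /u NZ ger0_norm ?invr_ge0 ?ltW //.
  have -> : ht%:R^-1 * N rho + ht%:R^-1 * N rho = 2 * N rho / ht%:R by ring.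
  by rewrite ltr_pdivrMr // [ltRHS]mulrC -ltr_pdivrMr.
have Cu : Cvf S u by move=> j; rewrite uE invr_gt0.
have qu : qf S m u = 1.
  rewrite /qf; under eq_bigr do rewrite uE.
  by rewrite -mulr_suml -natr_sum -/ht divff // gt_eqF.
have [w' [Ww' K K']] := weyl_inv Ww.
pose zz := t + sgnR R b *: u.
have zE : w (w' zz) = zz by rewrite K'.
have [c zc] : exists c : int, al i (w' zz) = c%:~R.
  rewrite -mw /= zE /zz -form_qsum formD formZ [form _ u](_ : _ = 1); last by rewrite form_qsum.
  have [c cE] : exists c : int, form (qsum S m) t = c%:~R.
    have [d dE] := choice ti; exists (\sum_j (m j)%:Z * d j).
    by rewrite form_qsum rmorph_sum; apply: eq_bigr => j _; rewrite dE rmorphM.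
  by exists (c + (-1) ^+ b); rewrite intrD rmorphXn /= cE mulr1 /sgnR rmorphN.
apply: (@branching_absurd A f t w i (w' zz) c aA iA sf ti Ww zc).
  move=> j; rewrite zE /zz addrAC subrr add0r sgnRK; exact: Cu.
move=> B p a aB piso aE sB Bz [k [sk kp]] pz; rewrite zE in Bz pz.
have sA : s A by rewrite sf; apply/germ_inftyP; exists 0 => y _; apply: (isom_in MM y aA iA).
have iB := weyl_iso_isom MM aB piso iA.
have oy : orb (p (f t)).
  by rewrite -aE; [apply: (orbit_act GG)|apply: (isom_in MM t aA iA)].
apply: He => //; apply: le_lt_trans Nu.
(* Since p fixes both s and f(zz), the vertices f(t) and p(f(t)) reach f(zz) by the same u, one in A
   and the other in B. *)
apply: (@dtheta_le _ _ _ _ _ _ _ _ _ _ NN _ _ (u, u)).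
split => /=; [exact: subset_closure|exact: subset_closure|].
exists (f zz); split.
  by exists A, f, t; split; [split => //; apply: (isom_model_iso MM)|].
exists B, (p \o f), t; split; first by split => //; apply: (isom_model_iso MM).
split => //=.
rewrite sf; apply/esym.
have gk : germ_infty S b (cl k).
  by move: sk; rewrite sf /fmap /= preimage_image_inj //; apply: (isom_inj MM aA iA).
apply: (fmap_eq_on _ _ gk) => [X Y|X Y|y ky] /=; [exact: germ_inftyI|exact: germ_inftyS|].
by rewrite kp.
Qed.

End Infinite.

Theorem proposition43 (R : realType) (I : finType) (n : nat) (S : rootDatum I n)
    (L : lmodType R[i]) (g : kacMoodyAlgebra S L)
    (M : Type) (apt : set (set M)) (isom : set M -> set ('rV[R]_n -> M))
    (M_masure : masure g apt isom)
    (M_thick : thick_loc_finite g apt isom)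
    (G : groupType) (act : G -> M -> M)
    (G_transitive : strongly_transitive g apt isom act)
    (A0 : set M) (iota : 'rV[R]_n -> M)
    (A0_apt : apt A0) (iota_isom : isom A0 iota)
    (G_stab : stabilizer_induces_weyl_Y S act A0 iota)
    (N : 'rV[R]_n -> R) (N_norm : is_norm N)
    (b : bool) (s : set_system M) (s_germ : sector_germ S apt isom b s) :
  discrete_for (dtheta S apt isom N b s) (orbit_of act (iota 0)) <->
  is_building g apt isom.
Proof.
split=> [disc|[Wfin _ _ _]].
  apply: finite_weyl_building => //.
  exact: (discrete_finite_weyl M_masure M_thick G_transitive A0_apt iota_isom G_stab N_norm s_germ disc).
exact: (finite_weyl_discrete M_masure G_transitive A0_apt iota_isom G_stab N_norm s_germ Wfin).
Qed.
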